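(* Every lamination by hyperbolic Riemann surfaces of a compact space is projective.
   Context: Compact spaces are Hausdorff. A lamination by Riemann surfaces $\mathcal L$ of a space $X$ is a maximal atlas of homeomorphisms $\varphi:U\to \mathbb D\times T$ from open sets $U$ covering $X$ onto the product of the unit disc $\mathbb D\subset\mathbb{C}$ with a topological space $T$, such that the changes of charts have the form $(z,t)\mapsto(z'(z,t),t'(t))$ with $z'$ holomorphic in $z$. The leaves are the Riemann surfaces obtained by gluing the plaques. It is hyperbolic (a lamination by hyperbolic Riemann surfaces) if the universal cover of every leaf is the unit disc. Projective: $\mathcal L$ is projective if the continuous maps $\pi:X\to\mathbb{C}P^N$ ($N$ arbitrary) whose restriction to every leaf is a holomorphic immersion separate the points of $X$, i.e. for all $x\neq y$ in $X$ there is such a $\pi$ with $\pi(x)\neq\pi(y)$. *)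

(* Defs.v *)
From HB Require Import structures.
From mathcomp Require Import all_boot all_order all_algebra.
From mathcomp Require Import generic_quotient.
From mathcomp Require Import all_classical all_reals all_analysis.
From mathcomp Require Import complex.
Set Implicit Arguments.
Unset Strict Implicit.
Unset Printing Implicit Defensive.
Import Order.TTheory GRing.Theory Num.Theory.
Import numFieldNormedType.Exports.
Local Open Scope classical_set_scope.
Local Open Scope ring_scope.
Local Open Scope complex_scope.

(* [R[i]] itself carries no topology in the libraries; its regular module
   [R[i]^o] is a normed module over R[i], with the topology of the modulus.
   [derivable f z 1] is complex differentiability for f defined on it. *)
Notation Cplx R := (R[i]^o) (only parsing).

Definition unit_disc (R : realType) : set (Cplx R) := [set z | `|z| < 1].
Arguments unit_disc R _ : clear implicits.

Definition homeomorphism_between (S T : topologicalType) (A : set S) (B : set T)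
    (f : S -> T) (g : T -> S) : Prop :=
  [/\ set_fun A B f /\ set_fun B A g,
      {in A, cancel f g}, {in B, cancel g f},
      {within A, continuous f} & {within B, continuous g}].

(* [open (V : set (subspace B))], for V `<=` B, says that V is relatively open
   in B. F is the set of sheets over V. *)
Definition covering_map (S T : topologicalType) (A : set S) (B : set T)
    (p : S -> T) : Prop :=
  [/\ {within A, continuous p}, p @` A = B &
      forall y, B y -> exists V : set T,
        [/\ V y, V `<=` B, open (V : set (subspace B)) &
            exists F : set (set S),
              [/\ trivIset F id, A `&` p @^-1` V = \bigcup_(W in F) W &
                  forall W, F W -> open (W : set (subspace A)) /\
                    exists g, homeomorphism_between W V p g]]].

Definition path_in (R : realType) (S : topologicalType) (A : set S)
    (gamma : R -> S) : Prop :=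
  {within `[0, 1], continuous gamma} /\ set_fun `[0, 1] A gamma.

Definition null_homotopic_in (R : realType) (S : topologicalType) (A : set S)
    (gamma : R -> S) : Prop :=
  exists H : R * R -> S,
    [/\ {within `[0, 1] `*` `[0, 1], continuous H},
        set_fun (`[0, 1] `*` `[0, 1]) A H,
        forall t, 0 <= t <= 1 -> H (0, t) = gamma t /\ H (1, t) = gamma 0 &
        forall s, 0 <= s <= 1 -> H (s, 0) = gamma 0 /\ H (s, 1) = gamma 0].

Definition simply_connected (R : realType) (S : topologicalType) (A : set S) :
    Prop :=
  [/\ A !=set0,
      forall x y, A x -> A y ->
        exists gamma : R -> S, [/\ path_in A gamma, gamma 0 = x & gamma 1 = y] &
      forall gamma : R -> S, path_in A gamma -> gamma 0 = gamma 1 ->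
        null_homotopic_in A gamma].

Definition universal_covering (R : realType) (S T : topologicalType)
    (A : set S) (B : set T) (p : S -> T) : Prop :=
  simply_connected R A /\ covering_map A B p.

(* [fb_map] is the chart from the open set [fb_dom] onto D x T and [fb_inv] its
   inverse; they are total functions whose values outside [fb_dom], resp.
   D x T, are irrelevant. *)
Record flow_box (R : realType) (X : topologicalType) := FlowBox {
  fb_dom : set X;
  fb_transversal : topologicalType;
  fb_map : X -> Cplx R * fb_transversal;
  fb_inv : Cplx R * fb_transversal -> X;
  fb_dom_open : open fb_dom;
  fb_homeo : homeomorphism_between fb_dom (unit_disc R `*` setT) fb_map fb_inv
}.
Arguments fb_map {R X} c _ : rename.
Arguments fb_inv {R X} c _ : rename.
Arguments fb_dom {R X} c _ : rename.

Definition change_of_charts (R : realType) (X : topologicalType)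
    (c c' : flow_box R X) :
    Cplx R * fb_transversal c -> Cplx R * fb_transversal c' :=
  fb_map c' \o fb_inv c.
Arguments change_of_charts {R X} c c' _.

(* Changes of charts have the form (z, t) |-> (z'(z, t), t'(t)) locally: a
   plaque of one flow box may meet another flow box along several plaques, so
   that t' need not exist on the whole overlap. *)
Definition compatible (R : realType) (X : topologicalType)
    (c c' : flow_box R X) : Prop :=
  forall z t, unit_disc R z -> fb_dom c' (fb_inv c (z, t)) ->
    derivable (fun w : Cplx R => (change_of_charts c c' (w, t)).1) z 1 /\
    exists tau : fb_transversal c -> fb_transversal c',
      \forall q \near ((z, t) : Cplx R * fb_transversal c),
        (change_of_charts c c' q).2 = tau q.2.

Record lamination (R : realType) (X : topologicalType) := Lamination {
  lam_box :> flow_box R X -> Prop;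
  lam_cover : forall x, exists2 c, lam_box c & fb_dom c x;
  lam_compatible : forall c c', lam_box c -> lam_box c' -> compatible c c';
  lam_maximal : forall c,
    (forall c', lam_box c' -> compatible c c' /\ compatible c' c) -> lam_box c
}.

(* The space X with the topology obtained by gluing the plaques, i.e., the
   final topology for the plaque parametrizations z |-> fb_inv c (z, t). *)
Definition leafwise (R : realType) (X : topologicalType) (L : lamination R X) :
  Type := X.

HB.instance Definition _ (R : realType) (X : topologicalType)
  (L : lamination R X) := Choice.copy (leafwise L) X.

Definition leafwise_open (R : realType) (X : topologicalType)
    (L : lamination R X) : set (set (leafwise L)) :=
  [set O | forall c (t : fb_transversal c), L c ->
     open [set z : Cplx R | unit_disc R z /\ O (fb_inv c (z, t))]].

Lemma open_unit_disc (R : realType) : open (unit_disc R).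
Proof.
have -> : unit_disc R = ball (0 : Cplx R) 1.
  by apply/seteqP; split => z; rewrite /unit_disc -ball_normE /= sub0r normrN.
exact: ball_open.
Qed.

Lemma leafwise_openT (R : realType) (X : topologicalType)
  (L : lamination R X) : leafwise_open (setT : set (leafwise L)).
Proof.
move=> c t Lc.
rewrite (_ : [set z | _] = unit_disc R); first exact: open_unit_disc.
by apply/seteqP; split => z //= [].
Qed.

Lemma leafwise_openI (R : realType) (X : topologicalType)
  (L : lamination R X) : setI_closed (@leafwise_open R X L).
Proof.
move=> A B oA oB c t Lc.
have := openI (oA c t Lc) (oB c t Lc); congr open.
by apply/seteqP; split => z /= => [[[? ?] [? ?]]|[? [? ?]]].
Qed.

Lemma leafwise_open_bigcup (R : realType) (X : topologicalType)
  (L : lamination R X) (I : Type) (f : I -> set (leafwise L)) :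
  (forall i, leafwise_open (f i)) -> leafwise_open (\bigcup_i f i).
Proof.
move=> of_ c t Lc.
have : open (\bigcup_i [set z : Cplx R | unit_disc R z /\ f i (fb_inv c (z, t))]).
  by apply: bigcup_open => i _; exact: of_.
congr open; apply/seteqP; split => z /=.
  by move=> [i _ [? ?]]; split => //; exists i.
by move=> [? [i _ ?]]; exists i.
Qed.

HB.instance Definition _ (R : realType) (X : topologicalType)
  (L : lamination R X) := isOpenTopological.Build (leafwise L)
    (@leafwise_openT R X L) (@leafwise_openI R X L)
    (@leafwise_open_bigcup R X L).

Definition leaf (R : realType) (X : topologicalType) (L : lamination R X)
    (x : leafwise L) : set (leafwise L) :=
  connected_component setT x.

(* Holomorphy of a map from the disc into the leaves, read in the coordinates
   [(fb_map c _).1] of the plaques. Being continuous for the leafwise topology,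
   p stays near w in the plaque of c through p w. *)
Definition leafwise_holomorphic (R : realType) (X : topologicalType)
    (L : lamination R X) (p : Cplx R -> leafwise L) : Prop :=
  {within unit_disc R, continuous p} /\
  forall w c, unit_disc R w -> L c -> fb_dom c (p w) ->
    derivable (fun w' : Cplx R => (fb_map c (p w')).1) w 1.

(* A universal cover of a leaf, with its complex structure, is the disc when
   there is a holomorphic universal covering of the leaf by the disc. *)
Definition hyperbolic (R : realType) (X : topologicalType)
    (L : lamination R X) : Prop :=
  forall x : leafwise L, exists p : Cplx R -> leafwise L,
    universal_covering R (unit_disc R) (leaf x) p /\ leafwise_holomorphic p.

Definition nonzero_vec (R : realType) (N : nat) : set 'rV[Cplx R]_N.+1 :=
  [set v | v != 0].
Arguments nonzero_vec R N _ : clear implicits.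

Definition same_line (R : realType) (N : nat) (u v : nonzero_vec R N) : bool :=
  `[< exists2 a : R[i], a != 0 & val u = a *: val v >].

Lemma same_line_equiv (R : realType) (N : nat) :
  equiv_class_of (@same_line R N).
Proof.
split.
- by move=> u; apply/asboolP; exists 1; rewrite ?oner_neq0 ?scale1r.
- suff sym u v : @same_line R N u v -> same_line v u.
    by move=> u v; apply/idP/idP; exact: sym.
  move=> /asboolP[a a0 uv]; apply/asboolP; exists a^-1; first by rewrite invr_eq0.
  by rewrite uv scalerA mulVf ?scale1r.
- move=> v u w /asboolP[a a0 uv] /asboolP[b b0 vw]; apply/asboolP.
  by exists (a * b); rewrite ?mulf_neq0 // uv vw scalerA.
Qed.

Canonical same_line_equivRel (R : realType) (N : nat) :=
  EquivRelPack (@same_line_equiv R N).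

(* CP^N, with the quotient topology of C^(N+1) \ {0} *)
Definition CP (R : realType) (N : nat) : topologicalType :=
  quotient_topology {eq_quot @same_line R N}%qT.

Definition homogeneous (R : realType) (N : nat) (p : CP R N) :
    'rV[Cplx R]_N.+1 :=
  val (repr (p : quotient_topology {eq_quot @same_line R N}%qT)).

(* The affine chart [v_0 : .. : v_N] |-> (v_j / v_k)_j on {v_k <> 0}; its values
   lie in the affine hyperplane of C^(N+1) where the k-th coordinate is 1. *)
Definition affine_chart (R : realType) (N : nat) (k : 'I_N.+1) (p : CP R N) :
    'rV[Cplx R]_N.+1 :=
  (homogeneous p ord0 k : R[i])^-1 *: homogeneous p.

(* A map from a Riemann surface is an immersion iff its derivative in a local
   coordinate does not vanish. *)
Definition leafwise_holomorphic_immersion (R : realType) (X : topologicalType)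
    (L : lamination R X) (N : nat) (f : X -> CP R N) : Prop :=
  forall c (t : fb_transversal c) z (k : 'I_N.+1), L c -> unit_disc R z ->
    homogeneous (f (fb_inv c (z, t))) ord0 k != 0 ->
    let g := fun w : Cplx R => affine_chart k (f (fb_inv c (w, t))) in
    derivable g z 1 /\ derive1 g z != 0.

Definition projective (R : realType) (X : topologicalType)
    (L : lamination R X) : Prop :=
  forall x y : X, x <> y -> exists (N : nat) (f : X -> CP R N),
    [/\ continuous f, leafwise_holomorphic_immersion L f & f x <> f y].

(* Main.v *)
(* Fix a uniformization p_x of the leaf of every point x by the disc, with
   p_x(0) = x, unique up to rotation. Hyperbolicity and compactness make the set
   of all uniformizations compact for pointwise convergence, as in Brody's
   theorem: a family of uniformizations with unbounded derivatives could be
   rescaled to a nonconstant map from C to a leaf, but such a map lifts to the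
   disc and is constant by the Schwarz lemma.

   For a flow box c, a bump function b supported in it and a constant z1, the
   points of the slice {zc c = z1} lift to uniformly separated subsets of the
   disc, so that for k >= 4 the Poincare series over them converges and defines a
   form f(z) dz^k along the leaves, holomorphic on the leaves and continuous on
   X. For k large such a series is dominated by the term at the lift of the slice
   closest to 0. Hence it separates a given point from another one, and two
   nearby slices yield two forms whose quotient is an immersion near a given
   point. By compactness finitely many pairs of forms suffice, and powers bring
   them to a common weight; together they are the homogeneous coordinates of a
   map to projective space.

   Limits are taken along ultrafilters, the derivative of a form along p is its
   first-order term under p \o mob u, and holomorphic functions are handled
   without power series, through the mean value inequality. *)
Require Import Defs.
From mathcomp Require Import all_boot all_order all_algebra.
From mathcomp Require Import generic_quotient.
From mathcomp Require Import all_classical all_reals all_analysis.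
From mathcomp Require Import complex ring lra.
Local Open Scope classical_set_scope.
Set Implicit Arguments.
Unset Strict Implicit.
Unset Printing Implicit Defensive.
Import Order.TTheory GRing.Theory Num.Theory.
Import numFieldNormedType.Exports.
Local Open Scope ring_scope.
Local Open Scope complex_scope.

(** * Complex modulus and complex derivatives *)

(** A uniformization with a given base point is determined only up to a rotation e, which multiplies
    the value of a form of weight k by e^k. Forms are therefore functions of uniformizations rather
    than of points; only their ratios descend to [X], which is all that projective space requires.

    The quotient of two forms is an immersion where their Wronskian does not vanish. The kernel at a
    lift w has logarithmic derivative 2k conj(w) at 0, so a series dominated by its term at w = 0 is
    almost stationary, and the one of a nearby slice, dominated at some w1 <> 0, is not. The lift w1
    has to be so close to 0, compared with the separation of the slices, that its term beats the
    rest of its series exponentially in k.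

    The weight 4 comes from counting separated points by Euclidean squares: this bounds the sum of
    (1 - |w|)^3, and one further factor makes the tails uniformly small.

    The complex analysis rests on a maximum principle that admits finitely many exceptional points
    where the function is merely bounded. It replaces the removal of singularities, and applied to
    difference quotients it replaces Cauchy's estimates. *)

Notation cj z := (@conjc _ z).

Section Modulus.
Variable R : realType.
Implicit Types (z w : R[i]) (x y : R).

Definition cmod z : R := ComplexField.Normc.normc z.

Lemma norm_cmod z : `|z| = (cmod z)%:C.
Proof. by []. Qed.

Lemma cmodE z : cmod z = Num.sqrt (complex.Re z ^+ 2 + complex.Im z ^+ 2).
Proof. by case: z. Qed.

Lemma cmod_ge0 z : 0 <= cmod z.
Proof. by rewrite cmodE sqrtr_ge0. Qed.

Lemma cmod_sq z : cmod z ^+ 2 = complex.Re z ^+ 2 + complex.Im z ^+ 2.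
Proof. by rewrite cmodE sqr_sqrtr ?addr_ge0 ?sqr_ge0. Qed.

Lemma cmod0 : cmod 0 = 0.
Proof. exact: ComplexField.Normc.normc0. Qed.

Lemma cmod1 : cmod 1 = 1.
Proof. exact: ComplexField.Normc.normc1. Qed.

Lemma cmodM z w : cmod (z * w) = cmod z * cmod w.
Proof. exact: ComplexField.Normc.normcM. Qed.

Lemma cmodV z : cmod z^-1 = (cmod z)^-1.
Proof. exact: ComplexField.Normc.normcV. Qed.

Lemma cmod_div z w : cmod (z / w) = cmod z / cmod w.
Proof. by rewrite cmodM cmodV. Qed.

Lemma cmodN z : cmod (- z) = cmod z.
Proof. exact: (normcN (z : Rcomplex R)). Qed.

Lemma cmodD z w : cmod (z + w) <= cmod z + cmod w.
Proof. exact: (le_normcD (z : Rcomplex R) w). Qed.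

Lemma cmodB z w : cmod (z - w) <= cmod z + cmod w.
Proof. by rewrite -(cmodN w) cmodD. Qed.

Lemma cmodBC z w : cmod (z - w) = cmod (w - z).
Proof. by rewrite -cmodN opprB. Qed.

Lemma cmodX z n : cmod (z ^+ n) = cmod z ^+ n.
Proof. by elim: n => [|n IH]; rewrite ?expr0 ?cmod1 // !exprS cmodM IH. Qed.

Lemma cmod_eq0 z : (cmod z == 0) = (z == 0).
Proof.
apply/eqP/eqP => [/ComplexField.Normc.eq0_normc //|->]; exact: cmod0.
Qed.

Lemma cmod_gt0 z : (0 < cmod z) = (z != 0).
Proof. by rewrite lt_def cmod_ge0 andbT cmod_eq0. Qed.

Lemma cmodC x : cmod x%:C = `|x|.
Proof. by rewrite cmodE /= expr0n addr0 sqrtr_sqr. Qed.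

Lemma cmod_nat n : cmod n%:R = n%:R.
Proof. by rewrite -(rmorph_nat (@real_complex R)) cmodC ger0_norm. Qed.

Lemma cmod_cj z : cmod (cj z) = cmod z.
Proof. by case: z => a b; rewrite !cmodE /= sqrrN. Qed.

Lemma mul_cj z : z * cj z = (cmod z ^+ 2)%:C.
Proof.
rewrite cmod_sq; case: z => a b /=.
by simpc; apply/eqP; rewrite eq_complex /=; apply/andP; split; apply/eqP; ring.
Qed.

Lemma cmod_Re z : `|complex.Re z| <= cmod z.
Proof.
rewrite -(ler_sqr (normr_ge0 _) (cmod_ge0 _)) cmod_sq real_normK ?num_real //.
by rewrite lerDl sqr_ge0.
Qed.

Lemma cmod_Im z : `|complex.Im z| <= cmod z.
Proof.
rewrite -(ler_sqr (normr_ge0 _) (cmod_ge0 _)) cmod_sq real_normK ?num_real //.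
by rewrite lerDr sqr_ge0.
Qed.

Lemma cmod_le z : cmod z <= `|complex.Re z| + `|complex.Im z|.
Proof.
have h : z = (complex.Re z)%:C + 'i%C * (complex.Im z)%:C by rewrite -complexE.
rewrite {1}h; apply: le_trans (cmodD _ _) _.
rewrite cmodM !cmodC ; suff -> : cmod 'i%C = 1 by rewrite mul1r.
by rewrite cmodE /= expr0n expr1n add0r sqrtr1.
Qed.

Lemma cmod_lerB z w : cmod z - cmod w <= cmod (z - w).
Proof. by rewrite lerBlDr -{1}(subrK w z) cmodD. Qed.

Lemma cmod_dist z w v : cmod (z - v) <= cmod (z - w) + cmod (w - v).
Proof. by rewrite -{1}(subrK w z) -addrA cmodD. Qed.

Lemma cmod_sum (I : Type) (s : seq I) (F : I -> R[i]) :
  cmod (\sum_(i <- s) F i) <= \sum_(i <- s) cmod (F i).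
Proof.
elim: s => [|i s IH]; first by rewrite !big_nil cmod0.
by rewrite !big_cons (le_trans (cmodD _ _)) // lerD2l.
Qed.

Lemma cmod_ltC z x : (`|z| < x%:C) = (cmod z < x).
Proof. by rewrite norm_cmod ltcR. Qed.

Lemma cmod_lt1 z : (`|z| < 1) = (cmod z < 1).
Proof. by rewrite -cmod_ltC. Qed.

Lemma unit_discE z : unit_disc R z = (cmod z < 1).
Proof. by rewrite /unit_disc /= cmod_lt1. Qed.

Lemma gt0C (e : R[i]) : 0 < e -> exists2 x : R, 0 < x & e = x%:C.
Proof.
move=> e0; exists (complex.Re e).
  by move: e0; rewrite ltcE /= => /andP[].
by rewrite RRe_real // gtr0_real.
Qed.

Lemma cmod_ball z w x : ball (z : Cplx R) x%:C w <-> cmod (w - z) < x.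
Proof. by rewrite -ball_normE /= norm_cmod ltcR cmodBC. Qed.

Lemma nbhs_cmod z (A : set (Cplx R)) : nbhs (z : Cplx R) A <->
  exists2 e : R, 0 < e & forall w, cmod (w - z) < e -> A w.
Proof.
split.
  move=> /nbhs_ballP[e /= e0 he]; have [x x0 ex] := gt0C e0.
  by exists x => // w hw; apply: he; rewrite ex; apply/cmod_ball.
move=> [e e0 he]; apply/nbhs_ballP; exists e%:C; first by rewrite /= ltcR.
by move=> w /cmod_ball; exact: he.
Qed.

Definition ccont (f : R[i] -> R[i]) z := forall e : R, 0 < e ->
  exists2 d : R, 0 < d & forall w, cmod (w - z) < d -> cmod (f w - f z) < e.

Lemma ccontP f z : ccont f z <-> {for z, continuous (f : Cplx R -> Cplx R)}.
Proof.
split.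
  move=> h A /nbhs_cmod[e e0 hA]; have [d d0 hd] := h e e0.
  by apply/nbhs_cmod; exists d => // w /hd; exact: hA.
move=> h e e0; have /h/nbhs_cmod[d d0 hd] : nbhs (f z : Cplx R)
    [set v | cmod (v - f z) < e] by apply/nbhs_cmod; exists e.
by exists d.
Qed.

Lemma ccont_cst a z : ccont (fun=> a) z.
Proof. by move=> e e0; exists 1 => // w _; rewrite subrr cmod0. Qed.

Lemma ccont_id z : ccont id z.
Proof. by move=> e e0; exists e. Qed.

Lemma ccontD f g z : ccont f z -> ccont g z -> ccont (fun w => f w + g w) z.
Proof.
move=> hf hg e e0; have e2 : 0 < e / 2 by exact: divr_gt0.
have [d d0 hd] := hf _ e2; have [d' d'0 hd'] := hg _ e2.
exists (Num.min d d'); first by rewrite lt_min d0.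
move=> w; rewrite lt_min => /andP[/hd h /hd' h'].
rewrite opprD addrACA; apply: le_lt_trans (cmodD _ _) _; lra.
Qed.

Lemma ccontM f g z : ccont f z -> ccont g z -> ccont (fun w => f w * g w) z.
Proof.
move=> hf hg e e0; pose m := cmod (f z) + cmod (g z) + 1.
have m0 : 0 < m by rewrite ltr_wpDl // addr_ge0 ?cmod_ge0.
pose r := Num.min 1 (e / m / 2).
have r0 : 0 < r by rewrite lt_min ltr01 /= divr_gt0 // divr_gt0.
have [r1 rm] : r <= 1 /\ r <= e / m / 2 by rewrite /r !ge_min !lexx orbT.
have [d d0 hd] := hf _ r0; have [d' d'0 hd'] := hg _ r0.
exists (Num.min d d'); first by rewrite lt_min d0.
move=> w; rewrite lt_min => /andP[/hd h /hd' h'].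
have -> : f w * g w - f z * g z =
  (f w - f z) * (g w - g z) + f z * (g w - g z) + (f w - f z) * g z by ring.
have rme : r * m <= e / 2 by rewrite -ler_pdivlMr // mulrAC.
have a0 := cmod_ge0 (f w - f z); have b0 := cmod_ge0 (g w - g z).
have h1 : cmod (f w - f z) * cmod (g w - g z) <= r * 1.
  by apply: ler_pM => //; [exact: ltW|apply: le_trans r1; exact: ltW].
have h2 : cmod (f z) * cmod (g w - g z) <= r * cmod (f z).
  by rewrite mulrC ler_wpM2r ?cmod_ge0 // ltW.
have h3 : cmod (f w - f z) * cmod (g z) <= r * cmod (g z).
  by rewrite ler_wpM2r ?cmod_ge0 // ltW.
have := cmodD ((f w - f z) * (g w - g z) + f z * (g w - g z)) ((f w - f z) * g z).
have := cmodD ((f w - f z) * (g w - g z)) (f z * (g w - g z)).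
rewrite !cmodM => k1 k2.
have : r * m = r * cmod (f z) + r * cmod (g z) + r * 1 by rewrite -!mulrDr.
lra.
Qed.

Lemma ccontV f z : f z != 0 -> ccont f z -> ccont (fun w => (f w)^-1) z.
Proof.
move=> f0 /ccontP hf; apply/ccontP.
exact: (@continuousV _ _ (f : Cplx R -> Cplx R)).
Qed.

Lemma ccont_comp f g z : ccont g z -> ccont f (g z) -> ccont (f \o g) z.
Proof.
by move=> hg hf e /hf[d d0 hd]; have [t t0 ht] := hg d d0; exists t => // w /ht/hd.
Qed.

Lemma ccont_near f g z (r : R) : 0 < r ->
  (forall w, cmod (w - z) < r -> f w = g w) -> ccont f z -> ccont g z.
Proof.
move=> r0 fg hf e /hf[d d0 hd]; exists (Num.min d r); first by rewrite lt_min d0.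
move=> w; rewrite lt_min => /andP[w1 w2]; rewrite -!fg ?subrr ?cmod0 //; exact: hd.
Qed.

(* Caratheodory's form of complex differentiability *)
Definition cder (f : R[i] -> R[i]) z d := exists phi : R[i] -> R[i],
  [/\ ccont phi z, phi z = d & forall w, f w - f z = phi w * (w - z)].

Lemma cderP f z d : cder f z d <-> forall e : R, 0 < e -> exists2 r : R, 0 < r &
  forall w, cmod (w - z) < r ->
    cmod (f w - f z - d * (w - z)) <= e * cmod (w - z).
Proof.
split.
  move=> [phi [cphi <- hphi]] e e0; have [r r0 hr] := cphi e e0; exists r => // w hw.
  rewrite hphi -mulrBl cmodM ler_wpM2r ?cmod_ge0 // ltW //; exact: hr.
move=> h; pose phi w := if w == z then d else (f w - f z) / (w - z).
exists phi; split; [|by rewrite /phi eqxx|]; last first.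
  move=> w; rewrite /phi; case: (eqVneq w z) => [->|wz]; first by rewrite !subrr mulr0.
  by rewrite divfK // subr_eq0.
move=> e e0; have e2 : 0 < e / 2 by lra.
have [r r0 hr] := h (e / 2) e2.
exists r => // w hw; rewrite /phi eqxx; case: (eqVneq w z) => [_|wz].
  by rewrite subrr cmod0.
have wz0 : w - z != 0 by rewrite subr_eq0.
have -> : (f w - f z) / (w - z) - d = (f w - f z - d * (w - z)) / (w - z).
  by rewrite [RHS]mulrBl mulfK.
rewrite cmod_div ltr_pdivrMr ?cmod_gt0 //; apply: le_lt_trans (hr w hw) _.
by rewrite ltr_pM2r ?cmod_gt0 // ltr_pdivrMr // ltr_pMr // ltr1n.
Qed.

Lemma cder_cont f z d : cder f z d -> ccont f z.
Proof.
move=> [phi [cphi _ hphi]].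
apply: (@ccont_near (fun w => f z + phi w * (w - z)) _ z 1) => //.
  by move=> w _; rewrite -hphi addrC subrK.
apply: ccontD; first exact: ccont_cst.
apply: ccontM => //; apply: ccontD; [exact: ccont_id|exact: ccont_cst].
Qed.

Lemma cder_cst a z : cder (fun=> a) z 0.
Proof.
by exists (fun=> 0); split => //; [exact: ccont_cst|move=> w; rewrite subrr mul0r].
Qed.

Lemma cder_id z : cder id z 1.
Proof. by exists (fun=> 1); split => //; [exact: ccont_cst|move=> w; rewrite mul1r]. Qed.

Lemma cderD f g z d e : cder f z d -> cder g z e -> cder (fun w => f w + g w) z (d + e).
Proof.
move=> [p [cp <- hp]] [q [cq <- hq]]; exists (fun w => p w + q w); split => //.
  exact: ccontD.
by move=> w; rewrite mulrDl -hp -hq; ring.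
Qed.

Lemma cderM f g z d e : cder f z d -> cder g z e ->
  cder (fun w => f w * g w) z (d * g z + f z * e).
Proof.
move=> Hf Hg; have cg := cder_cont Hg; move: Hf Hg.
move=> [p [cp <- hp]] [q [cq <- hq]]; exists (fun w => p w * g w + f z * q w); split => //.
  apply: ccontD; first exact: ccontM.
  by apply: ccontM => //; exact: ccont_cst.
move=> w; have -> : (p w * g w + f z * q w) * (w - z) =
   p w * (w - z) * g w + f z * (q w * (w - z)) by ring.
by rewrite -hp -hq; ring.
Qed.

Lemma cderZ a f z d : cder f z d -> cder (fun w => a * f w) z (a * d).
Proof. by move=> /(cderM (cder_cst a z)); rewrite mul0r add0r. Qed.

Lemma cderN f z d : cder f z d -> cder (fun w => - f w) z (- d).
Proof.
move=> [p [cp <- hp]]; exists (fun w => - p w); split => //.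
  apply: (@ccont_near (fun w => -1 * p w) _ z 1) => //.
    by move=> w _; rewrite mulN1r.
  by apply: ccontM => //; exact: ccont_cst.
by move=> w; rewrite mulNr -hp; ring.
Qed.

Lemma cderB f g z d e : cder f z d -> cder g z e -> cder (fun w => f w - g w) z (d - e).
Proof. by move=> hf /cderN; exact: cderD. Qed.

Lemma cder_comp f g z d e : cder g z e -> cder f (g z) d -> cder (f \o g) z (d * e).
Proof.
move=> Hg; have cg := cder_cont Hg; case: Hg => [q [cq <- hq]] [p [cp <- hp]].
exists (fun w => p (g w) * q w); split => //.
  by apply: ccontM => //; exact: (ccont_comp cg).
by move=> w /=; rewrite hp hq mulrA.
Qed.

Lemma cderV f z d : f z != 0 -> cder f z d -> cder (fun w => (f w)^-1) z (- d / f z ^+ 2).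
Proof.
move=> f0 Hf; have cf := cder_cont Hf; have [r r0 hr] := cf _ (eq_ind_r is_true f0 (cmod_gt0 _)).
have fn0 w : cmod (w - z) < r -> f w != 0.
  move=> /hr h; apply/negP => /eqP fw; move: h.
  by rewrite fw sub0r cmodN ltxx.
case: Hf => p [cp <- hp].
apply/cderP => e e0.
(* Caratheodory's factorization has to hold at every [w]; at the zeros of [f], which stay away from
   [z], the reciprocal is therefore replaced by its value at [z]. *)
have : cder (fun w => if f w == 0 then (f z)^-1 else (f w)^-1) z (- p z / f z ^+ 2).
  exists (fun w => - p w * ((if f w == 0 then 0 else (f w)^-1) * (f z)^-1)); split.
  - apply: ccontM.
      apply: (@ccont_near (fun w => -1 * p w) _ z 1) => //.
        by move=> w _; rewrite mulN1r.
      by apply: ccontM => //; exact: ccont_cst.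
    apply: ccontM; last exact: ccont_cst.
    apply: (@ccont_near (fun w => (f w)^-1) _ z r) => //; last exact: ccontV.
    by move=> w /fn0 /negPf ->.
  - by rewrite (negPf f0) expr2 invfM.
  - move=> w; rewrite (negPf f0); case: ifPn => [_|fw0]; first by rewrite mul0r mulr0 mul0r subrr.
    have -> : - p w * ((f w)^-1 / f z) * (w - z) = - (p w * (w - z)) * ((f w)^-1 / f z) by ring.
    by rewrite -hp; field; rewrite f0.
move=> /cderP /(_ e e0)[t t0 ht]; exists (Num.min t r); first by rewrite lt_min t0.
move=> w; rewrite lt_min => /andP[w1 w2]; have := ht w w1.
by rewrite (negPf f0) (negPf (fn0 w w2)).
Qed.

Lemma cder_near f g z d (r : R) : 0 < r ->
  (forall w, cmod (w - z) < r -> f w = g w) -> cder f z d -> cder g z d.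
Proof.
move=> r0 fg /cderP h; apply/cderP => e e0; have [t t0 ht] := h e e0.
exists (Num.min t r); first by rewrite lt_min t0.
move=> w; rewrite lt_min => /andP[w1 w2]; rewrite -!fg ?subrr ?cmod0 //; exact: ht.
Qed.

Lemma cder_uniq f z d e : cder f z d -> cder f z e -> d = e.
Proof.
move=> /cderP hd /cderP he; apply/eqP; rewrite -subr_eq0; apply/negPn/negP => de.
have c0 : 0 < cmod (d - e) / 4 by rewrite divr_gt0 ?cmod_gt0.
have [r r0 hr] := hd _ c0; have [t t0 ht] := he _ c0.
pose h := Num.min r t / 2; have h0 : 0 < h by rewrite divr_gt0 // lt_min r0.
have hlt : h < Num.min r t by rewrite ltr_pdivrMr // ltr_pMr ?ltr1n // lt_min r0.
move: hlt; rewrite lt_min => /andP[h1 h2].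
pose w := z + h%:C; have wz : w - z = h%:C by rewrite /w addrC addKr.
have mw : cmod (w - z) = h by rewrite wz cmodC gtr0_norm.
have := hr w; have := ht w; rewrite mw => /(_ h2) H1 /(_ h1) H2.
have : cmod ((d - e) * (w - z)) <= cmod (d - e) / 4 * h + cmod (d - e) / 4 * h.
  have -> : (d - e) * (w - z) =
    (f w - f z - e * (w - z)) - (f w - f z - d * (w - z)) by ring.
  exact: le_trans (cmodB _ _) (lerD H1 H2).
rewrite cmodM mw -mulrDl ler_pM2r //; have : 0 < cmod (d - e) by rewrite cmod_gt0.
lra.
Qed.

Lemma cderX f z d n : cder f z d -> exists e, cder (fun w => f w ^+ n) z e.
Proof.
move=> hf; elim: n => [|n [e IH]]; first by exists 0; exact: cder_cst.
exists (d * f z ^+ n + f z * e); have := cderM hf IH.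
by apply: (@cder_near _ _ z _ 1) => // w _; rewrite exprS.
Qed.

Lemma cder_aff a b z : cder (fun w => a * w + b) z a.
Proof.
by have := cderD (cderZ a (cder_id z)) (cder_cst b z); rewrite mulr1 addr0.
Qed.

Lemma cder_lip f z d : cder f z d -> exists2 r : R, 0 < r &
  forall w, cmod (w - z) < r -> cmod (f w - f z) <= (cmod d + 1) * cmod (w - z).
Proof.
move=> [p [cp <- hp]]; have [r r0 hr] := cp 1 ltr01; exists r => // w /hr h.
rewrite hp cmodM ler_wpM2r ?cmod_ge0 //.
by rewrite -[p w](subrK (p z)) addrC (le_trans (cmodD _ _)) // lerD2l ltW.
Qed.

End Modulus.

(** * The mean value inequality *)

Section Goursat.
Variable R : realType.

Lemma real_prim (h : R -> R) (a : R) : continuous h ->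
  exists H : R -> R, forall x, a < x -> is_derive x 1 H (h x).
Proof.
move=> ch; pose F x := (\int[lebesgue_measure]_(t in `[a, x]) h t)%R.
exists F => x ax.
have xu : x < x + 1 by rewrite ltrDl.
have hi : lebesgue_measure.-integrable `[a, x + 1] (EFin \o h).
  apply: continuous_compact_integrable; first exact: segment_compact.
  by apply: continuous_subspaceT => ? ?; exact: ch.
have [D1 D2] := @continuous_FTC1_closed R h a x (x + 1) xu hi ax (ch x).
by apply: DeriveDef => //; rewrite -derive1E.
Qed.

(** The mean value theorem for [H] minus a primitive [Q] of the affine approximation of [h]. *)
Lemma edge_estimate (H h : R -> R) (a b c p q e : R) : a <= b ->
  (forall x, a <= x <= b -> is_derive x 1 H (h x)) ->
  (forall x, a <= x <= b -> `|h x - (p + q * (x - c))| <= e) ->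
  `|H b - H a - (p * (b - a) + q * ((b - c) ^+ 2 - (a - c) ^+ 2) / 2)| <= e * (b - a).
Proof.
move=> ab dH he.
pose Q x : R := p * x + (q / 2) * (x - c) ^+ 2.
have dQ (x : R) : is_derive x 1 (H \- Q) (h x - (p + q * (x - c))) \/ ~ (a <= x <= b).
  case: (boolP (a <= x <= b)) => [xab|]; last by move=> h1; right; apply/negP.
  left; have := dH x xab => ?.
  have dq : is_derive x 1 Q (p + q * (x - c)).
    rewrite /Q; apply: is_derive_eq.
    rewrite ?scaler0 ?add0r ?addr0 ?subr0 ?scaler1 /GRing.scale /=.
    by field.
  exact: is_deriveB.
have dQ' (x : R) : a <= x <= b -> is_derive x 1 (H \- Q) (h x - (p + q * (x - c))).
  by move=> xab; case: (dQ x).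
have cQ : {within `[a, b], continuous (H \- Q)}.
  apply: derivable_within_continuous => x; rewrite in_itv /= => hx.
  exact: (@ex_derive _ _ _ _ _ _ _ (dQ' x hx)).
have dQo (x : R) : x \in `]a, b[ -> is_derive x 1 (H \- Q) (h x - (p + q * (x - c))).
  by move=> /subset_itv_oo_cc; rewrite in_itv; exact: dQ'.
have [x xab] := MVT_segment ab dQo cQ; rewrite in_itv /= in xab.
have -> : (H \- Q) b - (H \- Q) a =
   H b - H a - (p * (b - a) + q * ((b - c) ^+ 2 - (a - c) ^+ 2) / 2).
  by rewrite /Q /=; field.
move=> ->; rewrite normrM (ger0_norm (_ : 0 <= b - a)) ?subr_ge0 //.
by rewrite ler_wpM2r ?subr_ge0 // he.
Qed.

Lemma nested (s e : nat -> R) : (forall n, 0 <= e n) ->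
  (forall n, s n <= s n.+1) -> (forall n, s n.+1 + e n.+1 <= s n + e n) ->
  exists x, forall n, s n <= x <= s n + e n.
Proof.
move=> e0 s1 s2.
have sm m n : (m <= n)%N -> s m <= s n.
  by move=> /subnK <-; elim: (n - m)%N => // k IH; rewrite addSn (le_trans IH).
have em m n : (m <= n)%N -> s n + e n <= s m + e m.
  by move=> /subnK <-; elim: (n - m)%N => // k IH; rewrite addSn (le_trans (s2 _)).
have ub m n : s n <= s m + e m.
  have := sm n (maxn m n) (leq_maxr _ _); have := em m (maxn m n) (leq_maxl _ _).
  have := e0 (maxn m n); lra.
have hs : has_sup (range s).
  split; first by exists (s 0%N), 0%N.
  by exists (s 0%N + e 0%N) => _ [n _ <-].
exists (sup (range s)) => n; apply/andP; split.
  by apply: sup_upper_bound => //; exists n.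
by apply: ge_sup; [exists (s 0%N), 0%N|move=> _ [m _ <-]].
Qed.

Variables (u v : R -> R -> R) (A : R) (U V : R -> R -> R).
Hypothesis dU : forall s t, A < s -> is_derive s 1 (U ^~ t) (u s t).
Hypothesis dV : forall s t, A < t -> is_derive t 1 (V s) (v s t).

(** The integral of the form u ds + v dt along the boundary of a rectangle, written with the partial
    primitives [U] and [V]. *)
Definition circulation s0 s1 t0 t1 : R :=
  (U s1 t0 - U s0 t0) - (U s1 t1 - U s0 t1) + (V s1 t1 - V s1 t0) - (V s0 t1 - V s0 t0).

(** The common mixed coefficient [b] says that the form u ds + v dt is closed, in the sense of
    pointwise derivatives, as in Goursat's lemma. *)
Hypothesis closed : forall x y, exists a b c : R, forall e : R, 0 < e ->
  exists2 d : R, 0 < d & forall s t, `|s - x| < d -> `|t - y| < d ->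
    `|u s t - (u x y + a * (s - x) + b * (t - y))| <= e * (`|s - x| + `|t - y|) /\
    `|v s t - (v x y + b * (s - x) + c * (t - y))| <= e * (`|s - x| + `|t - y|).

(** The affine part of the form is closed because of the common coefficient [b], so its circulation
    vanishes; each of the four edges leaves an error of at most e (p + q) times its length. *)
Lemma circulation_small x y e : 0 < e -> exists2 d : R, 0 < d &
  forall s t p q : R, A < s -> A < t -> 0 <= p < d -> 0 <= q < d -> s <= x <= s + p ->
   t <= y <= t + q -> `|circulation s (s + p) t (t + q)| <= 2 * e * (p + q) ^+ 2.
Proof.
move=> e0; have [a [b [c hc]]] := closed x y; have [d d0 hd] := hc e e0.
exists d => // s t p q As At /andP[p0 pd] /andP[q0 qd] /andP[sx xs] /andP[ty yt].
have sp : s <= s + p by rewrite lerDl.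
have tq : t <= t + q by rewrite lerDl.
have near s' t' : s <= s' <= s + p -> t <= t' <= t + q ->
  [/\ `|u s' t' - (u x y + a * (s' - x) + b * (t' - y))| <= e * (p + q) &
     `|v s' t' - (v x y + b * (s' - x) + c * (t' - y))| <= e * (p + q)].
  move=> /andP[h1 h2] /andP[h3 h4].
  have k1 : `|s' - x| <= p by rewrite ler_norml; apply/andP; split; lra.
  have k2 : `|t' - y| <= q by rewrite ler_norml; apply/andP; split; lra.
  have [l1 l2] := hd s' t' (le_lt_trans k1 pd) (le_lt_trans k2 qd).
  by split; [apply: (le_trans l1)|apply: (le_trans l2)]; rewrite ler_pM2l //; lra.
have hU t' : t <= t' <= t + q -> `|U (s + p) t' - U s t' - ((u x y + b * (t' - y)) * p
    + a * ((s + p - x) ^+ 2 - (s - x) ^+ 2) / 2)| <= e * (p + q) * p.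
  move=> ht; have := @edge_estimate (U ^~ t') (u ^~ t') s (s + p) x (u x y + b * (t' - y)) a
    (e * (p + q)) sp; rewrite (_ : s + p - s = p); last by ring.
  apply.
    by move=> s' /andP[h _]; apply: dU; lra.
  move=> s' hs; have [l1 _] := near s' t' hs ht.
  by rewrite (_ : _ + _ * (s' - x) = u x y + a * (s' - x) + b * (t' - y)) //; ring.
have hV s' : s <= s' <= s + p -> `|V s' (t + q) - V s' t - ((v x y + b * (s' - x)) * q
    + c * ((t + q - y) ^+ 2 - (t - y) ^+ 2) / 2)| <= e * (p + q) * q.
  move=> hs; have := @edge_estimate (V s') (v s') t (t + q) y (v x y + b * (s' - x)) c
    (e * (p + q)) tq; rewrite (_ : t + q - t = q); last by ring.
  apply.
    by move=> t' /andP[h _]; apply: dV; lra.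
  by move=> t' ht; have [_ l2] := near s' t' hs ltac:(lra).
have hU0 := hU t ltac:(lra); have hU1 := hU (t + q) ltac:(lra).
have hV0 := hV s ltac:(lra); have hV1 := hV (s + p) ltac:(lra).
move: hU0 hU1 hV0 hV1; rewrite /circulation.
set X1 := (X in `|X| <= _ -> _); move=> H1.
set X2 := (X in `|X| <= _ -> _); move=> H2.
set X3 := (X in `|X| <= _ -> _); move=> H3.
set X4 := (X in `|X| <= _ -> _); move=> H4.
set Y := (X in `|X| <= _).
have -> : Y = X1 - X2 + X4 - X3 by rewrite /X1 /X2 /X3 /X4 /Y; field.
apply: (@le_trans _ _ (`|X1| + `|X2| + `|X4| + `|X3|)).
  apply: le_trans (ler_normB _ _) _; rewrite lerD2r.
  by apply: le_trans (ler_normD _ _) _; rewrite lerD2r ler_normB.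
have -> : 2 * e * (p + q) ^+ 2 = e * (p + q) * p + e * (p + q) * p + e * (p + q) * q +
  e * (p + q) * q by ring.
lra.
Qed.

(** Goursat's bisection: among the four quarters of a rectangle one carries at least a quarter of
    the circulation. At the common point of the nested rectangles this contradicts the quadratic
    smallness of the circulation. *)
Lemma circulation_eq0 s0 s1 t0 t1 : A < s0 -> A < t0 -> s0 <= s1 -> t0 <= t1 ->
  circulation s0 s1 t0 t1 = 0.
Proof.
move=> As At s01 t01; set J := circulation _ _ _ _.
pose p n := (s1 - s0) / 2 ^+ n; pose q n := (t1 - t0) / 2 ^+ n.
have pS n : p n = p n.+1 + p n.+1 by rewrite /p exprS; field; rewrite expf_neq0.
have qS n : q n = q n.+1 + q n.+1 by rewrite /q exprS; field; rewrite expf_neq0.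
have p0 n : 0 <= p n by rewrite divr_ge0 ?subr_ge0 // exprn_ge0.
have q0 n : 0 <= q n by rewrite divr_ge0 ?subr_ge0 // exprn_ge0.
pose K n (z : R * R) := `|circulation z.1 (z.1 + p n) z.2 (z.2 + q n)|.
have n4 (a b c d : R) : `|a + b + c + d| <= `|a| + `|b| + `|c| + `|d|.
  apply: le_trans (ler_normD _ _) _; rewrite lerD2r.
  apply: le_trans (ler_normD _ _) _; rewrite lerD2r; exact: ler_normD.
have step (nz : nat * (R * R)) : exists z' : R * R,
   [/\ nz.2.1 <= z'.1, z'.1 + p nz.1.+1 <= nz.2.1 + p nz.1, nz.2.2 <= z'.2,
     z'.2 + q nz.1.+1 <= nz.2.2 + q nz.1 & K nz.1 nz.2 <= 4 * K nz.1.+1 z'].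
  case: nz => n [s t] /=; rewrite (pS n) (qS n).
  have Pn := p0 n.+1; have Qn := q0 n.+1; move: Pn Qn.
  pose P := p n.+1; pose Q := q n.+1; rewrite -/P -/Q => Pn Qn.
  have : K n (s, t) <= K n.+1 (s, t) + K n.+1 (s + P, t) + K n.+1 (s, t + Q) + K n.+1 (s + P, t + Q).
    rewrite /K /= (pS n) (qS n) -/P -/Q.
    apply: le_trans (n4 _ _ _ _).
    rewrite le_eqVlt; apply/orP; left; apply/eqP; congr (`|_|).
    by rewrite /circulation !addrA; ring.
  case: (leP (K n (s, t)) (4 * K n.+1 (s, t))) => h1; first by exists (s, t); split => //=; lra.
  case: (leP (K n (s, t)) (4 * K n.+1 (s + P, t))) => h2; first by exists (s + P, t); split => //=; lra.
  case: (leP (K n (s, t)) (4 * K n.+1 (s, t + Q))) => h3; first by exists (s, t + Q); split => //=; lra.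
  case: (leP (K n (s, t)) (4 * K n.+1 (s + P, t + Q))) => h4; first by exists (s + P, t + Q); split => //=; lra.
  move=> h5; exfalso; lra.
have [f hf] := choice step.
pose z := fix z n : R * R := if n is m.+1 then f (m, z m) else (s0, t0).
have hz n := hf (n, z n).
have hK n : `|J| <= 4 ^+ n * K n (z n).
  elim: n => [|n IH].
    rewrite expr0 mul1r /K /= /p /q !expr0 !divr1 /J.
    by rewrite [s0 + _]addrC [t0 + _]addrC !subrK.
  apply: (le_trans IH); rewrite exprSr -mulrA ler_pM2l ?exprn_gt0 //.
  by have [] := hz n.
have [x hx] : exists x, forall n, (z n).1 <= x <= (z n).1 + p n.
  by apply: nested => // n; have [] := hz n.
have [y hy] : exists y, forall n, (z n).2 <= y <= (z n).2 + q n.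
  by apply: nested => // n; have [] := hz n.
have zA n : A < (z n).1 /\ A < (z n).2.
  elim: n => [//|n [IH1 IH2]]; have [h1 _ h2 _ _] := hz n; split => /=.
    exact: lt_le_trans IH1 h1.
  exact: lt_le_trans IH2 h2.
apply/eqP; rewrite -normr_le0; apply/ler_addgt0Pl => e e0; rewrite addr0.
pose M := (s1 - s0) + (t1 - t0) + 1.
have M0 : 0 < M by rewrite /M; lra.
have e1 : 0 < e / (2 * M ^+ 2) by rewrite divr_gt0 // mulr_gt0 ?exprn_gt0.
have [d d0 hd] := circulation_small x y e1.
have [n hn] : exists n : nat, M / 2 ^+ n < d.
  have [n hn] : exists n : nat, M / d < n%:R.
    exists (Num.bound (M / d)); apply: archi_boundP.
    by rewrite divr_ge0 // ltW.
  exists n; rewrite ltr_pdivrMr ?exprn_gt0 // mulrC -ltr_pdivrMr //.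
  by apply: (lt_trans hn); rewrite -natrX ltr_nat ltn_expl.
have pq w : 0 <= w -> w <= M -> 0 <= w / 2 ^+ n < d.
  move=> w0 wM; rewrite divr_ge0 ?exprn_ge0 //=; apply: le_lt_trans hn.
  by rewrite ler_pM2r ?invr_gt0 ?exprn_gt0.
have [zA1 zA2] := zA n.
have := hd _ _ (p n) (q n) zA1 zA2 (pq _ _ _) (pq _ _ _) (hx n) (hy n).
rewrite !subr_ge0 => /(_ s01 _ t01 _) h.
have {}h := h ltac:(rewrite /M; lra) ltac:(rewrite /M; lra).
apply: (le_trans (hK n)).
apply: (@le_trans _ _ (4 ^+ n * (2 * (e / (2 * M ^+ 2)) * (p n + q n) ^+ 2))).
  by rewrite ler_pM2l ?exprn_gt0.
have -> : 4 ^+ n * (2 * (e / (2 * M ^+ 2)) * (p n + q n) ^+ 2) =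
   e * ((M - 1) / M) ^+ 2.
  rewrite /p /q -mulrDl; have -> : s1 - s0 + (t1 - t0) = M - 1 by rewrite /M; ring.
  have -> : (4 : R) ^+ n = (2 ^+ n) ^+ 2 by rewrite -exprM mulnC exprM; congr (_ ^+ n); ring.
  by field; rewrite expf_neq0 //= gt_eqF.
apply: ler_piMr; first exact: ltW.
apply: exprn_ile1; first by rewrite divr_ge0 ?(ltW M0) // /M; lra.
by rewrite ler_pdivrMr // mul1r lerBlDr lerDl.
Qed.

End Goursat.

Section MeanValue.
Variable R : realType.

Lemma ccont_pair (T : topologicalType) (f g : T -> R) (x : T) :
  {for x, continuous f} -> {for x, continuous g} ->
  {for x, continuous (fun y => f y +i* g y : Cplx R)}.
Proof.
move=> cf cg A /nbhs_cmod[e e0 hA].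
have e2 : 0 < e / 2 by lra.
have hf : nbhs x (f @^-1` ball (f x) (e / 2)) by apply: cf; exact: nbhsx_ballx.
have hg : nbhs x (g @^-1` ball (g x) (e / 2)) by apply: cg; exact: nbhsx_ballx.
apply: (@filterS _ (nbhs x) _ _ _ _ (filterI hf hg)) => y [h1 h2].
apply: hA; apply: le_lt_trans (cmod_le _) _ => /=.
move: h1 h2; rewrite -!ball_normE /= => h1 h2.
by rewrite (distrC (f y)) (distrC (g y)) [e]splitr ltrD.
Qed.

Lemma ccont_Re (T : topologicalType) (f : T -> Cplx R) (x : T) :
  {for x, continuous f} -> {for x, continuous (fun y => complex.Re (f y))}.
Proof.
move=> cf A /nbhs_ballP[e /= e0 hA].
have : nbhs (f x) [set w | cmod (w - f x) < e] by apply/nbhs_cmod; exists e.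
move=> /cf h0; apply: (@filterS _ (nbhs x) _ _ _ _ h0) => y /= h; apply: hA; rewrite -ball_normE /=.
apply: le_lt_trans h; apply: le_trans (cmod_Re _).
by rewrite distrC; case: (f y) => ? ?; case: (f x).
Qed.

Lemma ccont_Im (T : topologicalType) (f : T -> Cplx R) (x : T) :
  {for x, continuous f} -> {for x, continuous (fun y => complex.Im (f y))}.
Proof.
move=> cf A /nbhs_ballP[e /= e0 hA].
have : nbhs (f x) [set w | cmod (w - f x) < e] by apply/nbhs_cmod; exists e.
move=> /cf h0; apply: (@filterS _ (nbhs x) _ _ _ _ h0) => y /= h; apply: hA; rewrite -ball_normE /=.
apply: le_lt_trans h; apply: le_trans (cmod_Im _).
by rewrite distrC; case: (f y) => ? ?; case: (f x).
Qed.

Lemma cont_fst (f : R -> R) (x y : R) : {for x, continuous f} ->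
  {for (x, y), continuous (fun p : R * R => f p.1)}.
Proof. by move=> h; apply: (@continuous_comp _ _ _ fst f); [exact: cvg_fst|]. Qed.

Lemma cont_snd (f : R -> R) (x y : R) : {for y, continuous f} ->
  {for (x, y), continuous (fun p : R * R => f p.2)}.
Proof. by move=> h; apply: (@continuous_comp _ _ _ snd f); [exact: cvg_snd|]. Qed.

(* [s in [0, +oo[] and t are polar coordinates of the unit disc with radius
   1 / (1 + s^2); the form [F(z) dz / (i z)] pulls back to [F (dt - i rho ds)]. *)
Let g (s : R) : R := (1 + s ^+ 2)^-1.
Let rho (s : R) : R := - 2 * s / (1 + s ^+ 2).
Let e (t : R) : R[i] := cos t +i* sin t.
Let z (s t : R) : R[i] := (g s)%:C * e t.

Let g_gt0 s : 0 < 1 + s ^+ 2 :> R.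
Proof. by rewrite ltr_wpDr ?sqr_ge0. Qed.

Let g_neq0 s : 1 + s ^+ 2 != 0 :> R.
Proof. by rewrite gt_eqF. Qed.

Let cmod_z s t : cmod (z s t) = g s.
Proof.
rewrite /z cmodM cmodC cmodE /= cos2Dsin2 sqrtr1 mulr1 ger0_norm //.
by rewrite invr_ge0 ltW.
Qed.

Let cont_den (x : R) : {for x, continuous (fun s : R => 1 + s ^+ 2)}.
Proof.
apply: continuousD; first exact: cst_continuous.
exact: exprn_continuous.
Qed.

Let cont_inv (x : R) : {for x, continuous g}.
Proof. by apply: continuousV => //; exact: cont_den. Qed.

(** Caratheodory's factorization in two real variables: the coefficients are continuous at (x, y),
    where their values are the partial derivatives rho z and i z. *)
Let z_expand x y : exists al be : R * R -> Cplx R,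
  [/\ {for (x, y), continuous al}, {for (x, y), continuous be},
      al (x, y) = (rho x)%:C * z x y, be (x, y) = 'i%C * z x y &
      forall s t, z s t - z x y = al (s, t) * (s - x)%:C + be (s, t) * (t - y)%:C].
Proof.
have [kc [kc1 kc2 kc3]] := (is_derive1_caratheodory _ _ _).1 (is_derive_cos y).
have [ks [ks1 ks2 ks3]] := (is_derive1_caratheodory _ _ _).1 (is_derive_sin y).
pose ga (s : R) := - (s + x) * g s * g x.
exists (fun p => (ga p.1 * cos p.2) +i* (ga p.1 * sin p.2)).
exists (fun p => (g x * kc p.2) +i* (g x * ks p.2)).
have cga : {for (x, y), continuous (fun p : R * R => ga p.1)}.
  apply: cont_fst; apply: continuousM; last exact: cst_continuous.
  apply: continuousM; last exact: cont_inv.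
  apply: continuousN; apply: continuousD; [exact: cvg_id|exact: cst_continuous].
split.
- by apply: ccont_pair; apply: continuousM => //; apply: cont_snd;
    [exact: continuous_cos|exact: continuous_sin].
- by apply: ccont_pair; apply: continuousM; rewrite ?/continuous_at; try exact: cst_continuous;
    exact: cont_snd.
- rewrite /z /rho /ga /e /g /=; simpc; apply/eqP; rewrite eq_complex /=.
  by apply/andP; split; apply/eqP; field.
- rewrite /z /e kc3 ks3 /=; simpc; apply/eqP; rewrite eq_complex /=.
  by apply/andP; split; apply/eqP; ring.
- move=> s t; rewrite /z /e /ga; simpc; apply/eqP; rewrite eq_complex /=.
  have -> : cos t = cos y + kc t * (t - y) by rewrite -kc1 addrC subrK.
  have -> : sin t = sin y + ks t * (t - y) by rewrite -ks1 addrC subrK.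
  by rewrite /g; apply/andP; split; apply/eqP; field; rewrite !g_neq0.
Qed.

Variables (F : R[i] -> R[i]).
Hypothesis F_der : forall z, cmod z <= 1 -> exists d, cder F z d.

(** u ds + v dt is the real part of the form F (dt - i rho ds). *)
Let v (s t : R) : R := complex.Re (F (z s t)).
Let u (s t : R) : R := rho s * complex.Im (F (z s t)).

Let Fz_expand x y : exists d, exists P1 P2 : R * R -> Cplx R,
  [/\ {for (x, y), continuous P1}, {for (x, y), continuous P2},
      P1 (x, y) = d * ((rho x)%:C * z x y), P2 (x, y) = d * ('i%C * z x y) &
      forall s t, F (z s t) - F (z x y) = P1 (s, t) * (s - x)%:C + P2 (s, t) * (t - y)%:C].
Proof.
have [al [be [cal cbe al0 be0 hz]]] := z_expand x y.
have [d [phi [cphi phid hphi]]] : exists d, cder F (z x y) d.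
  by apply: F_der; rewrite cmod_z /g invf_le1 // lerDl sqr_ge0.
pose Z (p : R * R) : Cplx R := z p.1 p.2.
have cZ : {for (x, y), continuous Z}.
  have h : Z = fun p => al p * (p.1 - x)%:C + be p * (p.2 - y)%:C + z x y.
    by apply/funext => -[s t]; rewrite /Z /= -hz subrK.
  rewrite h; apply: continuousD; last exact: cst_continuous.
  have creal (f : R * R -> R) : {for (x, y), continuous f} ->
     {for (x, y), continuous (fun p => (f p)%:C : Cplx R)}.
    by move=> cf; apply: (@ccont_pair _ f (fun=> 0)) => //; exact: cst_continuous.
  have c1 : {for (x, y), continuous (fun p : R * R => (p.1 - x)%:C : Cplx R)}.
    apply: creal; apply: (@cont_fst (fun s => s - x)).
    by apply: continuousB; [exact: cvg_id|exact: cst_continuous].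
  have c2 : {for (x, y), continuous (fun p : R * R => (p.2 - y)%:C : Cplx R)}.
    apply: creal; apply: (@cont_snd (fun s => s - y)).
    by apply: continuousB; [exact: cvg_id|exact: cst_continuous].
  exact: (continuousD (continuousM cal c1) (continuousM cbe c2)).
have cp : {for (x, y), continuous (fun p => phi (Z p) : Cplx R)}.
  move=> A /nbhs_cmod[eps eps0 hA]; have [r r0 hr] := cphi eps eps0.
  have h : nbhs (Z (x, y)) [set w | cmod (w - Z (x, y)) < r] by apply/nbhs_cmod; exists r.
  by apply: (@filterS _ (nbhs (x, y)) _ _ _ _ (cZ _ h)) => p /= hp; apply: hA; exact: hr.
exists d, (fun p => phi (Z p) * al p), (fun p => phi (Z p) * be p); split.
- exact: (continuousM cp cal).
- exact: (continuousM cp cbe).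
- by rewrite al0 /Z /= phid.
- by rewrite be0 /Z /= phid.
- by move=> s t; rewrite hphi hz /Z /=; ring.
Qed.

Let near_pair (x y eps : R) (h : R * R -> R) : {for (x, y), continuous h} -> 0 < eps ->
  exists2 d : R, 0 < d & forall s t, `|s - x| < d -> `|t - y| < d -> `|h (s, t) - h (x, y)| < eps.
Proof.
move=> ch e0; have /ch : nbhs (h (x, y)) (ball (h (x, y)) eps) by exact: nbhsx_ballx.
move=> /nbhs_ballP[d /= d0 hd]; exists d => // s t hs ht.
have /hd : ball (x, y) d (s, t) by split; rewrite -ball_normE /= distrC.
by rewrite /= -ball_normE /= distrC.
Qed.

Let closed_form x y : exists a b c : R, forall e : R, 0 < e ->
  exists2 d : R, 0 < d & forall s t, `|s - x| < d -> `|t - y| < d ->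
    `|u s t - (u x y + a * (s - x) + b * (t - y))| <= e * (`|s - x| + `|t - y|) /\
    `|v s t - (v x y + b * (s - x) + c * (t - y))| <= e * (`|s - x| + `|t - y|).
Proof.
have [d [P1 [P2 [c1 c2 p1 p2 hF]]]] := Fz_expand x y.
(* The difference quotient of [rho] between [s] and [x]. *)
pose sg (s : R) := - 2 * (1 - s * x) * g s * g x.
have csg : {for (x, y), continuous (fun p : R * R => sg p.1)}.
  apply: cont_fst; apply: continuousM; last exact: cst_continuous.
  apply: continuousM; last exact: cont_inv.
  apply: continuousM; first exact: cst_continuous.
  apply: continuousB; first exact: cst_continuous.
  apply: continuousM; [exact: cvg_id|exact: cst_continuous].
have crho : {for (x, y), continuous (fun p : R * R => rho p.1)}.
  apply: cont_fst; apply: continuousM; last exact: cont_inv.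
  apply: continuousM; [exact: cst_continuous|exact: cvg_id].
pose U1 p := rho p.1 * complex.Im (P1 p) + sg p.1 * complex.Im (F (z x y)).
pose U2 p := rho p.1 * complex.Im (P2 p).
have cI1 := ccont_Im c1; have cI2 := ccont_Im c2.
have cU1 : {for (x, y), continuous U1}.
  have c0 : {for (x, y), continuous (fun _ : R * R => complex.Im (F (z x y)))}.
    exact: cst_continuous.
  exact: (continuousD (continuousM crho cI1) (continuousM csg c0)).
have cU2 : {for (x, y), continuous U2} by exact: (continuousM crho cI2).
have cV1 := ccont_Re c1; have cV2 := ccont_Re c2.
have hu s t : u s t - u x y = U1 (s, t) * (s - x) + U2 (s, t) * (t - y).
  have hi : complex.Im (F (z s t)) = complex.Im (F (z x y)) + complex.Im (P1 (s, t)) * (s - x)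
       + complex.Im (P2 (s, t)) * (t - y).
    have -> : F (z s t) = F (z x y) + (P1 (s, t) * (s - x)%:C + P2 (s, t) * (t - y)%:C).
      by rewrite -hF addrC subrK.
    case: (F (z x y)) => ? ?; case: (P1 (s, t)) => ? ?; case: (P2 (s, t)) => ? ? /=.
    by ring.
  rewrite /u /U1 /U2 hi /sg /rho /g /=; field.
  by rewrite !g_neq0.
have hv s t : v s t - v x y = complex.Re (P1 (s, t)) * (s - x) + complex.Re (P2 (s, t)) * (t - y).
  rewrite /v; have -> : F (z s t) = F (z x y) + (P1 (s, t) * (s - x)%:C + P2 (s, t) * (t - y)%:C).
    by rewrite -hF addrC subrK.
  case: (F (z x y)) => ? ?; case: (P1 (s, t)) => ? ?; case: (P2 (s, t)) => ? ? /=.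
  by ring.
exists (U1 (x, y)), (U2 (x, y)), (complex.Re (P2 (x, y))) => eps eps0.
have [d1 d10 h1] := near_pair cU1 eps0.
have [d2 d20 h2] := near_pair cU2 eps0.
have [d3 d30 h3] := near_pair cV1 eps0.
have [d4 d40 h4] := near_pair cV2 eps0.
(* The Cauchy-Riemann equations: the two mixed coefficients are rho Im (i d z) and Re (d rho z). *)
have hb : U2 (x, y) = complex.Re (P1 (x, y)).
  rewrite /U2 p1 p2 /=; case: (d) => a b; case: (z x y) => a' b' /=.
  by ring.
exists (Num.min (Num.min d1 d2) (Num.min d3 d4)); first by rewrite !lt_min d10 d20 d30.
move=> s t; rewrite !lt_min => /andP[/andP[s1 s2] /andP[s3 s4]] /andP[/andP[t1 t2] /andP[t3 t4]].
have fin (a b a' b' X X' : R) : X - X' = a * (s - x) + b * (t - y) ->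
   `|a - a'| < eps -> `|b - b'| < eps ->
   `|X - (X' + a' * (s - x) + b' * (t - y))| <= eps * (`|s - x| + `|t - y|).
  move=> hX ha hb'; have -> : X - (X' + a' * (s - x) + b' * (t - y)) =
    (a - a') * (s - x) + (b - b') * (t - y).
    by rewrite -[X](subrK X') hX; ring.
  apply: le_trans (ler_normD _ _) _; rewrite !normrM mulrDr.
  by rewrite lerD // ler_wpM2r // ltW.
split; apply: fin; rewrite ?hu ?hv //.
- exact: h1.
- exact: h2.
- by rewrite hb; exact: h3.
- exact: h4.
Qed.

(** The circulation around [0, s] x [0, 2 pi] vanishes and its edges t = 0 and t = 2 pi cancel by
    periodicity, so the integral of Re F over the circle of parameter s does not depend on s. Hence
    every circle contains a point where Re F takes the same value as at some point of the unit
    circle, and these points tend to 0 as s grows. *)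
Lemma mean_value_le B : (forall z, cmod z = 1 -> complex.Re (F z) <= B) ->
  complex.Re (F 0) <= B.
Proof.
move=> FB.
have cont2 (w : R -> R -> R) (x : R) : (forall x y, exists a b : R, forall e : R, 0 < e ->
  exists2 d : R, 0 < d & forall s t, `|s - x| < d -> `|t - y| < d ->
   `|w s t - (w x y + a * (s - x) + b * (t - y))| <= e * (`|s - x| + `|t - y|)) ->
    continuous (w ^~ x) /\ continuous (w x).
  move=> hw; split => y A /nbhs_ballP[eps /= eps0 hA].
    have [a [b hab]] := hw y x; have [d d0 hd] := hab 1 ltr01.
    have k0 : 0 < eps / (2 + `|a|) by rewrite divr_gt0 // ltr_wpDr.
    apply/nbhs_ballP; exists (Num.min d (eps / (2 + `|a|))); first by rewrite /= lt_min d0.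
    move=> s; rewrite -ball_normE /= distrC lt_min => /andP[s1 s2].
    apply: hA; rewrite -ball_normE /= distrC.
    have := hd s x s1; rewrite subrr normr0 mulr0 addr0 mul1r => /(_ d0) h.
    have -> : w s x - w y x = w s x - (w y x + a * (s - y) + 0) + a * (s - y) by ring.
    apply: le_lt_trans (ler_normD _ _) _; rewrite addr0 normrM.
    rewrite addr0 in h.
    apply: le_lt_trans (_ : (1 + `|a|) * `|s - y| < _); first by rewrite mulrDl mul1r lerD2r.
    rewrite ltr_pdivlMr in s2; last by rewrite ltr_wpDr.
    apply: le_lt_trans s2; rewrite mulrC ler_wpM2l //; lra.
  have [a [b hab]] := hw x y; have [d d0 hd] := hab 1 ltr01.
  have k0 : 0 < eps / (2 + `|b|) by rewrite divr_gt0 // ltr_wpDr.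
  apply/nbhs_ballP; exists (Num.min d (eps / (2 + `|b|))); first by rewrite /= lt_min d0.
  move=> t; rewrite -ball_normE /= distrC lt_min => /andP[s1 s2].
  apply: hA; rewrite -ball_normE /= distrC.
  have := hd x t; rewrite subrr normr0 mulr0 addr0 add0r mul1r => /(_ d0 s1) h.
  have -> : w x t - w x y = w x t - (w x y + b * (t - y)) + b * (t - y) by ring.
  apply: le_lt_trans (ler_normD _ _) _; rewrite normrM.
  apply: le_lt_trans (_ : (1 + `|b|) * `|t - y| < _); first by rewrite mulrDl mul1r lerD2r.
  rewrite ltr_pdivlMr in s2; last by rewrite ltr_wpDr.
  apply: le_lt_trans s2; rewrite mulrC ler_wpM2l //; lra.
have cu t : continuous (u ^~ t).
  apply: (cont2 u t _).1 => x y; have [a [b [c h]]] := closed_form x y.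
  exists a, b => eps /h[d d0 hd]; exists d => // s1 t1 h1 h2; exact: (hd _ _ h1 h2).1.
have cv s : continuous (v s).
  apply: (cont2 v s _).2 => x y; have [a [b [c h]]] := closed_form x y.
  exists b, c => eps /h[d d0 hd]; exists d => // s1 t1 h1 h2; exact: (hd _ _ h1 h2).2.
(* The primitives are based at -1, to the left of s = 0 and t = 0, so that they are differentiable
   on the closed edges. The second case is a default that makes [choice] applicable. *)
have prim (h : R -> R) : exists G : R -> R, continuous h ->
    forall x : R, -1 < x -> is_derive x 1 G (h x).
  have [ch|nch] := pselect (continuous h); last by exists h.
  by have [G hG] := real_prim (-1) ch; exists G.
have [H hH] := choice prim.
pose U s t := H (u ^~ t) s; pose V s := H (v s).
have dU (s t : R) : -1 < s -> is_derive s 1 (U ^~ t) (u s t) by exact: (hH _ (cu t)).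
have dV (s t : R) : -1 < t -> is_derive t 1 (V s) (v s t) by exact: (hH _ (cv s)).
have pi2 : 0 < pi *+ 2 :> R by rewrite mulrn_wgt0 // pi_gt0.
have per (s : R) : V s (pi *+ 2) - V s 0 = V 0 (pi *+ 2) - V 0 0 \/ s < 0.
  case: (ltP s 0) => s0; [by right|left].
  have := circulation_eq0 dU dV closed_form (ltrN10 R) (ltrN10 R) s0 (ltW pi2).
  rewrite /circulation /U; have -> : u ^~ (pi *+ 2) = u ^~ 0.
    apply/funext => s1; rewrite /u /z /e -[pi *+ 2]add0r cosD2pi sinD2pi //.
  by rewrite subrr add0r => /eqP; rewrite subr_eq0 => /eqP.
have mvt (s : R) : exists t, V s (pi *+ 2) - V s 0 = v s t * (pi *+ 2).
  have dV' (t : R) : 0 <= t -> is_derive t 1 (V s) (v s t).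
    by move=> t0; apply: dV; lra.
  have cV : {within `[0, pi *+ 2], continuous (V s)}.
    apply: derivable_within_continuous => t; rewrite in_itv /= => /andP[t0 _].
    exact: (@ex_derive _ _ _ _ _ _ _ (dV' t t0)).
  have dVo (t : R) : t \in `]0, (pi *+ 2)[ -> is_derive t 1 (V s) (v s t).
    by rewrite in_itv /= => /andP[t0 _]; apply: dV'; exact: ltW.
  by have [t _] := MVT_segment (ltW pi2) dVo cV; rewrite subr0 => ?; exists t.
have vle (s : R) : exists2 t, True & 0 <= s -> v s t <= B.
  have [t ht] := mvt s; exists t => // s0; have [t0 ht0] := mvt 0.
  have : v s t * (pi *+ 2) = v 0 t0 * (pi *+ 2) by rewrite -ht -ht0; case: (per s) => //; lra.
  move=> /(mulIf (lt0r_neq0 pi2)) ->; apply: FB.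
  by rewrite cmod_z /g expr0n addr0 invr1.
apply/ler_addgt0Pr => eps eps0.
have [d /cder_cont/(_ eps eps0)[r r0 hr]] : exists d, cder F 0 d.
  by apply: F_der; rewrite cmod0.
pose s := r^-1 + 1.
have s0 : 0 < s by rewrite /s ltr_wpDl // invr_ge0 ltW.
have [t _ ht] := vle s.
have zs : cmod (z s t - 0) < r.
  rewrite subr0 cmod_z /g invf_plt ?posrE //.
  have h : s <= s ^+ 2 by rewrite expr2 ler_pMr // /s lerDr invr_ge0 ltW.
  have : r^-1 < s by rewrite /s ltrDl.
  lra.
have := hr _ zs; have := ht (ltW s0); rewrite /v => h1 /(le_lt_trans (cmod_Re _)).
case: (F (z s t)) h1 => a b; case: (F 0) => a' b' /= h1; rewrite ltr_norml => /andP[h2 _].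
lra.
Qed.

End MeanValue.

(** * The maximum principle *)

Section Moebius.
Variable R : realType.
Implicit Types (u z w a c : R[i]) (r B M : R).

(** The automorphism of the disc that takes 0 to [u]; its inverse is [mob (- u)]. *)
Definition mob u z := (z + u) / (1 + cj u * z).

Lemma mob_sq u z : cmod (1 + cj u * z) ^+ 2 - cmod (z + u) ^+ 2 =
  (1 - cmod u ^+ 2) * (1 - cmod z ^+ 2).
Proof. by rewrite !cmod_sq; case: u => a b; case: z => x y /=; ring. Qed.

Lemma mob_den u z : cmod u < 1 -> cmod z <= 1 -> 1 + cj u * z != 0.
Proof.
move=> u1 z1; rewrite -cmod_gt0.
have : 1 - cmod (cj u * z) <= cmod (1 + cj u * z).
  by have := cmod_lerB 1 (- (cj u * z)); rewrite cmod1 cmodN opprK.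
apply: lt_le_trans; rewrite subr_gt0 cmodM cmod_cj.
by apply: le_lt_trans u1; rewrite ler_piMr ?cmod_ge0.
Qed.

Lemma mob_norm u z : cmod u < 1 -> cmod z <= 1 ->
  1 - cmod (mob u z) ^+ 2 =
  (1 - cmod u ^+ 2) * (1 - cmod z ^+ 2) / cmod (1 + cj u * z) ^+ 2.
Proof.
move=> u1 z1; have := mob_den u1 z1; rewrite -cmod_gt0 => d0.
by rewrite -mob_sq /mob cmod_div exprMn exprVn mulrBl divff // expf_neq0 // gt_eqF.
Qed.

Lemma sq_lt1 x : 0 <= x -> (x ^+ 2 < 1 :> R) = (x < 1).
Proof. by move=> x0; rewrite expr_lt1. Qed.

Lemma mob_lt1 u z : cmod u < 1 -> cmod z < 1 -> cmod (mob u z) < 1.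
Proof.
move=> u1 z1; rewrite -sq_lt1 ?cmod_ge0 // -subr_gt0 mob_norm ?(ltW z1) //.
have := mob_den u1 (ltW z1); rewrite -cmod_gt0 => d0.
by rewrite divr_gt0 ?exprn_gt0 // mulr_gt0 // subr_gt0 sq_lt1 ?cmod_ge0.
Qed.

Lemma mob_circle u z : cmod u < 1 -> cmod z = 1 -> cmod (mob u z) = 1.
Proof.
move=> u1 z1; have := @mob_norm u z u1; rewrite z1 lexx => /(_ isT).
rewrite expr1n subrr mulr0 mul0r => /eqP; rewrite subr_eq0 eq_sym => h.
by apply/eqP; rewrite -(@eqrXn2 _ 2) ?cmod_ge0 // expr1n.
Qed.

Lemma mob0 u : mob u 0 = u.
Proof. by rewrite /mob mulr0 addr0 divr1 add0r. Qed.

Lemma mobNv u : mob (- u) u = 0.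
Proof. by rewrite /mob subrr mul0r. Qed.

Lemma one_cj u : cmod u < 1 -> 1 - cj u * u != 0.
Proof.
move=> u1; rewrite mulrC mul_cj -(rmorph1 (@real_complex R)) -rmorphB.
rewrite -cmod_gt0 cmodC normr_gt0 subr_eq0 eq_sym.
by have := sq_lt1 (cmod_ge0 u); rewrite u1 => /lt_eqF ->.
Qed.

Lemma mobK u z : cmod u < 1 -> cmod z < 1 -> mob (- u) (mob u z) = z.
Proof.
move=> u1 z1; have d0 := mob_den u1 (ltW z1).
have k0 := one_cj u1; rewrite /mob rmorphN /=.
have e : 1 + - cj u * ((z + u) / (1 + cj u * z)) = (1 - cj u * u) / (1 + cj u * z).
  by field.
rewrite e; field; rewrite d0 /=; exact: k0.
Qed.

Lemma mobKN u z : cmod u < 1 -> cmod z < 1 -> mob u (mob (- u) z) = z.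
Proof. by move=> u1 z1; rewrite -{1}[u]opprK mobK // cmodN. Qed.

Lemma cder_mob u z : 1 + cj u * z != 0 ->
  cder (mob u) z ((1 - u * cj u) / (1 + cj u * z) ^+ 2).
Proof.
move=> d0.
have h1 := cder_aff 1 u z; have h2 := cder_aff (cj u) 1 z.
have h3 := cderV (f := fun w => cj u * w + 1) (_ : cj u * z + 1 != 0) h2.
have d1 := d0; rewrite addrC in d1; have := cderM h1 (h3 d1).
have -> : 1 * (cj u * z + 1)^-1 + (1 * z + u) * (- cj u / (cj u * z + 1) ^+ 2) =
  (1 - u * cj u) / (1 + cj u * z) ^+ 2.
  by field; rewrite ?d0 ?d1.
by apply: (@cder_near _ _ _ _ _ 1) => // w _; rewrite /mob mul1r [1 + _]addrC.
Qed.

(** A unimodular factor makes [F 0] a positive real number, to which the bound on real parts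
    applies. *)
Lemma max_center (F : R[i] -> R[i]) B : (forall z, cmod z <= 1 -> exists d, cder F z d) ->
  (forall z, cmod z = 1 -> cmod (F z) <= B) -> cmod (F 0) <= B.
Proof.
move=> hF FB; have [F0|F0] := eqVneq (F 0) 0.
  by rewrite F0 cmod0 (le_trans (cmod_ge0 _) (FB 1 (cmod1 R))).
pose k := (cmod (F 0))^-1%:C * cj (F 0).
have k1 : cmod k = 1.
  by rewrite /k cmodM cmodC cmod_cj ger0_norm ?invr_ge0 ?cmod_ge0 // mulVf // cmod_eq0.
have -> : cmod (F 0) = complex.Re (k * F 0).
  rewrite /k -mulrA [cj _ * _]mulrC mul_cj -rmorphM /=.
  by rewrite expr2 mulrA mulVf ?mul1r // cmod_eq0.
apply: (@mean_value_le R (fun z => k * F z)).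
  by move=> z /hF[d hd]; exists (k * d); exact: cderZ.
move=> z /FB h; apply: le_trans h; rewrite -[X in _ <= X]mul1r -k1 -cmodM.
exact: le_trans (ler_norm _) (cmod_Re _).
Qed.

(** An automorphism of the disc moves [a] to the centre. *)
Lemma max_disc (F : R[i] -> R[i]) c r B a : 0 < r ->
  (forall z, cmod (z - c) <= r -> exists d, cder F z d) ->
  (forall z, cmod (z - c) = r -> cmod (F z) <= B) -> cmod (a - c) < r -> cmod (F a) <= B.
Proof.
move=> r0 hF FB ar; pose b := (a - c) / r%:C.
have rC : r%:C != 0 by rewrite -cmod_gt0 cmodC gtr0_norm.
have b1 : cmod b < 1 by rewrite /b cmod_div cmodC gtr0_norm // ltr_pdivrMr // mul1r.
pose G z := r%:C * mob b z + c.
have -> : a = G 0 by rewrite /G mob0 /b mulrC divfK // subrK.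
have mobn z : cmod z <= 1 -> cmod (mob b z) <= 1.
  by rewrite le_eqVlt => /orP[/eqP /(mob_circle b1) -> //|/(mob_lt1 b1)/ltW].
have hG z : cmod (G z - c) = r * cmod (mob b z).
  by rewrite /G addrK cmodM cmodC gtr0_norm.
apply: (@max_center (F \o G)) => z z1.
  have dm := cder_mob (mob_den b1 z1).
  have dG : cder G z (r%:C * ((1 - b * cj b) / (1 + cj b * z) ^+ 2) + 0).
    by apply: cderD; [exact: cderZ|exact: cder_cst].
  have [d hd] : exists d, cder F (G z) d.
    by apply: hF; rewrite hG ger_pMr // mobn.
  by eexists; exact: cder_comp dG hd.
by apply: FB; rewrite hG (mob_circle b1 z1) mulr1.
Qed.

Lemma bernoulli (t : R) n : 1 <= t -> 1 + n%:R * (t - 1) <= t ^+ n.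
Proof.
move=> t1; elim: n => [|n IH]; first by rewrite mul0r addr0 expr0.
rewrite exprS; apply: le_trans (_ : t * (1 + n%:R * (t - 1)) <= _); last first.
  by rewrite ler_pM2l // (lt_le_trans ltr01).
rewrite -subr_ge0 (_ : _ - _ = n%:R * (t - 1) ^+ 2); last by rewrite -(natr1 n); ring.
by rewrite mulr_ge0 ?ler0n ?sqr_ge0.
Qed.

(** If x > y, the powers of x / y exceed K / q by Bernoulli's inequality. Constant factors thus
    disappear from an estimate that holds for all powers. *)
Lemma pow_le (x y q K : R) : 0 <= y -> 0 < q ->
  (forall n, x ^+ n * q <= y ^+ n * K) -> x <= y.
Proof.
move=> y0 q0 h; case: (leP x y) => // yx.
move: y0; rewrite le_eqVlt => /orP[/eqP y0|y0].
  have := h 1%N; rewrite !expr1 -y0 mul0r pmulr_lle0 // => h1.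
  by move: yx; rewrite -y0 ltNge h1.
pose t := x / y; have t1 : 1 < t by rewrite /t ltr_pdivlMr ?mul1r.
have ht n : t ^+ n * q <= K.
  rewrite /t expr_div_n mulrAC ler_pdivrMr ?exprn_gt0 // [K * _]mulrC; exact: h.
have K0 : 0 <= K by have := ht 0%N; rewrite expr0 mul1r; apply: le_trans (ltW q0).
pose n := Num.bound (K / q / (t - 1)).
have hn : K / q / (t - 1) < n%:R.
  by apply: archi_boundP; rewrite !divr_ge0 ?(ltW q0) ?subr_ge0 ?(ltW t1).
rewrite ltr_pdivrMr ?subr_gt0 // ltr_pdivrMr // in hn.
have := ht n; have := bernoulli n (ltW t1) => h1 h2.
have : n%:R * (t - 1) * q <= K.
  apply: le_trans h2; rewrite ler_pM2r //; lra.
lra.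
Qed.

Lemma cder_prodB (E : seq R[i]) z : exists d, cder (fun w => \prod_(e <- E) (w - e)) z d.
Proof.
elim: E => [|e E [d IH]].
  exists 0; apply: (@cder_near _ (fun=> 1) _ z _ 1) => // [w _|]; first by rewrite big_nil.
  exact: cder_cst.
eexists; apply: (@cder_near _ (fun w => (1 * w + - e) * \prod_(e <- E) (w - e)) _ z _ 1) => //.
  by move=> w _; rewrite big_cons mul1r.
exact: cderM (cder_aff 1 (- e) z) IH.
Qed.

(* Apply the principle to [f^n] times a polynomial vanishing doubly on E, and
   let n go to infinity. *)
Lemma max_principle (f : R[i] -> R[i]) (E : seq R[i]) c r B M a :
  (forall e, e \in E -> cmod (e - c) < r) ->
  (forall z, cmod (z - c) <= r -> z \notin E -> exists d, cder f z d) ->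
  (forall z, cmod (z - c) <= r -> z \notin E -> cmod (f z) <= M) ->
  (forall z, cmod (z - c) = r -> cmod (f z) <= B) ->
  cmod (a - c) < r -> a \notin E -> cmod (f a) <= B.
Proof.
move=> hE df fM fB ar aE.
have r0 : 0 < r by exact: le_lt_trans (cmod_ge0 _) ar.
pose Q w := \prod_(e <- E) (w - e).
have Q0 e : e \in E -> Q e = 0.
  by move=> eE; rewrite /Q (big_rem e) //= subrr mul0r.
have Qn0 w : w \notin E -> Q w != 0.
  rewrite /Q; elim: (E) => [|e E' IH]; first by rewrite big_nil oner_neq0.
  by rewrite in_cons negb_or big_cons => /andP[we /IH]; apply: mulf_neq0; rewrite subr_eq0.
have QB w : cmod (w - c) = r -> cmod (Q w) <= (2 * r) ^+ size E.
  move=> wr; rewrite /Q; elim: (E) hE => [|e E' IH] hE'; first by rewrite big_nil cmod1.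
  rewrite big_cons cmodM /= exprS ler_pM ?cmod_ge0 //.
    apply: le_trans (cmod_dist _ c _) _; rewrite wr (cmodBC c).
    by have := hE' e (mem_head _ _); lra.
  by apply: IH => e' he'; apply: hE'; rewrite in_cons he' orbT.
pose F n w := f w ^+ n * (Q w * Q w).
apply: (@pow_le _ _ (cmod (Q a) ^+ 2) (((2 * r) ^+ size E) ^+ 2)).
- have := fB (c + r%:C); rewrite addrC addKr cmodC gtr0_norm // => /(_ erefl).
  exact: le_trans (cmod_ge0 _).
- by rewrite exprn_gt0 // cmod_gt0 Qn0.
move=> n; rewrite -cmodX expr2 -!cmodM.
apply: (@max_disc (F n) c r) => //.
- move=> z zr; have [zE|zE] := boolP (z \in E); last first.
    have [d hd] := df z zr zE; have [d1 hd1] := cderX n hd; have [d2 hd2] := cder_prodB E z.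
    by eexists; apply: cderM hd1 (cderM hd2 hd2).
  (* At a point of [E] the double zero prevails over the bounded factor [f w ^+ n], so that the
     product has derivative 0 there. *)
  exists 0; have [d2 hd2] := cder_prodB E z; have [t t0 ht] := cder_lip hd2.
  apply/cderP => eps eps0; pose L := cmod d2 + 1.
  have M0 : 0 <= `|M| ^+ n * L ^+ 2 by rewrite mulr_ge0 ?exprn_ge0 ?addr_ge0 ?cmod_ge0.
  have k0 : 0 < `|M| ^+ n * L ^+ 2 + 1 by lra.
  pose s := Num.min (Num.min t (r - cmod (z - c))) (eps / (`|M| ^+ n * L ^+ 2 + 1)).
  exists s; first by rewrite /s !lt_min t0 subr_gt0 hE //= divr_gt0.
  move=> w; rewrite /s !lt_min => /andP[/andP[w1 w2] w3].
  rewrite /F !(Q0 _ zE) !mulr0 mul0r !subr0.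
  have [wE|wE] := boolP (w \in E).
    by rewrite (Q0 _ wE) !mulr0 cmod0 mulr_ge0 ?cmod_ge0 // ltW.
  have wr : cmod (w - c) <= r.
    by apply: le_trans (cmod_dist _ z _) _; lra.
  have := ht w w1; rewrite -/(Q w) -/(Q z) (Q0 _ zE) subr0 -/L => hQ.
  have hf : cmod (f w) <= `|M| by apply: le_trans (fM w wr wE) (ler_norm _).
  rewrite !cmodM cmodX.
  have h1 : cmod (f w) ^+ n <= `|M| ^+ n by rewrite lerXn2r ?nnegrE ?cmod_ge0.
  have h2 : cmod (Q w) * cmod (Q w) <= (L * cmod (w - z)) * (L * cmod (w - z)).
    by rewrite ler_pM ?cmod_ge0.
  have h3 : cmod (f w) ^+ n * (cmod (Q w) * cmod (Q w)) <=
    `|M| ^+ n * ((L * cmod (w - z)) * (L * cmod (w - z))).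
    by rewrite ler_pM ?exprn_ge0 ?cmod_ge0 // mulr_ge0 ?cmod_ge0.
  apply: (le_trans h3).
  have -> : `|M| ^+ n * (L * cmod (w - z) * (L * cmod (w - z))) =
     (`|M| ^+ n * L ^+ 2 * cmod (w - z)) * cmod (w - z) by ring.
  rewrite ler_wpM2r ?cmod_ge0 //.
  rewrite ltr_pdivlMr // in w3; apply: le_trans (ltW w3).
  rewrite mulrC ler_wpM2l ?cmod_ge0 //; lra.
- move=> z zr; rewrite /F !cmodM cmodX ler_pM ?exprn_ge0 ?mulr_ge0 ?cmod_ge0 //.
    by rewrite lerXn2r ?nnegrE ?cmod_ge0 ?fB // (le_trans (cmod_ge0 _) (fB z zr)).
  by rewrite expr2 ler_pM ?cmod_ge0 ?QB.
Qed.

End Moebius.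

(** * Cauchy estimates and the Schwarz lemma *)

Section CauchyEstimates.
Variable R : realType.
Implicit Types (u z w a b c d : R[i]) (r B M : R).

Lemma cder_div (f g : R[i] -> R[i]) z d e : cder f z d -> cder g z e -> g z != 0 ->
  exists k, cder (fun w => f w / g w) z k.
Proof. by move=> hf hg g0; eexists; exact: cderM hf (cderV g0 hg). Qed.

(** The maximum principle for the difference quotient at [b], with [b] as one more exceptional
    point; on the boundary circle the denominator is at least r - |b - c|. The set [E] allows the
    lemma to be applied to functions that are themselves difference quotients. *)
Lemma hol_lipschitz (f : R[i] -> R[i]) (E : seq R[i]) c r M a b :
  (forall e, e \in E -> cmod (e - c) < r) ->
  (forall z, cmod (z - c) <= r -> z \notin E -> exists d, cder f z d) ->
  (forall z, cmod (z - c) <= r -> z \notin E -> cmod (f z) <= M) ->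
  cmod (a - c) < r -> cmod (b - c) < r -> a \notin E -> b \notin E ->
  cmod (f a - f b) <= 2 * M / (r - cmod (b - c)) * cmod (a - b).
Proof.
move=> hE df fM ar br aE bE.
have [->|ab] := eqVneq a b; first by rewrite !subrr cmod0 mulr0.
have [db hdb] := df b (ltW br) bE; have [t t0 ht] := cder_lip hdb.
pose Q z := (f z - f b) / (z - b).
have fM2 z : cmod (z - c) <= r -> z \notin E -> cmod (f z - f b) <= 2 * M.
  move=> zr zE; apply: le_trans (cmodB _ _) _.
  by rewrite mulr2n mulrDl mul1r lerD // fM // ltW.
have M0 : 0 <= M by exact: le_trans (cmod_ge0 _) (fM b (ltW br) bE).
have Qab : cmod (Q a) <= 2 * M / (r - cmod (b - c)).
  apply: (@max_principle _ Q (b :: E) c r _ (cmod db + 1 + 2 * M / t)) => //.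
  - by move=> e; rewrite in_cons => /orP[/eqP ->|/hE].
  - move=> z zr; rewrite in_cons negb_or => /andP[zb zE].
    have [d hd] := df z zr zE.
    have h1 := cderB hd (cder_cst (f b) z); have h2 := cderB (cder_id z) (cder_cst b z).
    have zb0 : z - b != 0 by rewrite subr_eq0.
    exact: cder_div h1 h2 zb0.
  - move=> z zr; rewrite in_cons negb_or => /andP[zb zE].
    have zb0 : 0 < cmod (z - b) by rewrite cmod_gt0 subr_eq0.
    rewrite /Q cmod_div ler_pdivrMr //; case: (ltP (cmod (z - b)) t) => [/ht h|tz].
      apply: (le_trans h); rewrite ler_pM2r // lerDl divr_ge0 ?(ltW t0) //; lra.
    apply: (le_trans (fM2 z zr zE)); rewrite mulrDl.
    have eM : 2 * M = 2 * M / t * t by rewrite divfK // gt_eqF.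
    have : 2 * M / t * t <= 2 * M / t * cmod (z - b).
      by rewrite ler_wpM2l // divr_ge0 ?(ltW t0) //; lra.
    have : 0 <= (cmod db + 1) * cmod (z - b) by rewrite mulr_ge0 ?addr_ge0 ?cmod_ge0.
    lra.
  - move=> z zr; have zE : z \notin E by apply/negP => /hE; rewrite zr ltxx.
    have h : r - cmod (b - c) <= cmod (z - b).
      have := cmod_lerB (z - c) (b - c); rewrite zr; congr (_ <= cmod _); ring.
    have h0 : 0 < r - cmod (b - c) by rewrite subr_gt0.
    rewrite /Q cmod_div ler_pdivrMr; last exact: lt_le_trans h0 h.
    apply: (le_trans (fM2 z _ zE)); first by rewrite zr.
    have eM : 2 * M = 2 * M / (r - cmod (b - c)) * (r - cmod (b - c)).
      by rewrite divfK // gt_eqF.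
    rewrite [X in X <= _]eM ler_wpM2l // divr_ge0 ?(ltW h0) //; lra.
  - by rewrite in_cons negb_or ab.
have ab0 : a - b != 0 by rewrite subr_eq0.
by rewrite -[f a - f b](divfK ab0) cmodM ler_wpM2r ?cmod_ge0.
Qed.

(** The difference quotient [g] at [a] is bounded by 2M/r and tends to [d]. Being holomorphic with
    [a] as exceptional point, it is Lipschitz near [a], with the constant 2 (2M/r) / (r/2) =
    8M/r^2. *)
Lemma second_order (f : R[i] -> R[i]) a r M d z : 0 < r ->
  (forall w, cmod (w - a) <= r -> exists e, cder f w e) ->
  (forall w, cmod (w - a) <= r -> cmod (f w) <= M) -> cder f a d ->
  cmod (z - a) < r ->
  cmod d <= 2 * M / r /\
  cmod (f z - f a - d * (z - a)) <= 8 * M / r ^+ 2 * cmod (z - a) ^+ 2.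
Proof.
move=> r0 df fM hd zr.
pose g w := (f w - f a) / (w - a).
have M0 : 0 <= M by apply: le_trans (cmod_ge0 _) (fM a _); rewrite subrr cmod0 ltW.
have gM w : cmod (w - a) < r -> w != a -> cmod (g w) <= 2 * M / r.
  move=> wr wa; have wa0 : 0 < cmod (w - a) by rewrite cmod_gt0 subr_eq0.
  rewrite /g cmod_div ler_pdivrMr //.
  have := @hol_lipschitz f [::] a r M w a; rewrite subrr cmod0 subr0; apply => //.
  - by move=> ? ? _; exact: df.
  - by move=> ? ? _; exact: fM.
have dg w : cmod (w - a) <= r -> w \notin [:: a] -> exists e, cder g w e.
  move=> wr; rewrite inE => wa; have [e he] := df w wr.
  have h1 := cderB he (cder_cst (f a) w); have h2 := cderB (cder_id w) (cder_cst a w).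
  have wa0 : w - a != 0 by rewrite subr_eq0.
  exact: cder_div h1 h2 wa0.
have glim (e : R) : 0 < e -> exists w, [/\ w != a, cmod (w - a) < e & cmod (g w - d) <= e].
  move=> e0; have [t t0 ht] := (cderP f a d).1 hd e e0.
  pose s := Num.min e t / 2; have s0 : 0 < s by rewrite divr_gt0 // lt_min e0.
  have st : s < Num.min e t by rewrite ltr_pdivrMr // ltr_pMr ?ltr1n // lt_min e0.
  move: st; rewrite lt_min => /andP[se st].
  have sC : s%:C != 0 by rewrite -cmod_gt0 cmodC gtr0_norm.
  exists (a + s%:C); rewrite /g [a + _ - a]addrC addKr cmodC gtr0_norm //; split => //.
    by rewrite -subr_eq0 [a + _]addrC addrK.
  have := ht (a + s%:C); rewrite [a + _ - a]addrC addKr cmodC gtr0_norm // => /(_ st) h.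
  have -> : (f (a + s%:C) - f a) / s%:C - d = (f (a + s%:C) - f a - d * s%:C) / s%:C.
    by rewrite [RHS]mulrBl mulfK.
  by rewrite cmod_div cmodC gtr0_norm // ler_pdivrMr.
split.
  apply/ler_addgt0Pl => e e0; have m0 : 0 < Num.min e r by rewrite lt_min e0.
  have [w [wa we wd]] := glim _ m0.
  move: we wd; rewrite lt_min le_min => /andP[w1 w2] /andP[w3 _].
  have -> : d = - ((g w - d) - g w) by ring.
  by rewrite cmodN (le_trans (cmodB _ _)) // lerD // gM.
have [->|za] := eqVneq z a; first by rewrite !subrr mulr0 subr0 cmod0 expr0n mulr0.
pose K := 8 * M / r ^+ 2.
have K0 : 0 <= K by rewrite divr_ge0 ?exprn_ge0 ?(ltW r0) ?mulr_ge0.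
suff h : cmod (g z - d) <= K * cmod (z - a).
  have za0 : z - a != 0 by rewrite subr_eq0.
  have -> : f z - f a - d * (z - a) = (g z - d) * (z - a) by rewrite mulrBl divfK.
  by rewrite cmodM expr2 mulrA ler_wpM2r ?cmod_ge0.
have rz : 0 < (r + cmod (z - a)) / 2 by have := cmod_ge0 (z - a); lra.
apply/ler_addgt0Pl => e e0; pose e1 := Num.min (e / (K + 1)) (r / 4).
have e10 : 0 < e1 by rewrite lt_min divr_gt0 ?(divr_gt0 r0) // ltr_wpDl.
have [w [wa we wd]] := glim _ e10.
have we1 : e1 <= r / 4 by rewrite /e1 ge_min lexx orbT.
have we2 : (K + 1) * e1 <= e.
  by rewrite mulrC -ler_pdivlMr ?ltr_wpDl // /e1 ge_min lexx.
have gl : cmod (g z - g w) <= K * cmod (z - w).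
  apply: le_trans (_ : 2 * (2 * M / (r / 1)) / (r - cmod (w - a)) * cmod (z - w) <= _).
    apply: (@hol_lipschitz g [:: a] a r _ z w) => //.
    - by move=> e'; rewrite inE => /eqP ->; rewrite subrr cmod0.
    - move=> w' hw'; rewrite inE => w'a; move: hw'; rewrite divr1 le_eqVlt => /orP[/eqP hw'|hw'].
        rewrite /g cmod_div hw' ler_pM2r ?invr_gt0 //.
        apply: le_trans (cmodB _ _) _; rewrite mulr2n mulrDl mul1r lerD // fM ?hw' //.
        by rewrite subrr cmod0 ltW.
      exact: gM.
    - lra.
    - by rewrite inE.
    - by rewrite inE.
  rewrite ler_wpM2r ?cmod_ge0 // ler_pdivrMr; last by lra.
  rewrite /K divr1 expr2 invfM.
  have -> : 2 * (2 * M / r) = 8 * M * (r^-1 / r) * (r / 2) by field; rewrite gt_eqF.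
  rewrite ler_wpM2l ?mulr_ge0 ?invr_ge0 ?(ltW r0) //; lra.
have h1 : cmod (z - w) <= cmod (z - a) + e1.
  by apply: le_trans (cmod_dist _ a _) _; rewrite lerD2l cmodBC ltW.
have -> : g z - d = (g z - g w) + (g w - d) by ring.
apply: (le_trans (cmodD _ _)).
have h2 : K * cmod (z - w) <= K * (cmod (z - a) + e1) by rewrite ler_wpM2l.
nra.
Qed.

Definition disc_map (f : R[i] -> R[i]) := forall z, cmod z < 1 ->
  (exists d, cder f z d) /\ cmod (f z) < 1.

Lemma disc_map_comp f g : disc_map f -> disc_map g -> disc_map (f \o g).
Proof.
move=> hf hg z /hg[[d hd] /hf[[e he] h]]; split => //.
by eexists; exact: cder_comp hd he.
Qed.

Lemma disc_map_mob u : cmod u < 1 -> disc_map (mob u).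
Proof.
move=> u1 z z1; split; last exact: mob_lt1.
by eexists; exact: (cder_mob (mob_den u1 (ltW z1))).
Qed.

(* The bound is 1/r on the circle of radius r, for all r < 1. *)
Lemma schwarz_rho f rho z : (forall w, cmod w < rho -> exists d, cder f w d) ->
  (forall w, cmod w < rho -> cmod (f w) <= 1) -> f 0 = 0 -> cmod z < rho ->
  rho * cmod (f z) <= cmod z.
Proof.
move=> df f1 f0 zr; have [->|z0] := eqVneq z 0; first by rewrite f0 cmod0 mulr0.
have zp : 0 < cmod z by rewrite cmod_gt0.
suff h r : cmod z < r -> r < rho -> r * cmod (f z) <= cmod z.
  rewrite leNgt; apply/negP => lt.
  have fz : 0 < cmod (f z).
    by rewrite lt_def cmod_ge0 andbT; apply/negP => /eqP fz; move: lt; rewrite fz mulr0 ltNge cmod_ge0.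
  have q : cmod z / cmod (f z) < rho by rewrite ltr_pdivrMr.
  pose m := Num.max (cmod z) (cmod z / cmod (f z)).
  have m1 : m < rho by rewrite gt_max zr.
  have m2 : cmod z <= m by rewrite le_max lexx.
  have m3 : cmod z / cmod (f z) <= m by rewrite le_max lexx orbT.
  have := h ((m + rho) / 2) ltac:(lra) ltac:(lra); rewrite -ler_pdivlMr //.
  lra.
move=> zr' r1; have r0 : 0 < r by exact: lt_trans zp zr'.
have : cmod (f z / z) <= r^-1; last first.
  by rewrite cmod_div ler_pdivrMr // ler_pdivlMl.
have rho0 : cmod 0 < rho by rewrite cmod0; exact: le_lt_trans (cmod_ge0 z) zr.
have [db hdb] := df 0 rho0.
have [t t0 ht] := cder_lip hdb.
apply: (@max_principle _ (fun z => f z / z) [:: 0] 0 r _ (cmod db + 1 + t^-1)) => //.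
- by move=> e; rewrite inE => /eqP ->; rewrite subrr cmod0.
- move=> w; rewrite subr0 inE => wr w0; have [|d hd] := df w; first lra.
  exact: cder_div hd (cder_id w) w0.
- move=> w; rewrite subr0 inE => wr w0; have wp : 0 < cmod w by rewrite cmod_gt0.
  rewrite cmod_div ler_pdivrMr //; have := ht w; rewrite f0 !subr0.
  have c0 := cmod_ge0 db; have t1 : 0 < t^-1 by rewrite invr_gt0.
  case: (ltP (cmod w) t) => [lt /(_ isT) h|tw _].
    by apply: (le_trans h); rewrite ler_pM2r // lerDl ltW.
  have := f1 w ltac:(lra) => h; apply: (le_trans h).
  have : 1 <= t^-1 * cmod w by rewrite ler_pdivlMl // mulr1.
  have : 0 <= (cmod db + 1) * cmod w by rewrite mulr_ge0 ?cmod_ge0 // addr_ge0.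
  by lra.
- move=> w; rewrite subr0 => wr; rewrite cmod_div wr ler_pdivrMr // mulVf ?gt_eqF //.
  by apply: f1; rewrite wr.
- by rewrite subr0.
- by rewrite inE.
Qed.

Lemma schwarz f z : disc_map f -> f 0 = 0 -> cmod z < 1 -> cmod (f z) <= cmod z.
Proof.
move=> df f0 z1; have := @schwarz_rho f 1 z; rewrite mul1r; apply => // w /df[] // _.
exact: ltW.
Qed.

Lemma schwarz_pick f a z : disc_map f -> cmod a < 1 -> cmod z < 1 ->
  cmod (mob (- f a) (f z)) <= cmod (mob (- a) z).
Proof.
move=> df a1 z1; have [_ fa1] := df a a1.
have na : cmod (- a) < 1 by rewrite cmodN.
have h : disc_map (mob (- f a) \o (f \o mob a)).
  by apply: disc_map_comp; [apply: disc_map_mob; rewrite cmodN|apply: disc_map_comp => //; exact: disc_map_mob].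
have := schwarz (z := mob (- a) z) h; rewrite /= mob0 mobNv mobKN //; apply => //.
exact: mob_lt1.
Qed.

(** A lower bound for the distance of [f z] from the unit circle that depends only on |f a| and the
    hyperbolic distance of [a] and [z]. It keeps limits of disc maps inside the open disc. *)
Lemma schwarz_pick_inside f a z : disc_map f -> cmod a < 1 -> cmod z < 1 ->
  (1 - cmod (f a) ^+ 2) * (1 - cmod (mob (- a) z) ^+ 2) / 4 <= 1 - cmod (f z) ^+ 2.
Proof.
move=> df a1 z1; have [_ fa1] := df a a1; have [_ fz1] := df z z1.
pose v := mob (- f a) (f z).
have v1 : cmod v < 1 by apply: mob_lt1 => //; rewrite cmodN.
have -> : f z = mob (f a) v by rewrite /v mobKN.
rewrite (mob_norm fa1 (ltW v1)).
have sp : cmod v <= cmod (mob (- a) z) by exact: schwarz_pick.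
have d0 := mob_den fa1 (ltW v1); rewrite -cmod_gt0 in d0.
have d2 : cmod (1 + cj (f a) * v) <= 2.
  apply: le_trans (cmodD _ _) _; rewrite cmod1 cmodM cmod_cj.
  have : cmod (f a) * cmod v <= 1 * 1 by rewrite ler_pM ?cmod_ge0 // ltW.
  lra.
have A0 : 0 < 1 - cmod (f a) ^+ 2 by rewrite subr_gt0 sq_lt1 ?cmod_ge0.
have B1 : cmod v ^+ 2 <= cmod (mob (- a) z) ^+ 2 by rewrite ler_sqr ?nnegrE ?cmod_ge0.
have B0 : 0 < 1 - cmod v ^+ 2 by rewrite subr_gt0 sq_lt1 ?cmod_ge0.
rewrite ler_pdivlMr ?exprn_gt0 // mulrAC ler_pdivrMr //.
have e4 : cmod (1 + cj (f a) * v) ^+ 2 <= 4.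
  have -> : 4 = 2 ^+ 2 :> R by ring.
  by rewrite ler_sqr ?nnegrE ?cmod_ge0.
rewrite -!mulrA ler_pM2l //.
case: (leP 0 (1 - cmod (mob (- a) z) ^+ 2)) => h.
  apply: (@le_trans _ _ ((1 - cmod (mob (- a) z) ^+ 2) * 4)); first by rewrite ler_wpM2l.
  by rewrite ler_pM2r //; lra.
apply: (@le_trans _ _ 0); last by rewrite mulr_ge0 // ltW.
by rewrite mulr_le0_ge0 ?exprn_ge0 ?cmod_ge0 // ltW.
Qed.

Lemma mob_eq0 u z : cmod u < 1 -> cmod z <= 1 -> mob (- u) z = 0 -> z = u.
Proof.
move=> u1 z1; have un : cmod (- u) < 1 by rewrite cmodN.
have d0 := mob_den un z1; rewrite /mob => /eqP; rewrite mulf_eq0 invr_eq0 (negPf d0) orbF.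
by rewrite subr_eq0 => /eqP.
Qed.

Lemma eps_le (x y C : R) : (forall e : R, 0 < e -> x <= y + C * e) -> x <= y.
Proof.
move=> h; apply/ler_addgt0Pl => e e0.
have k0 : 0 < `|C| + 1 by rewrite ltr_wpDl.
have := h _ (divr_gt0 e0 k0) => h1; apply: (le_trans h1); rewrite addrC lerD2r.
rewrite mulrCA ler_piMr ?(ltW e0) // ler_pdivrMr // mul1r.
by have := ler_norm C; lra.
Qed.

End CauchyEstimates.

(** * Inverse functions *)

Section Rotation.
Variable R : realType.
Implicit Types (z w e : R[i]).

Lemma cmod_one_sub z w : cmod (1 + cj (- z) * w) ^+ 2 =
  1 - 2 * complex.Re (cj z * w) + (cmod z * cmod w) ^+ 2.
Proof.
rewrite exprMn !cmod_sq; case: z => a b; case: w => x y /=; ring.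
Qed.

(* By Schwarz-Pick f preserves the pseudo-hyperbolic distance, hence the
   euclidean scalar product; up to a rotation f fixes 1/2, and then f z is z or
   its conjugate. The latter is not holomorphic. *)
Lemma disc_rotation (f g : R[i] -> R[i]) : disc_map f -> disc_map g -> f 0 = 0 -> g 0 = 0 ->
  (forall z, cmod z < 1 -> g (f z) = z) ->
  exists2 e, cmod e = 1 & forall z, cmod z < 1 -> f z = e * z.
Proof.
move=> df dg f0 g0 gf.
have f1 z : cmod z < 1 -> cmod (f z) < 1 by move=> /df[].
have fn z : cmod z < 1 -> cmod (f z) = cmod z.
  move=> z1; apply/eqP; rewrite eq_le schwarz //= -{1}(gf z z1) schwarz // f1 //.
have isom z w : cmod z < 1 -> cmod w < 1 ->
    complex.Re (cj (f z) * f w) = complex.Re (cj z * w).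
  move=> z1 w1; have fz1 := f1 z z1; have fw1 := f1 w w1.
  have P : cmod (mob (- f z) (f w)) = cmod (mob (- z) w).
    apply/eqP; rewrite eq_le schwarz_pick //= -{1}(gf z z1) -{1}(gf w w1).
    exact: schwarz_pick.
  have := @mob_norm R (- f z) (f w); rewrite cmodN fz1 (ltW fw1) P => /(_ isT isT).
  rewrite mob_norm ?cmodN ?(ltW w1) // !fn // !cmod_one_sub !fn //.
  set k := (1 - _) * (1 - _); have k0 : 0 < k by rewrite mulr_gt0 // subr_gt0 sq_lt1 ?cmod_ge0.
  move=> /(mulfI (lt0r_neq0 k0)) /invr_inj; lra.
pose h : R[i] := (2^-1)%:C; have hn : cmod h = 2^-1 by rewrite cmodC ger0_norm // invr_ge0.
have h1 : cmod h < 1 by rewrite hn; lra.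
pose e := 2 * f h.
have e1 : cmod e = 1 by rewrite /e cmodM fn // hn (cmod_nat R 2) divff.
pose q z := cj e * f z.
have eq1 : e * cj e = 1 by rewrite mul_cj e1 expr1n.
have qRe z : cmod z < 1 -> complex.Re (q z) = complex.Re z.
  move=> z1; have E : q z = 2 * (cj (f h) * f z) by rewrite /q /e rmorphM rmorph_nat mulrA.
  have R2 (w : R[i]) : complex.Re (2 * w) = 2 * complex.Re w.
    by rewrite mulrDl mul1r; case: w => x y /=; ring.
  by rewrite E R2 (isom h z h1 z1) /h; case: z {z1 E} => x y /=; rewrite oppr0 mul0r subr0; field.
have qIm z : cmod z < 1 -> complex.Im (q z) ^+ 2 = complex.Im z ^+ 2.
  move=> z1; have : cmod (q z) ^+ 2 = cmod z ^+ 2 by rewrite cmodM cmod_cj e1 mul1r fn.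
  by rewrite !cmod_sq qRe //; lra.
have qz z : cmod z < 1 -> q z = z \/ q z = cj z.
  move=> z1; have /eqP := qIm z z1; rewrite eqf_sqr => /orP[]/eqP him.
    by left; apply/eqP; rewrite eq_complex qRe // him !eqxx.
  right; apply/eqP; rewrite eq_complex qRe // him.
  by case: (z) => a b /=; rewrite !eqxx.
have qid z : cmod z < 1 -> q z = z.
  move=> z1; case: (qz z z1) => // qc; apply/eqP/negPn/negP => qnz.
  have [[d hd] _] := df z z1; have Hq := cderZ (cj e) hd.
  have half : (0 : R) < 2^-1 by rewrite invr_gt0.
  have [r r0 hr] := (cderP _ _ _).1 Hq _ half.
  have zc : 0 < cmod (z - cj z) by rewrite cmod_gt0 subr_eq0 -qc eq_sym.
  have [s s0 hs] := cder_cont Hq (divr_gt0 zc (ltr0Sn R 1 : 0 < 2)).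
  pose t := Num.min (Num.min r s) (Num.min (1 - cmod z) (cmod (z - cj z) / 2)) / 2.
  have m0 : 0 < Num.min (Num.min r s) (Num.min (1 - cmod z) (cmod (z - cj z) / 2)).
    by rewrite !lt_min r0 s0 subr_gt0 z1 divr_gt0.
  have t0 : 0 < t by rewrite /t divr_gt0.
  have : t < Num.min (Num.min r s) (Num.min (1 - cmod z) (cmod (z - cj z) / 2)).
    by rewrite /t; lra.
  rewrite !lt_min => /andP[/andP[tr ts] /andP[tz tc]].
  have near w : cmod w = t -> cmod (cj w - cj e * d * w) <= 2^-1 * t.
    move=> wt; have zw : z + w - z = w by rewrite addrC addKr.
    have zw1 : cmod (z + w) < 1 by apply: le_lt_trans (cmodD _ _) _; lra.
    have := hr (z + w); have := hs (z + w); rewrite zw wt -/(q z) -/(q (z + w)).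
    move=> /(_ ts) H1 /(_ tr) H2.
    (* Only the conjugate branch occurs near [z]: a value z + w would be too far from [q z], which
       is the conjugate of [z] and differs from [z]. *)
    case: (qz (z + w) zw1) => E; last first.
      by move: H2; rewrite E qc rmorphD /= [cj z + _]addrC addrK.
    exfalso; move: H1; rewrite E qc => H1.
    have := cmod_dist z (z + w) (cj z); rewrite -(cmodBC (z + w)) zw wt; lra.
  (* A derivative of the conjugation would be 1 along the real direction and -1 along the imaginary
     one; an error of one half in each cannot bridge the gap 2. *)
  have n1 := near t%:C; have n2 := near (t%:C * 'i%C).
  have i1 : cmod ('i%C : R[i]) = 1 by rewrite cmodE /= expr0n expr1n add0r sqrtr1.
  rewrite cmodM i1 mulr1 cmodC gtr0_norm // in n1 n2.
  have {}n1 := n1 erefl; have {}n2 := n2 erefl.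
  have h2 : cmod (2 * t%:C) = 2 * t by rewrite cmodM (cmod_nat R 2) cmodC gtr0_norm.
  have : cmod (2 * t%:C) <= 2^-1 * t + 2^-1 * t.
    rewrite -[cmod (2 * _)]mulr1 -i1 -cmodM.
    have -> : 2 * t%:C * 'i%C = (cj t%:C - cj e * d * t%:C) * 'i%C
         - (cj (t%:C * 'i%C) - cj e * d * (t%:C * 'i%C)).
      have -> : cj (t%:C * 'i%C) = - (t%:C * 'i%C).
        by apply/eqP; rewrite eq_complex /=; apply/andP; split; apply/eqP; ring.
      by rewrite conjc_real; ring.
    by apply: le_trans (cmodB _ _) _; rewrite cmodM i1 mulr1 lerD.
  rewrite h2; lra.
exists e => // z z1; by rewrite -{2}(qid z z1) /q mulrA eq1 mul1r.
Qed.

End Rotation.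

Section Inverse.
Variable R : realType.
Implicit Types (z w a b c d : R[i]) (r B M : R).

Lemma cder_right_inverse (u psi : R[i] -> R[i]) z r d : 0 < r -> d != 0 ->
  cder u (psi z) d -> ccont psi z -> (forall w, cmod (w - z) < r -> u (psi w) = w) ->
  cder psi z d^-1.
Proof.
move=> r0 d0 [phi [cphi phid hphi]] cpsi upsi.
have cc : ccont (phi \o psi) z by apply: ccont_comp.
have pd0 : (phi \o psi) z != 0 by rewrite /= phid.
have [s s0 hs] := cc (cmod d) (eq_ind_r is_true d0 (cmod_gt0 d)).
apply: (@cder_near _ (fun w => psi z + ((phi \o psi) w)^-1 * (w - z)) _ _ _ (Num.min r s)).
- by rewrite lt_min r0.
- move=> w; rewrite lt_min => /andP[wr ws].
  have pw0 : phi (psi w) != 0.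
    apply/negP => /eqP E; have := hs w ws; rewrite /= E phid sub0r cmodN ltxx //.
  have zr : cmod (z - z) < r by rewrite subrr cmod0.
  have -> : w - z = phi (psi w) * (psi w - psi z) by rewrite -hphi !upsi.
  by rewrite /= mulrA mulVf // mul1r addrC subrK.
- exists (fun w => ((phi \o psi) w)^-1); split; last 2 first.
  + by rewrite /= phid.
  + by move=> w; rewrite subrr mulr0 addr0 [psi z + _]addrC addrK.
  + exact: ccontV.
Qed.

Lemma pow_small (x y M : R) : 0 <= x -> x < y -> 0 <= M ->
  forall e, 0 < e -> exists n, M * (x / y) ^+ n < e.
Proof.
move=> x0 xy M0 e e0; apply: contrapT => /forallNP h.
have y0 : 0 < y by exact: le_lt_trans x0 xy.
have := @pow_le _ y x e M x0 e0; rewrite leNgt xy => /(_ _) h2.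
suff : false by [].
apply: h2 => n; have /negP := h n; rewrite -leNgt expr_div_n mulrA ler_pdivlMr ?exprn_gt0 //.
by rewrite mulrC [_ * M]mulrC.
Qed.

(* Near a critical point [u - u z = (w - z)^m h] with h bounded away from 0, so
   that psi is holomorphic and bounded off the critical value, hence Lipschitz;
   this forces [m = 1]. *)
Lemma cder_inverse (u psi : R[i] -> R[i]) z0 r :
  0 < r -> (forall w, cmod (w - psi z0) <= r -> exists d, cder u w d) ->
  (forall w, cmod (w - z0) <= r -> ccont psi w /\ u (psi w) = w) ->
  exists d, cder psi z0 d.
Proof.
move=> r0 du0 hpsi0; pose a := psi z0.
have [cpsi ua] := hpsi0 z0 (eq_ind_r (fun x => cmod x <= r) (eq_ind_r (fun x => x <= r) (ltW r0) (cmod0 R)) (subrr z0)).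
rewrite -/a in ua.
have [d hd] := du0 a (eq_ind_r (fun x => cmod x <= r) (eq_ind_r (fun x => x <= r) (ltW r0) (cmod0 R)) (subrr a)).
have [s s0 hs] := cder_cont hd (ltr01 : 0 < 1 :> R).
pose rho := Num.min r s / 2.
have rho0 : 0 < rho by rewrite /rho divr_gt0 // lt_min r0.
have : rho < Num.min r s by rewrite /rho ltr_pdivrMr // ltr_pMr ?ltr1n // lt_min r0.
rewrite lt_min => /andP[rhor rhos].
pose v w := u w - z0.
have dv w : cmod (w - a) <= rho -> exists e, cder v w e.
  move=> h; have [|e he] := du0 w; first exact: le_trans h (ltW rhor).
  by exists (e - 0); exact: cderB he (cder_cst _ _).
have v1 w : cmod (w - a) <= rho -> cmod (v w) <= 1.
  by move=> h; have := hs w (le_lt_trans h rhos); rewrite ua; exact: ltW.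
(* [P m] says that [v] vanishes to order at least [m] at [a]. By the maximum principle ([PM]) the
   constant may then be taken to be 1 / rho^m, whatever [C] is. *)
pose P m := exists C : R, forall w, cmod (w - a) <= rho -> cmod (v w) <= C * cmod (w - a) ^+ m.
have P0 : P 0%N by exists 1 => w h; rewrite expr0 mulr1; exact: v1.
have rhoC : cmod (rho%:C : R[i]) = rho by rewrite cmodC gtr0_norm.
have PM m : P m -> forall w, cmod (w - a) < rho -> w != a ->
   cmod (v w / (w - a) ^+ m) <= 1 / rho ^+ m.
  move=> [C hC] w wr wa; apply: (@max_principle _ (fun w => v w / (w - a) ^+ m) [:: a] a rho _ C) => //.
  - by move=> e; rewrite inE => /eqP ->; rewrite subrr cmod0.
  - move=> y yr; rewrite inE => ya; have [e he] := dv y yr.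
    have [k hk] := cderX m (cderB (cder_id y) (cder_cst a y)).
    by apply: (cder_div he hk); rewrite expf_neq0 // subr_eq0.
  - move=> y yr; rewrite inE => ya; rewrite cmod_div cmodX ler_pdivrMr; first exact: hC.
    by rewrite exprn_gt0 // cmod_gt0 subr_eq0.
  - move=> y yr; rewrite cmod_div cmodX yr ler_pM2r ?invr_gt0 ?exprn_gt0 //.
    by apply: v1; rewrite yr.
  - by rewrite inE.
(* Were [v] of infinite order at [a], the bounds with 1 / rho^m would give v = 0 near [a], but
   [u (psi y) = y] takes values other than [z0]. *)
have notP : exists m, ~ P m.
  apply: contrapT => /forallNP nP.
  have vz w : cmod (w - a) < rho -> v w = 0.
    move=> wr; have [->|wa] := eqVneq w a; first by rewrite /v ua subrr.
    apply/eqP; rewrite -cmod_eq0 eq_le cmod_ge0 andbT leNgt; apply/negP => v0.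
    have [n hn] := pow_small (cmod_ge0 (w - a)) wr ler01 v0.
    have /PM/(_ w wr wa) : P n by apply: contrapT; exact: nP.
    rewrite cmod_div cmodX ler_pdivrMr ?exprn_gt0 ?cmod_gt0 ?subr_eq0 //.
    by move: hn; rewrite mul1r expr_div_n mul1r mulrC ltNge => /negP.
  have [t t0 ht] := cpsi rho rho0.
  pose y := z0 + (Num.min t r / 2)%:C.
  have yz : cmod (y - z0) = Num.min t r / 2.
    by rewrite /y [z0 + _]addrC addrK cmodC gtr0_norm // divr_gt0 // lt_min t0.
  have m0 : 0 < Num.min t r by rewrite lt_min t0.
  have : Num.min t r / 2 < Num.min t r by lra.
  rewrite -yz lt_min => /andP[yt yr].
  have := vz _ (ht y yt); have [_ uy] := hpsi0 y (ltW yr).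
  rewrite /v uy => /eqP; rewrite -cmod_eq0 yz => /eqP; lra.
have [m [Pm nPm]] : exists m, P m /\ ~ P m.+1.
  have [n nP] := notP; apply: contrapT => /forallNP h; apply: nP.
  by elim: n => // n IH; apply: contrapT => nn; apply: (h n).
have m1 : (0 < m)%N.
  case: m Pm nPm => // _ nP1; exfalso; apply: nP1.
  exists (2 * 1 / (rho - cmod (a - a))) => w wr; rewrite expr1.
  have [wr1|wr1] := ltP (cmod (w - a)) rho.
    have -> : v w = v w - v a by rewrite [v a]/v ua subrr subr0.
    apply: (@hol_lipschitz _ v [::] a rho 1 w a) => //.
    - by move=> y h _; exact: dv.
    - by move=> y h _; exact: v1.
    - by rewrite subrr cmod0.
  rewrite subrr cmod0 subr0; apply: (le_trans (v1 w wr)).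
  rewrite mulrAC ler_pdivlMr // mul1r mulr1; lra.
pose h w := v w / (w - a) ^+ m.
have hB := PM m Pm; set Bd := 1 / rho ^+ m in hB.
have dh y : cmod (y - a) <= rho -> y \notin [:: a] -> exists e, cder h y e.
  move=> yr; rewrite inE => ya; have [e he] := dv y yr.
  have [k hk] := cderX m (cderB (cder_id y) (cder_cst a y)).
  by apply: (cder_div he hk); rewrite expf_neq0 // subr_eq0.
have hB' y : cmod (y - a) <= rho -> y \notin [:: a] -> cmod (h y) <= Bd.
  rewrite le_eqVlt inE => /orP[/eqP yr|yr] ya; last exact: hB.
  rewrite cmod_div cmodX yr ler_pM2r ?invr_gt0 ?exprn_gt0 //.
  by apply: v1; rewrite yr.
have Bd0 : 0 < Bd by rewrite divr_gt0 ?exprn_gt0.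
pose K := 2 * Bd / (rho - rho / 2); have K0 : 0 < K.
  by apply: divr_gt0; [exact: mulr_gt0|lra].
have hL y w : cmod (y - a) < rho -> cmod (w - a) <= rho / 2 -> y != a -> w != a ->
  cmod (h y - h w) <= K * cmod (y - w).
  move=> yr wr ya wa.
  apply: le_trans (_ : 2 * Bd / (rho - cmod (w - a)) * cmod (y - w) <= _).
    apply: (@hol_lipschitz _ h [:: a] a rho Bd y w) => //; rewrite ?inE //.
      by move=> e; rewrite inE => /eqP ->; rewrite subrr cmod0.
    by lra.
  rewrite ler_wpM2r ?cmod_ge0 // /K ler_pM2l ?lef_pV2 ?posrE; try lra; exact: mulr_gt0.
(* If [h] had arbitrarily small values near [a], the Lipschitz bound would give |h w| <= K |w - a|,
   that is, order m + 1. *)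
have [c [c0 [t [t0 ht]]]] : exists c : R, 0 < c /\ exists t : R, 0 < t /\
    forall w, cmod (w - a) < t -> w != a -> c <= cmod (h w).
  apply: contrapT => nc; apply: nPm.
  exists (Num.max K (1 / rho ^+ m.+1)) => w wr.
  have M1 : 1 / rho ^+ m.+1 <= Num.max K (1 / rho ^+ m.+1) by rewrite le_max lexx orbT.
  have M2 : K <= Num.max K (1 / rho ^+ m.+1) by rewrite le_max lexx.
  have [->|wa] := eqVneq w a; first by rewrite /v ua !subrr cmod0 expr0n mulr0.
  have wa0 : 0 < cmod (w - a) by rewrite cmod_gt0 subr_eq0.
  move: wr; rewrite le_eqVlt => /orP[/eqP wr|wr].
    have vw := v1 w (eq_ind_r (fun x => x <= rho) (lexx rho) wr).
    rewrite wr -ler_pdivrMr ?exprn_gt0 //; apply: le_trans M1.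
    by rewrite ler_pM2r // invr_gt0 exprn_gt0.
  have : cmod (h w) <= K * cmod (w - a).
    apply: (@eps_le _ _ _ (1 + K)) => e e0; rewrite leNgt; apply/negP => lt; apply: nc.
    exists e; split => //; exists (Num.min e (rho / 2)); split.
      by rewrite lt_min e0 divr_gt0.
    move=> y; rewrite lt_min => /andP[ye yr] ya; rewrite leNgt; apply/negP => hy.
    have := hL w y wr (ltW yr) wa ya => H.
    have h1 : cmod (h w) <= cmod (h w - h y) + cmod (h y).
      by rewrite -{1}(subrK (h y) (h w)) cmodD.
    have h2 : cmod (w - y) <= cmod (w - a) + e.
      by apply: le_trans (cmod_dist _ a _) _; rewrite (cmodBC a) lerD2l ltW.
    have h3 : K * cmod (w - y) <= K * (cmod (w - a) + e) by rewrite ler_pM2l.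
    lra.
  rewrite /h cmod_div cmodX ler_pdivrMr ?exprn_gt0 // => hw; apply: (le_trans hw).
  by rewrite [cmod (w - a) ^+ m.+1]exprS mulrA ler_wpM2r ?exprn_ge0 ?cmod_ge0 // ler_pM2r.
pose t1 := Num.min (Num.min t (rho / 2)) (c / (K + 1)).
have K10 : 0 < K + 1 by lra.
have t10 : 0 < t1 by rewrite !lt_min t0 /= (divr_gt0 c0 K10) andbT; lra.
(* The derivative of [u] at [w] is (w - a)^(m-1) (e (w - a) + m h(w)) with |e| <= K, and the choice
   of [t1] makes the second summand dominate. *)
have nc w : cmod (w - a) < t1 -> w != a -> exists2 e, e != 0 & cder u w e.
  rewrite !lt_min => /andP[/andP[wt wr] wc] wa.
  have wrho : cmod (w - a) < rho by lra.
  have wa0 : w - a != 0 by rewrite subr_eq0.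
  have wE : w \notin [:: a] by rewrite inE.
  have [e he] := dh w (ltW wrho) wE.
  have eK : cmod e <= K.
    apply: (@eps_le _ _ _ 1) => x x0; rewrite mul1r.
    have [y y0 hy] := (cderP _ _ _).1 he x x0.
    pose n := Num.min y (Num.min (rho - cmod (w - a)) (cmod (w - a))) / 2.
    have n0 : 0 < Num.min y (Num.min (rho - cmod (w - a)) (cmod (w - a))).
      by rewrite !lt_min y0 subr_gt0 wrho cmod_gt0.
    have np : 0 < n by rewrite divr_gt0.
    have : n < Num.min y (Num.min (rho - cmod (w - a)) (cmod (w - a))) by rewrite /n; lra.
    rewrite !lt_min => /and3P[n1 n2 n3].
    have wn : w + n%:C - w = n%:C by rewrite addrC addKr.
    have := hy (w + n%:C); rewrite wn cmodC gtr0_norm // => /(_ n1) H1.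
    have := hL (w + n%:C) w; rewrite wn cmodC gtr0_norm //.
    have wna : w + n%:C != a.
      apply/negP => /eqP E; move: n3.
      rewrite (_ : w - a = - n%:C); last by rewrite -E; ring.
      by rewrite cmodN cmodC gtr0_norm // ltxx.
    have wnr : cmod (w + n%:C - a) < rho.
      have -> : w + n%:C - a = (w - a) + n%:C by ring.
      by apply: le_lt_trans (cmodD _ _) _; rewrite cmodC gtr0_norm //; lra.
    move=> /(_ wnr (ltW wr) wna wa) H2.
    have : cmod (e * n%:C) <= x * n + K * n.
      have -> : e * n%:C = (h (w + n%:C) - h w) - (h (w + n%:C) - h w - e * n%:C) by ring.
      by apply: le_trans (cmodB _ _) _; rewrite addrC lerD.
    by rewrite cmodM cmodC gtr0_norm // -mulrDl ler_pM2r // addrC.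
  have hm : exists k, cder (fun w => (w - a) ^+ m) w k /\ k = m%:R * (w - a) ^+ m.-1.
    have X n : cder (fun w => (w - a) ^+ n) w (n%:R * (w - a) ^+ n.-1).
      elim: n => [|n IH]; first by rewrite mul0r; exact: cder_cst.
      have := cderM (cderB (cder_id w) (cder_cst a w)) IH.
      rewrite (_ : _ + _ = n.+1%:R * (w - a) ^+ n.+1.-1).
        by apply: (@cder_near _ _ _ _ _ 1) => // ? _; rewrite exprS.
      rewrite subr0 mul1r /=; case: (n) => [|k]; first by rewrite expr0 mul0r mulr0 addr0 mul1r.
      by rewrite /= exprS -[k.+2%:R]natr1; ring.
    by eexists; split; [exact: X|].
  case: hm => k [hk kE].
  have Hu : cder u w (e * (w - a) ^+ m + h w * k + 0).
    apply: (@cder_near _ (fun w => h w * (w - a) ^+ m + z0) _ _ _ (cmod (w - a))).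
    - by rewrite cmod_gt0.
    - move=> y hy; rewrite /h /v divfK ?subrK // expf_neq0 // subr_eq0.
      by apply/negP => /eqP E; move: hy; rewrite E cmodBC ltxx.
    - exact: cderD (cderM he hk) (cder_cst _ _).
  exists (e * (w - a) ^+ m + h w * k + 0) => //; rewrite addr0 kE.
  have -> : e * (w - a) ^+ m + h w * (m%:R * (w - a) ^+ m.-1) =
     (e * (w - a) + h w * m%:R) * (w - a) ^+ m.-1.
    by rewrite -{1}(prednK m1) exprS; ring.
  rewrite mulf_neq0 ?expf_neq0 // -cmod_gt0.
  have l1 : cmod (e * (w - a)) <= K * cmod (w - a) by rewrite cmodM ler_wpM2r ?cmod_ge0.
  have l2 : c <= cmod (h w * m%:R).
    rewrite cmodM cmod_nat; apply: le_trans (ht w wt wa) _.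
    by rewrite ler_peMr ?cmod_ge0 // ler1n.
  have l3 : (K + 1) * cmod (w - a) < c by rewrite mulrC -ltr_pdivlMr.
  have l4 : cmod (h w * m%:R) - cmod (e * (w - a)) <= cmod (e * (w - a) + h w * m%:R).
    by have := cmod_lerB (h w * m%:R) (- (e * (w - a))); rewrite cmodN opprK [_ + e * _]addrC.
  have l5 := cmod_ge0 (w - a).
  lra.
have [x x0 hx] := cpsi t1 t10.
pose y := Num.min x r / 2.
have y0 : 0 < Num.min x r by rewrite lt_min x0.
have yp : 0 < y by rewrite divr_gt0.
have : y < Num.min x r by rewrite /y; lra.
rewrite lt_min => /andP[yx yr].
have dpsi w : cmod (w - z0) <= y -> w \notin [:: z0] -> exists e, cder psi w e.
  move=> wy; rewrite inE => wz.
  have [cw uw] := hpsi0 w (le_trans wy (ltW yr)).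
  have pa : psi w != a by apply/negP => /eqP E; move: uw wz; rewrite E ua => ->; rewrite eqxx.
  have [e e0 he] := nc _ (hx w (le_lt_trans wy yx)) pa.
  exists e^-1; apply: (@cder_right_inverse u psi w (cmod (w - z0) / 2)) => //.
    by rewrite divr_gt0 // cmod_gt0 subr_eq0.
  move=> w' h'; apply: (hpsi0 w' _).2; apply: le_trans (cmod_dist _ w _) _.
  have := cmod_ge0 (w - z0); rewrite /y in wy; have : Num.min x r <= r by rewrite ge_min lexx orbT.
  lra.
have psiB w : cmod (w - z0) <= y -> w \notin [:: z0] -> cmod (psi w) <= cmod a + t1.
  move=> wy _; rewrite -{1}(subrK a (psi w)) addrC; apply: le_trans (cmodD _ _) _.
  by rewrite lerD2l ltW // hx // (le_lt_trans wy yx).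
pose L := 2 * (cmod a + t1) / (y - y / 2).
have at0 : 0 < cmod a + t1 by rewrite ltr_wpDl ?cmod_ge0.
have L0 : 0 < L by apply: divr_gt0; [exact: mulr_gt0|lra].
have psiL w : cmod (w - z0) < y -> w != z0 -> cmod (psi w - a) <= L * cmod (w - z0).
  move=> wy wz; apply: (@eps_le _ _ _ (1 + L)) => e e0.
  have [q q0 hq] := cpsi e e0.
  pose n := Num.min (Num.min q e) (y / 2) / 2.
  have n0 : 0 < Num.min (Num.min q e) (y / 2) by rewrite !lt_min q0 e0 divr_gt0.
  have np : 0 < n by rewrite divr_gt0.
  have : n < Num.min (Num.min q e) (y / 2) by rewrite /n; lra.
  rewrite !lt_min => /andP[/andP[n1 n2] n3].
  pose w' := z0 + n%:C; have w'n : cmod (w' - z0) = n by rewrite /w' [z0 + _]addrC addrK cmodC gtr0_norm.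
  have w'z : w' != z0 by rewrite -subr_eq0 -cmod_gt0 w'n.
  have w'y : cmod (w' - z0) < y by rewrite w'n; lra.
  have H : cmod (psi w - psi w') <= L * cmod (w - w').
    apply: le_trans (_ : 2 * (cmod a + t1) / (y - cmod (w' - z0)) * cmod (w - w') <= _).
      apply: (@hol_lipschitz _ psi [:: z0] z0 y (cmod a + t1) w w') => //; rewrite ?inE //.
      by move=> ?; rewrite inE => /eqP ->; rewrite subrr cmod0.
    rewrite ler_wpM2r ?cmod_ge0 // /L ler_pM2l; last exact: mulr_gt0.
    by rewrite lef_pV2 ?posrE ?w'n; lra.
  have h1 : cmod (psi w' - a) < e by apply: hq; rewrite w'n.
  have h2 : cmod (w - w') <= cmod (w - z0) + e.
    by apply: le_trans (cmod_dist _ z0 _) _; rewrite (cmodBC z0) w'n lerD2l ltW.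
  have h3 : L * cmod (w - w') <= L * (cmod (w - z0) + e) by rewrite ler_pM2l.
  have := cmod_dist (psi w) (psi w') a; lra.
have m_eq1 : m = 1%N.
  apply/eqP; rewrite eqn_leq m1 andbT leqNgt; apply/negP => m2.
  (* |w - z0| <= C |psi w - a|^2 <= C L^2 |w - z0|^2 *)
  have [C hC] : exists C : R, forall w, cmod (w - a) <= rho -> cmod (v w) <= C * cmod (w - a) ^+ 2.
    have [C hC] := Pm; exists (`|C| * rho ^+ (m - 2)) => w wr.
    apply: (le_trans (hC w wr)); rewrite -{1}(subnK m2) exprD mulrA.
    rewrite ler_wpM2r ?exprn_ge0 ?cmod_ge0 //.
    apply: (@le_trans _ _ (`|C| * cmod (w - a) ^+ (m - 2))).
      by rewrite ler_wpM2r ?exprn_ge0 ?cmod_ge0 // ler_norm.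
    by rewrite ler_wpM2l // lerXn2r ?nnegrE ?cmod_ge0 // ltW.
  have C0 : 0 <= C.
    have := hC (a + rho%:C); rewrite [a + _]addrC addrK rhoC lexx => /(_ isT).
    have := cmod_ge0 (v (rho%:C + a)) => h1 h2; have := le_trans h1 h2.
    by rewrite pmulr_lge0 // exprn_gt0.
  have k0 : 0 < C * L ^+ 2 + 1 by rewrite ltr_wpDl // mulr_ge0 ?exprn_ge0 // ltW.
  pose n := Num.min y (C * L ^+ 2 + 1)^-1 / 2.
  have n0 : 0 < Num.min y (C * L ^+ 2 + 1)^-1 by rewrite lt_min yp invr_gt0.
  have np : 0 < n by rewrite divr_gt0.
  have : n < Num.min y (C * L ^+ 2 + 1)^-1 by rewrite /n; lra.
  rewrite lt_min => /andP[ny nk].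
  pose w' := z0 + n%:C; have w'n : cmod (w' - z0) = n by rewrite /w' [z0 + _]addrC addrK cmodC gtr0_norm.
  have w'z : w' != z0 by rewrite -subr_eq0 -cmod_gt0 w'n.
  have [_ uw] := hpsi0 w' ltac:(rewrite w'n; lra).
  have t1r : t1 <= rho / 2 by rewrite /t1 !ge_min lexx orbT.
  have pr : cmod (psi w' - a) <= rho.
    by apply: le_trans (ltW (hx w' _)) _; rewrite ?w'n; lra.
  have := hC _ pr; rewrite /v uw w'n => H1.
  have := psiL w' ltac:(by rewrite w'n) w'z; rewrite w'n => H2.
  have H3 : cmod (psi w' - a) ^+ 2 <= (L * n) ^+ 2.
    have Ln0 : 0 <= L * n by exact: mulr_ge0 (ltW L0) (ltW np).
    by rewrite lerXn2r ?nnegrE ?cmod_ge0.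
  have H4 : C * cmod (psi w' - a) ^+ 2 <= C * (L * n) ^+ 2 by rewrite ler_wpM2l.
  have H5 : n * (C * L ^+ 2 + 1) < 1 by rewrite -ltr_pdivlMr // mul1r.
  have H6 : C * (L * n) ^+ 2 = n * (n * (C * L ^+ 2)) by ring.
  have H7 : n <= n * (n * (C * L ^+ 2)) by rewrite -H6; exact: le_trans H1 H4.
  have : 1 <= n * (C * L ^+ 2) by rewrite -(ler_pM2l np) mulr1.
  lra.
have d0 : d != 0.
  apply/negP => /eqP E; have := hd; rewrite E => /cderP /(_ (c / 2)) [|q q0 hq].
    by rewrite divr_gt0.
  pose n := Num.min q (Num.min t rho) / 2.
  have n0 : 0 < Num.min q (Num.min t rho) by rewrite !lt_min q0 t0.
  have np : 0 < n by rewrite divr_gt0.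
  have : n < Num.min q (Num.min t rho) by rewrite /n; lra.
  rewrite !lt_min => /and3P[n1 n2 n3].
  pose w := a + n%:C; have wn : cmod (w - a) = n by rewrite /w [a + _]addrC addrK cmodC gtr0_norm.
  have wa : w != a by rewrite -subr_eq0 -cmod_gt0 wn.
  have := hq w; rewrite wn mul0r subr0 ua => /(_ n1) H1.
  have := ht w; rewrite wn => /(_ n2 wa); rewrite /h m_eq1 expr1 cmod_div wn ler_pdivlMr // => H2.
  have : c * n <= c / 2 * n by exact: le_trans H2 H1.
  rewrite ler_pM2r //; lra.
exists d^-1; apply: (@cder_right_inverse u psi z0 r) => // w wr.
by have [] := hpsi0 w (ltW wr).
Qed.

End Inverse.

(** * Limits along ultrafilters *)

Section UltraLimits.
Variables (R : realType) (I : Type) (G : set_system I).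
Context {UG : UltraFilter G}.
Implicit Types (f g : I -> R[i]) (a l m z : R[i]).

Definition clim f l := forall e : R, 0 < e -> \forall i \near G, cmod (f i - l) < e.

Lemma ultra_ex (P : I -> Prop) : (\forall i \near G, P i) -> exists i, P i.
Proof. by move=> h; exact: filter_ex h. Qed.

Lemma ultra_or (P Q : I -> Prop) : (\forall i \near G, P i \/ Q i) ->
  (\forall i \near G, P i) \/ (\forall i \near G, Q i).
Proof.
move=> h; have [hP|hP] := in_ultra_setVsetC (P : set I) UG; first by left.
by right; apply: filterS2 h hP => i [].
Qed.

Lemma ultra_not (P : I -> Prop) : ~ (\forall i \near G, P i) -> \forall i \near G, ~ P i.
Proof. by move=> nP; have [|] := in_ultra_setVsetC (P : set I) UG. Qed.

(** Along an ultrafilter one of finitely many alternatives is eventually constant; this replaces the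
    passage to subsequences. *)
Lemma ultra_big (J : eqType) (s : seq J) (P : J -> I -> Prop) :
  (\forall i \near G, exists2 j, j \in s & P j i) ->
  exists2 j, j \in s & \forall i \near G, P j i.
Proof.
elim: s => [|j s IH] h; first by have [i [j]] := ultra_ex h.
have : \forall i \near G, P j i \/ exists2 j', j' \in s & P j' i.
  apply: filterS h => i [j']; rewrite in_cons => /orP[/eqP -> ?|? ?]; first by left.
  by right; exists j'.
move=> /ultra_or[hj|/IH[j' js hj']]; first by exists j; rewrite ?mem_head.
by exists j'; rewrite // in_cons js orbT.
Qed.

Lemma ultra_fmap (T : Type) (f : I -> T) : UltraFilter (f @ G).
Proof.
split; first exact: fmap_proper_filter.
move=> H HF sH; rewrite eqEsubset; split => // A HA.
have [//|nA] := in_ultra_setVsetC (f @^-1` A) UG.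
have : H (A `&` ~` A) by apply: filterI => //; exact: sH.
by rewrite setICr => /filter_not_empty.
Qed.

Lemma compact_ultralim (T : topologicalType) (K : set T) (f : I -> T) : compact K ->
  (\forall i \near G, K (f i)) -> exists2 x, K x & f @ G --> x.
Proof.
move=> cK hK; rewrite compact_ultra in cK.
by have [x [Kx hx]] := cK (f @ G) (ultra_fmap f) hK; exists x.
Qed.

Lemma real_ultralim (f : I -> R) (M : R) : (\forall i \near G, `|f i| <= M) ->
  exists l : R, f @ G --> l.
Proof.
move=> h; have hI : \forall i \near G, `[- M, M]%classic (f i).
  by apply: filterS h => i; rewrite /= in_itv /= ler_norml.
by have [l _ hl] := compact_ultralim (@segment_compact R (- M) M) hI; exists l.
Qed.

Lemma climP f l : clim f l <-> (f : I -> Cplx R) @ G --> (l : Cplx R).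
Proof.
split.
  move=> h A /nbhs_cmod[e e0 hA]; apply: filterS (h e e0) => i; exact: hA.
move=> h e e0; have : nbhs (l : Cplx R) [set w | cmod (w - l) < e] by apply/nbhs_cmod; exists e.
by move=> /h.
Qed.

Lemma clim_ex f (M : R) : (\forall i \near G, cmod (f i) <= M) -> exists l, clim f l.
Proof.
move=> h.
have [x hx] : exists l : R, (fun i => complex.Re (f i)) @ G --> l.
  by apply: (@real_ultralim _ M); apply: filterS h => i; apply: le_trans (cmod_Re _).
have [y hy] : exists l : R, (fun i => complex.Im (f i)) @ G --> l.
  by apply: (@real_ultralim _ M); apply: filterS h => i; apply: le_trans (cmod_Im _).
exists (x +i* y) => e e0; have e2 : 0 < e / 2 by lra.
have h1 : \forall i \near G, ball x (e / 2) (complex.Re (f i)) by apply: hx; exact: nbhsx_ballx.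
have h2 : \forall i \near G, ball y (e / 2) (complex.Im (f i)) by apply: hy; exact: nbhsx_ballx.
apply: filterS2 h1 h2 => i; rewrite -!ball_normE /= => h1 h2.
apply: le_lt_trans (cmod_le _) _; move: h1 h2; case: (f i) => a b /=.
by rewrite (distrC x) (distrC y) => h1 h2; lra.
Qed.

Lemma clim_uniq f l m : clim f l -> clim f m -> l = m.
Proof.
move=> hl hm; apply/eqP; rewrite -subr_eq0 -cmod_eq0 eq_le cmod_ge0 andbT.
apply: (@eps_le _ _ _ 2) => e e0; rewrite add0r.
have [i [h1 h2]] := ultra_ex (filterI (hl e e0) (hm e e0)).
apply: le_trans (cmod_dist _ (f i) _) _; rewrite cmodBC; lra.
Qed.

Lemma clim_cst a : clim (fun=> a) a.
Proof. by move=> e e0; apply: nearW => i; rewrite subrr cmod0. Qed.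

Lemma clim_near f g l : (\forall i \near G, f i = g i) -> clim f l -> clim g l.
Proof. by move=> fg hf e /hf h; apply: filterS2 fg h => i ->. Qed.

Lemma climD f g l m : clim f l -> clim g m -> clim (fun i => f i + g i) (l + m).
Proof.
move=> hf hg e e0; have e2 : 0 < e / 2 by lra.
apply: filterS2 (hf _ e2) (hg _ e2) => i h1 h2.
rewrite (_ : _ - _ = (f i - l) + (g i - m)); last by ring.
by apply: le_lt_trans (cmodD _ _) _; lra.
Qed.

Lemma clim_ccont (phi : R[i] -> R[i]) f l : ccont phi l -> clim f l ->
  clim (fun i => phi (f i)) (phi l).
Proof.
by move=> cphi hf e e0; have [d d0 hd] := cphi e e0; apply: filterS (hf d d0) => i; exact: hd.
Qed.

Lemma clim_bounded f l : clim f l -> \forall i \near G, cmod (f i) <= cmod l + 1.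
Proof.
move=> /(_ _ ltr01); apply: filterS => i h.
by rewrite -[f i](subrK l) addrC (le_trans (cmodD _ _)) // lerD2l ltW.
Qed.

Lemma climM f g l m : clim f l -> clim g m -> clim (fun i => f i * g i) (l * m).
Proof.
move=> hf hg e e0; pose k := cmod l + cmod m + 2.
have k0 : 0 < k by rewrite /k; have := cmod_ge0 l; have := cmod_ge0 m; lra.
apply: filterS3 (hf _ (divr_gt0 e0 k0)) (hg _ (divr_gt0 e0 k0)) (clim_bounded hf) => i h1 h2 h3.
rewrite (_ : _ - _ = f i * (g i - m) + (f i - l) * m); last by ring.
apply: le_lt_trans (cmodD _ _) _; rewrite !cmodM.
have h4 : cmod (f i) * cmod (g i - m) <= (cmod l + 1) * (e / k).
  by rewrite ler_pM ?cmod_ge0 // ltW.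
have h5 : cmod (f i - l) * cmod m <= e / k * cmod m by rewrite ler_wpM2r ?cmod_ge0 // ltW.
have h6 : e / k * k = e by rewrite divfK // gt_eqF.
have h7 : 0 < e / k by rewrite divr_gt0.
rewrite /k in h6 h7 h5 h4 *; nra.
Qed.

Lemma climN f l : clim f l -> clim (fun i => - f i) (- l).
Proof.
move=> hf e /hf; apply: filterS => i h; rewrite (_ : _ - _ = - (f i - l)) ?cmodN //; ring.
Qed.

Lemma climB f g l m : clim f l -> clim g m -> clim (fun i => f i - g i) (l - m).
Proof. by move=> hf /climN; exact: climD. Qed.

Lemma climV f l : l != 0 -> clim f l -> clim (fun i => (f i)^-1) l^-1.
Proof. by move=> l0; apply: clim_ccont; apply: (ccontV l0 (@ccont_id R l)). Qed.

Lemma climX f l n : clim f l -> clim (fun i => f i ^+ n) (l ^+ n).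
Proof.
move=> hf; elim: n => [|n IH]; first exact: clim_cst.
rewrite exprS; apply: clim_near (climM hf IH); by apply: nearW => i; rewrite exprS.
Qed.

Lemma clim_cj f l : clim f l -> clim (fun i => cj (f i)) (cj l).
Proof. by move=> hf e /hf; apply: filterS => i h; rewrite -rmorphB cmod_cj. Qed.

Lemma clim_le f l (M : R) : clim f l -> (\forall i \near G, cmod (f i) <= M) -> cmod l <= M.
Proof.
move=> hf hM; apply: (@eps_le _ _ _ 1) => e e0; rewrite mul1r.
have [i [h1 h2]] := ultra_ex (filterI (hf e e0) hM).
have := cmod_dist l (f i) 0; rewrite !subr0 cmodBC; lra.
Qed.

Lemma clim_ge f l (M : R) : clim f l -> (\forall i \near G, M <= cmod (f i)) -> M <= cmod l.
Proof.
move=> hf hM; apply: (@eps_le _ _ _ 1) => e e0; rewrite mul1r.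
have [i [h1 h2]] := ultra_ex (filterI (hf e e0) hM).
have := cmod_dist (f i) l 0; rewrite !subr0; lra.
Qed.

Lemma clim_cmodC f l : clim f l -> clim (fun i => (cmod (f i))%:C) (cmod l)%:C.
Proof.
move=> hf e /hf; apply: filterS => i h; rewrite -rmorphB cmodC; apply: le_lt_trans h.
rewrite ler_norml cmod_lerB andbT; have := cmod_lerB l (f i); rewrite cmodBC; lra.
Qed.

Section Holomorphic.
Variables (F : I -> R[i] -> R[i]) (f : R[i] -> R[i]) (a : R[i]) (r M : R).
Hypothesis r0 : 0 < r.
Hypothesis dF : \forall i \near G, forall w, cmod (w - a) <= r ->
  (exists d, cder (F i) w d) /\ cmod (F i w) <= M.
Hypothesis lF : forall w, cmod (w - a) < r -> clim (F ^~ w) (f w).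

(** Weierstrass' theorem: the constants of [second_order] do not depend on the index, so its
    estimate passes to the limit. *)
Lemma hol_lim (D : I -> R[i]) : (\forall i \near G, cder (F i) a (D i)) ->
  exists2 d, cder f a d & clim D d.
Proof.
move=> hD.
have so z : cmod (z - a) < r -> \forall i \near G, cmod (D i) <= 2 * M / r /\
   cmod (F i z - F i a - D i * (z - a)) <= 8 * M / r ^+ 2 * cmod (z - a) ^+ 2.
  move=> zr; apply: filterS2 dF hD => i h hd.
  by apply: second_order => // w /h[].
have aa : cmod (a - a) < r by rewrite subrr cmod0.
have [d hd] : exists d, clim D d.
  by apply: (@clim_ex _ (2 * M / r)); apply: filterS (so a aa) => i [].
exists d => //.
pose K := 8 * M / r ^+ 2.
have est z : cmod (z - a) < r -> cmod (f z - f a - d * (z - a)) <= K * cmod (z - a) ^+ 2.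
  move=> zr; apply: clim_le (climB (climB (lF zr) (lF aa)) (climM hd (clim_cst (z - a)))) _.
  by apply: filterS (so z zr) => i [].
apply/cderP => e e0; have k0 : 0 < `|K| + 1 by rewrite ltr_wpDl.
exists (Num.min r (e / (`|K| + 1))); first by rewrite lt_min r0 divr_gt0.
move=> w; rewrite lt_min => /andP[wr we]; apply: (le_trans (est w wr)).
rewrite expr2 mulrA ler_wpM2r ?cmod_ge0 //.
rewrite ltr_pdivlMr // in we; apply: le_trans (ltW we).
rewrite mulrC ler_wpM2l ?cmod_ge0 //; have := ler_norm K; lra.
Qed.

Lemma hol_lim_ex : exists d, cder f a d.
Proof.
have aa : cmod (a - a) <= r by rewrite subrr cmod0 ltW.
have step i : exists D, (exists d, cder (F i) a d) -> cder (F i) a D.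
  by have [[d hd]|nd] := pselect (exists d, cder (F i) a d); [exists d|exists 0].
have [D hD] := choice step.
have [|d hd _] := @hol_lim D; last by exists d.
by apply: filterS dF => i /(_ a aa)[h _]; exact: hD.
Qed.

(** The functions are Lipschitz near [z0] with a common constant. *)
Lemma hol_lim_moving (z : I -> R[i]) z0 : cmod (z0 - a) < r -> clim z z0 ->
  clim (fun i => F i (z i)) (f z0).
Proof.
move=> zr hz.
have : \forall i \near G, cmod (z i - a) < r.
  have : 0 < r - cmod (z0 - a) by rewrite subr_gt0.
  move=> /hz; apply: filterS => i h; apply: le_lt_trans (cmod_dist _ z0 _) _; lra.
move=> hr; pose K := 2 * M / (r - cmod (z0 - a)).
have h : \forall i \near G, cmod (F i (z i) - F i z0) <= K * cmod (z i - z0).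
  apply: filterS2 dF hr => i hi hri; apply: (@hol_lipschitz _ (F i) [::] a r M) => //.
    by move=> w wr _; have [] := hi w wr.
  by move=> w wr _; have [] := hi w wr.
move=> e e0; have e2 : 0 < e / 2 by lra.
have k0 : 0 < `|K| + 1 by rewrite ltr_wpDl.
apply: filterS3 h (lF zr e2) (hz _ (divr_gt0 e2 k0)) => i h1 h2 h3.
apply: le_lt_trans (cmod_dist _ (F i z0) _) _.
rewrite ltr_pdivlMr // in h3.
have : K * cmod (z i - z0) <= (`|K| + 1) * cmod (z i - z0).
  by rewrite ler_wpM2r ?cmod_ge0 //; have := ler_norm K; lra.
lra.
Qed.

End Holomorphic.
End UltraLimits.

Section DiscMapLimits.
Variables (R : realType) (I : Type) (G : set_system I).
Context {UG : UltraFilter G}.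

(** Montel's theorem along an ultrafilter. A priori the limit only maps into the closed disc; since
    one of its values is interior, [schwarz_pick_inside] bounds all the others away from the
    circle. *)
Lemma disc_map_ultralim (F : I -> R[i] -> R[i]) (a : I -> R[i]) (a0 : R[i]) b0 :
  (\forall i \near G, disc_map (F i)) -> cmod a0 < 1 -> clim G a a0 ->
  cmod b0 < 1 -> clim G (fun i => F i (a i)) b0 ->
  exists f, [/\ disc_map f, f a0 = b0 &
     forall z (y : I -> R[i]), cmod z < 1 -> clim G y z -> clim G (fun i => F i (y i)) (f z)].
Proof.
move=> dF a1 ha b1 hb.
have step (z : R[i]) : exists w, cmod z < 1 -> clim G (F ^~ z) w.
  have [z1|z1] := boolP (cmod z < 1); last by exists 0.
  have [|l hl] := @clim_ex R I G _ (F ^~ z) 1; last by exists l.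
  by apply: filterS dF => i /(_ z z1)[_ /ltW].
have [f hf] := choice step.
have loc z r : cmod z + r < 1 -> \forall i \near G, forall w, cmod (w - z) <= r ->
    (exists d, cder (F i) w d) /\ cmod (F i w) <= 1.
  move=> zr; apply: filterS dF => i h w wr.
  have w1 : cmod w < 1 by have := cmod_dist w z 0; rewrite !subr0; lra.
  by have [hd /ltW h1] := h w w1.
have pt z w r : cmod z + r < 1 -> cmod (w - z) < r -> clim G (F ^~ w) (f w).
  by move=> zr wr; apply: hf; have := cmod_dist w z 0; rewrite !subr0; lra.
have rad (z : R[i]) : cmod z < 1 -> 0 < (1 - cmod z) / 2 /\ cmod z + (1 - cmod z) / 2 < 1.
  by move=> z1; split; lra.
have mov z (y : I -> R[i]) : cmod z < 1 -> clim G y z -> clim G (fun i => F i (y i)) (f z).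
  move=> z1 hy; have [r0 zr] := rad z z1.
  have zz : cmod (z - z) < (1 - cmod z) / 2 by rewrite subrr cmod0.
  exact: (hol_lim_moving (loc z _ zr) (fun w wr => pt z w _ zr wr) zz hy).
have fa : f a0 = b0 by exact: clim_uniq (mov a0 a a1 ha) hb.
exists f; split => // z z1; have [r0 zr] := rad z z1; split.
  exact: (hol_lim_ex r0 (loc z _ zr) (fun w wr => pt z w _ zr wr)).
have na : cmod (- a0) < 1 by rewrite cmodN.
have hb' : clim G (F ^~ a0) b0 by rewrite -fa; apply: mov => //; exact: clim_cst.
(* Halfway between |b0| and 1, so that eventually |F i a0| <= be. *)
pose be := (1 + cmod b0) / 2; have be1 : be < 1 by rewrite /be; lra.
have be0 : 0 <= be by rewrite /be; have := cmod_ge0 b0; lra.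
have bb : 0 < be - cmod b0 by rewrite /be; lra.
pose s := (1 - be ^+ 2) * (1 - cmod (mob (- a0) z) ^+ 2) / 4.
have k0 : 0 < 1 - cmod (mob (- a0) z) ^+ 2 by rewrite subr_gt0 sq_lt1 ?cmod_ge0 // mob_lt1.
have s0 : 0 < s by rewrite /s divr_gt0 // mulr_gt0 // subr_gt0 sq_lt1.
suff h : cmod (f z) ^+ 2 <= 1 - s by rewrite -sq_lt1 ?cmod_ge0 //; lra.
rewrite -cmodX; apply: clim_le (climX 2 (hf z z1)) _.
apply: filterS2 dF (hb' _ bb) => i h3 h4.
have := schwarz_pick_inside h3 a1 z1; rewrite cmodX => H.
have h5 : cmod (F i a0) <= be.
  rewrite -[F i a0](subrK b0); apply: le_trans (cmodD _ _) _; lra.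
have h6 : cmod (F i a0) ^+ 2 <= be ^+ 2 by rewrite ler_sqr ?nnegrE ?cmod_ge0.
suff : s <= (1 - cmod (F i a0) ^+ 2) * (1 - cmod (mob (- a0) z) ^+ 2) / 4 by lra.
by rewrite /s ler_pM2r ?invr_gt0 // ler_pM2r // lerD2l lerN2.
Qed.

End DiscMapLimits.

(** * Lifting paths and discs *)

Section Lifting.
Variable R : realType.
Implicit Types (z w v a b : R[i]).

(** Induction along the unit interval: the supremum of the parameters where [P] holds cannot stay
    below 1. *)
Lemma segment_ind (P : R -> Prop) : P 0 ->
  (forall t, 0 <= t <= 1 -> exists2 d : R, 0 < d & forall s s', 0 <= s <= 1 -> 0 <= s' <= 1 ->
     `|s - t| < d -> `|s' - t| < d -> P s -> P s') -> P 1.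
Proof.
move=> P0 h; pose S := [set s : R | 0 <= s <= 1 /\ P s].
have S0 : S 0 by split; rewrite ?lexx ?ler01.
have hS : has_sup S by split; [exists 0|exists 1 => s [/andP[]]].
have t01 : 0 <= sup S <= 1.
  rewrite sup_upper_bound //=; apply: ge_sup; [by exists 0|by move=> s [/andP[]]].
have [d d0 hd] := h _ t01.
have [s [s01 Ps] hs] := sup_adherent d0 hS.
have sS : s <= sup S by apply: sup_upper_bound.
have sd : `|s - sup S| < d by rewrite ltr_norml; lra.
have [l1|l1] := leP 1 (sup S + d / 2).
  apply: (hd s 1) => //; rewrite ?lexx ?ler01 // ltr_norml; lra.
have Ps' : P (sup S + d / 2) by apply: (hd s) => //; rewrite ?ltr_norml; lra.
have : sup S + d / 2 <= sup S by apply: sup_upper_bound => //; split => //; lra.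
lra.
Qed.

Definition seg w v (t : R) : R[i] := w + t%:C * (v - w).

Lemma seg0 w v : seg w v 0 = w.
Proof. by rewrite /seg mul0r addr0. Qed.

Lemma seg1 w v : seg w v 1 = v.
Proof. by rewrite /seg mul1r addrC subrK. Qed.

Lemma seg_dist w v (t s : R) : cmod (seg w v s - seg w v t) = `|s - t| * cmod (v - w).
Proof. by rewrite -cmodC -cmodM; congr cmod; rewrite /seg rmorphB; ring. Qed.

Lemma seg_convex w v c (r t : R) : 0 <= t <= 1 -> cmod (w - c) < r -> cmod (v - c) < r ->
  cmod (seg w v t - c) < r.
Proof.
move=> /andP[t0 t1] wr vr.
have -> : seg w v t - c = (1 - t)%:C * (w - c) + t%:C * (v - c).
  by rewrite /seg rmorphB rmorph1; ring.
apply: le_lt_trans (cmodD _ _) _; rewrite !cmodM !cmodC !ger0_norm ?subr_ge0 //.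
have [->|tn] := eqVneq t 0; first lra.
have tp : 0 < t by rewrite lt_def tn.
have : t * cmod (v - c) < t * r by rewrite ltr_pM2l.
have : (1 - t) * cmod (w - c) <= (1 - t) * r by rewrite ler_wpM2l ?subr_ge0 // ltW.
lra.
Qed.

(** [Lift w a] reads: the point [a] lies over [w]. In [local_lift] the radius does not depend on the
    lift [a], which is the even covering of a neighbourhood of [z]. *)
Variables (r : R) (Lift : R[i] -> R[i] -> Prop).
Hypothesis local_lift : forall z, cmod z < r -> exists2 d : R, 0 < d & forall w a,
  cmod (w - z) < d -> cmod w < r -> Lift w a -> exists g : R[i] -> R[i], g w = a /\
    forall v, cmod (v - z) < d -> cmod v < r -> ccont g v /\ Lift v (g v).
Hypothesis local_inj : forall w a, cmod w < r -> Lift w a -> exists2 e : R, 0 < e &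
  forall w' a' a'', cmod (w' - w) < e -> cmod w' < r -> cmod (a' - a) < e -> cmod (a'' - a) < e ->
    Lift w' a' -> Lift w' a'' -> a' = a''.

Definition is_lift (g : R[i] -> R[i]) w := ccont g w /\ Lift w (g w).

Lemma lift_uniq_seg g h w v : cmod w < r -> cmod v < r ->
  (forall t, 0 <= t <= 1 -> is_lift g (seg w v t) /\ is_lift h (seg w v t)) ->
  g w = h w -> g v = h v.
Proof.
move=> wr vr hl gh; rewrite -[v](seg1 w v).
have sr (t : R) : 0 <= t <= 1 -> cmod (seg w v t) < r.
  by move=> t01; rewrite -[seg _ _ _]subr0; apply: seg_convex; rewrite ?subr0.
apply: (@segment_ind (fun t => g (seg w v t) = h (seg w v t))); first by rewrite seg0.
move=> t t01; have [[cg lg] [ch lh]] := hl t t01.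
have loc (e : R) : 0 < e -> exists2 d : R, 0 < d & forall s, `|s - t| < d ->
    [/\ cmod (seg w v s - seg w v t) < e, cmod (g (seg w v s) - g (seg w v t)) < e &
        cmod (h (seg w v s) - h (seg w v t)) < e].
  move=> e0; have [d1 d10 h1] := cg e e0; have [d2 d20 h2] := ch e e0.
  have k0 : 0 < cmod (v - w) + 1 by rewrite ltr_wpDl ?cmod_ge0.
  have m0 : 0 < Num.min e (Num.min d1 d2) by rewrite !lt_min e0 d10.
  exists (Num.min e (Num.min d1 d2) / (cmod (v - w) + 1)); first by rewrite divr_gt0.
  move=> s; rewrite ltr_pdivlMr // => hs.
  have : cmod (seg w v s - seg w v t) < Num.min e (Num.min d1 d2).
    by rewrite seg_dist; apply: le_lt_trans hs; rewrite ler_wpM2l // lerDl.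
  by rewrite !lt_min => /and3P[? ? ?]; split; [|exact: h1|exact: h2].
have [E|nE] := eqVneq (g (seg w v t)) (h (seg w v t)).
  have [e e0 he] := local_inj (sr t t01) lg; have [d d0 hd] := loc e e0.
  exists d => // s s' _ s'01 _ s'd _; have [h1 h2 h3] := hd s' s'd.
  have [[_ lg'] [_ lh']] := hl s' s'01.
  by apply: (he (seg w v s')) => //; [exact: sr|rewrite E].
have e0 : 0 < cmod (g (seg w v t) - h (seg w v t)) / 2.
  by rewrite divr_gt0 // cmod_gt0 subr_eq0.
have [d d0 hd] := loc _ e0; exists d => // s s' _ _ sd _ E; have [_ h2 h3] := hd s sd.
have H := cmod_dist (g (seg w v t)) (g (seg w v s)) (h (seg w v t)).
by rewrite cmodBC in h2; rewrite -E in h3; exfalso; lra.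
Qed.

Lemma lift_uniq g h b : cmod b < r -> (forall v, cmod v < r -> is_lift g v) ->
  (forall v, cmod v < r -> is_lift h v) -> g b = h b ->
  forall v, cmod v < r -> g v = h v.
Proof.
move=> br hg hh gh v vr; apply: (@lift_uniq_seg g h b v) => // t t01.
have : cmod (seg b v t) < r by rewrite -[seg _ _ _]subr0; apply: seg_convex; rewrite ?subr0.
by move=> sr; split; [exact: hg|exact: hh].
Qed.

(** The neighbourhood of radius [e] of the segment from 0 to [v]. It is convex, so that lifts on it
    agree as soon as they agree at one point. *)
Definition tube v (e : R) : set R[i] :=
  [set w | exists2 t : R, 0 <= t <= 1 & cmod (w - t%:C * v) < e].

Lemma tube_open v e w : tube v e w -> exists2 d : R, 0 < d &
  forall w', cmod (w' - w) < d -> tube v e w'.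
Proof.
move=> [t t01 h]; exists (e - cmod (w - t%:C * v)); first by rewrite subr_gt0.
by move=> w' h'; exists t => //; apply: le_lt_trans (cmod_dist _ w _) _; lra.
Qed.

Lemma tube_convex v e w w' (t : R) : 0 <= t <= 1 -> tube v e w -> tube v e w' ->
  tube v e (seg w w' t).
Proof.
move=> t01 [s1 s101 h1] [s2 s201 h2]; exists (s1 + t * (s2 - s1)).
  by move: t01 s101 s201 => /andP[? ?] /andP[? ?] /andP[? ?]; apply/andP; split; nra.
rewrite (_ : _ - _ = seg (w - s1%:C * v) (w' - s2%:C * v) t - 0).
  by apply: seg_convex; rewrite ?subr0.
by rewrite /seg rmorphD rmorphM rmorphB; ring.
Qed.

Lemma tube_sub v e (s s' : R) w : 0 <= s' <= s -> tube (s'%:C * v) e w -> tube (s%:C * v) e w.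
Proof.
move=> /andP[s'0 s's] [t /andP[t0 t1] h]; have [E|sn] := eqVneq s 0.
  have s'E : s' = 0 by lra.
  by exists t; rewrite ?t0 // E -s'E.
have sp : 0 < s by lra.
exists (t * s' / s); last by rewrite mulrA -rmorphM /= divfK // rmorphM -mulrA.
rewrite divr_ge0 ?mulr_ge0 //= ?(ltW sp) // ler_pdivrMr // mul1r; nra.
Qed.

(** The lift is continued along each radius, on a tube around it, and the global lift takes at [v]
    the value of the lift that belongs to the radius of [v]. Uniqueness along segments shows that
    neighbouring tubes give the same values. *)
Lemma lifting a0 : 0 < r -> Lift 0 a0 ->
  exists g, g 0 = a0 /\ forall v, cmod v < r -> is_lift g v.
Proof.
move=> r0 L0.
pose Good v := exists2 e : R, 0 < e & exists g, g 0 = a0 /\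
  forall w, cmod w < r -> tube v e w -> is_lift g w.
have tube0 v e : 0 < e -> tube v e 0 by exists 0; rewrite ?lexx ?ler01 // mul0r subr0 cmod0.
have tubev v e : 0 < e -> tube v e v by exists 1; rewrite ?lexx ?ler01 // mul1r subrr cmod0.
have conv w v (t : R) : 0 <= t <= 1 -> cmod w < r -> cmod v < r -> cmod (seg w v t) < r.
  by move=> t01 wr vr; rewrite -[seg _ _ _]subr0; apply: seg_convex; rewrite ?subr0.
have good v : cmod v < r -> Good v.
  move=> vr; rewrite -[v]mul1r; apply: (@segment_ind (fun t => Good (t%:C * v))).
    have [|d d0 hd] := local_lift (z := 0); first by rewrite cmod0.
    have [|||g [g0 hg]] := hd 0 a0 => //; rewrite ?subrr ?cmod0 //.
    exists d => //; exists g; split => // w wr [t _]; rewrite mul0r mulr0 => h.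
    exact: hg.
  move=> t /andP[t0 t1].
  have tr (s : R) : 0 <= s <= 1 -> cmod (s%:C * v) < r.
    move=> /andP[s0 s1]; rewrite cmodM cmodC ger0_norm //; apply: le_lt_trans vr.
    by rewrite ler_piMl ?cmod_ge0.
  have [|d d0 hd] := local_lift (z := t%:C * v); first by apply: tr; rewrite t0.
  have k0 : 0 < 2 * (cmod v + 1) by rewrite mulr_gt0 // ltr_wpDl ?cmod_ge0.
  have near (s : R) : `|s - t| < d / (2 * (cmod v + 1)) -> cmod (s%:C * v - t%:C * v) < d / 2.
    move=> hs; rewrite -mulrBl -rmorphB cmodM cmodC.
    rewrite ltr_pdivlMr // in hs.
    have : `|s - t| * cmod v <= `|s - t| * (cmod v + 1) by rewrite ler_wpM2l // lerDl.
    lra.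
  exists (d / (2 * (cmod v + 1))); first by rewrite divr_gt0.
  move=> s s' s01 s'01 hs0 hs' [e e0 [g [g0 hg]]].
  have hs := near s hs0.
  have [ss'|ss'] := leP s' s.
    exists e => //; exists g; split => // w wr tw; apply: hg => //.
    by apply: tube_sub tw; case/andP: s'01 => ->.
  have sr := tr s s01.
  have tubesv : tube (s%:C * v) e (s%:C * v) by exact: tubev.
  have [_ Lsv] := hg _ sr tubesv.
  have hsd : cmod (s%:C * v - t%:C * v) < d by lra.
  have [h [hsv hh]] := hd (s%:C * v) _ hsd sr Lsv.
  have agree w : cmod w < r -> tube (s%:C * v) e w -> cmod (w - t%:C * v) < d -> g w = h w.
    move=> wr tw wd; apply: (@lift_uniq_seg g h (s%:C * v) w) => // x x01; split.
      by apply: hg; [exact: conv|exact: tube_convex].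
    by apply: hh; [apply: seg_convex => //; lra|exact: conv].
  exists (Num.min e (d / 2)); first by rewrite lt_min e0 divr_gt0.
  (* The old lift [g] on the old tube, prolonged by the local lift [h] around [t v]. *)
  pose g' w := if asbool (tube (s%:C * v) e w) then g w else h w.
  exists g'; split.
    by rewrite /g' asboolT //; exact: tube0.
  move=> w wr [x x01]; rewrite lt_min => /andP[xe xd].
  rewrite /is_lift /g'; case: asboolP => [tw|ntw].
    have [cg lg] := hg w wr tw; split => //.
    have [y y0 hy] := tube_open tw.
    apply: (ccont_near y0 _ cg) => w' /hy tw'; by rewrite /g' asboolT.
  (* A point of the new tube outside the old one is close to the newly added piece of the segment,
     hence lies where [h] is defined. *)
  have wd : cmod (w - t%:C * v) < d.
    have xs : s < x * s'.
      rewrite ltNge; apply/negP => xs; apply: ntw.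
      have [s0|sn] := eqVneq s 0.
        exists 0; rewrite ?lexx ?ler01 // mul0r subr0.
        have xs0 : x * s' = 0.
          by apply/eqP; rewrite eq_le -{1}s0 xs /= mulr_ge0 //; [case/andP: x01|case/andP: s'01].
        by move: xe; rewrite mulrA -rmorphM xs0 mul0r subr0.
      have sp : 0 < s by rewrite lt_def sn; case/andP: s01.
      exists (x * s' / s); last by rewrite mulrA -rmorphM /= divfK // rmorphM -mulrA.
      rewrite divr_ge0 ?mulr_ge0 ?(ltW sp) //=; [|by case/andP: x01|by case/andP: s'01].
      by rewrite ler_pdivrMr // mul1r.
    have xs' : x * s' <= s' by rewrite ler_piMl //; [case/andP: s'01|case/andP: x01].
    have := near (x * s'); rewrite rmorphM -mulrA => hn.
    have : `|x * s' - t| < d / (2 * (cmod v + 1)).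
      by move: hs0 hs'; rewrite !ltr_norml => /andP[? ?] /andP[? ?]; apply/andP; split; lra.
    move=> /hn; have := cmod_dist w (x%:C * (s'%:C * v)) (t%:C * v); lra.
  have [ch lh] := hh w wd wr; split => //.
  have y0 : 0 < Num.min (d - cmod (w - t%:C * v)) (r - cmod w) by rewrite lt_min !subr_gt0 wd.
  apply: (ccont_near y0 _ ch) => w'; rewrite lt_min => /andP[h1 h2].
  rewrite /g'; case: asboolP => // tw'; symmetry; apply: agree => //.
    have := cmod_dist w' w 0; rewrite !subr0; lra.
  apply: le_lt_trans (cmod_dist _ w _) _; lra.
have step v : exists g, cmod v < r -> g 0 = a0 /\ exists2 e : R, 0 < e &
    forall w, cmod w < r -> tube v e w -> is_lift g w.
  have [vr|nvr] := boolP (cmod v < r); last by exists id.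
  by have [e e0 [g [g0 hg]]] := good v vr; exists g => _; split => //; exists e.
have [g hg] := choice step.
exists (fun v => g v v); split.
  by have [] := hg 0 (eq_ind_r (fun x => x < r) r0 (cmod0 R)).
move=> v vr; have [g0 [e e0 he]] := hg v vr; have [cg lg] := he v vr (tubev v e e0).
split => //; have y0 : 0 < Num.min e (r - cmod v) by rewrite lt_min e0 subr_gt0.
apply: (ccont_near y0 _ cg) => w; rewrite lt_min => /andP[h1 h2].
have wr : cmod w < r by have := cmod_dist w v 0; rewrite !subr0; lra.
have [g0' [e' e'0 he']] := hg w wr.
have c0 : cmod (0 : R[i]) < r by rewrite cmod0.
apply: (@lift_uniq_seg (g v) (g w) 0 w) => // [t t01|]; last by rewrite g0.
have sr := conv 0 w t t01 c0 wr.
split; last by apply: he' => //; apply: tube_convex => //; [exact: tube0|exact: tubev].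
apply: he => //; exists t => //; rewrite /seg add0r subr0 -mulrBr cmodM cmodC.
case/andP: t01 => t0 t1; rewrite ger0_norm //; apply: le_lt_trans h1.
by rewrite ler_piMl ?cmod_ge0.
Qed.

End Lifting.

(** * Flow boxes and leafwise uniformizations *)

Section LocallyInjective.
Variable R : realType.

(** On the disc of radius t about [a] the remainder [h] of the first-order expansion is O(t^2),
    hence on half that disc it is Lipschitz with a constant O(t), which is less than |d| for small
    t. *)
Lemma hol_locally_injective (u : R[i] -> R[i]) a d (r : R) : 0 < r ->
  (forall w, cmod (w - a) <= r -> exists e, cder u w e) -> cder u a d -> d != 0 ->
  exists2 e : R, 0 < e & forall w w', cmod (w - a) < e -> cmod (w' - a) < e ->
    u w = u w' -> w = w'.
Proof.
move=> r0 du hd d0; have [s s0 hs] := cder_cont hd (ltr01 : 0 < 1 :> R).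
pose rho := Num.min r (s / 2).
have rho0 : 0 < rho by rewrite lt_min r0 divr_gt0.
have rhor : rho <= r by rewrite ge_min lexx.
have rhos : rho < s by apply: le_lt_trans (_ : s / 2 < s); [rewrite ge_min lexx orbT|lra].
pose h w := u w - u a - d * (w - a).
have [K K0 hK] : exists2 K : R, 0 < K & forall w, cmod (w - a) < rho ->
    cmod (h w) <= K * cmod (w - a) ^+ 2.
  pose v w := u w - u a.
  have dv : cder v a (d - 0) by exact: cderB hd (cder_cst _ _).
  have S z : cmod (z - a) < rho -> cmod (v z - v a - (d - 0) * (z - a)) <=
      8 * 1 / rho ^+ 2 * cmod (z - a) ^+ 2.
    move=> zr; have [] := @second_order R v a rho 1 (d - 0) z rho0 _ _ dv zr => //.
      by move=> w wr; have [e he] := du w (le_trans wr rhor); eexists; exact: cderB he (cder_cst _ _).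
    by move=> w wr; apply: ltW; apply: hs; exact: le_lt_trans wr rhos.
  exists (8 * 1 / rho ^+ 2); first by rewrite divr_gt0 ?exprn_gt0 // mulr_gt0.
  by move=> w /S; rewrite /v subrr !subr0.
have dp : 0 < cmod d by rewrite cmod_gt0.
pose t := Num.min (rho / 2) (cmod d / (8 * K)).
have t0 : 0 < t by rewrite lt_min !divr_gt0 // mulr_gt0.
have [t1 t2] : t <= rho / 2 /\ t <= cmod d / (8 * K).
  by rewrite /t !ge_min !lexx orbT.
have aa : cmod (a - a) = 0 by rewrite subrr cmod0.
exists (t / 2); first by rewrite divr_gt0.
move=> w w' wt w't E; apply/eqP; rewrite -subr_eq0 -cmod_eq0 eq_le cmod_ge0 andbT leNgt.
apply/negP => ww.
have H : cmod (h w - h w') <= 2 * (K * t ^+ 2) / (t - cmod (w' - a)) * cmod (w - w').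
  apply: (@hol_lipschitz R h [::] a t) => //; try lra.
    move=> z zt _; have [|e he] := du z; first by lra.
    exists (e - 0 - d * (1 - 0)).
    exact: cderB (cderB he (cder_cst _ _)) (cderZ _ (cderB (cder_id _) (cder_cst _ _))).
  move=> z zt _; apply: le_trans (hK z _) _; first by lra.
  by rewrite ler_pM2l // lerXn2r ?nnegrE ?cmod_ge0 // ltW.
have E2 : h w - h w' = - d * (w - w') by rewrite /h E; ring.
rewrite E2 cmodM cmodN ler_pM2r // in H.
have tt : 0 < t - cmod (w' - a) by lra.
rewrite ler_pdivlMr // in H.
rewrite ler_pdivlMr in t2; last by rewrite mulr_gt0.
have h1 : cmod d * (t / 2) < cmod d * (t - cmod (w' - a)) by rewrite ltr_pM2l //; lra.
have h2 : 2 * (K * t ^+ 2) = t * (8 * K) * t / 4 by field.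
have h3 : t * (8 * K) * t <= cmod d * t by rewrite ler_pM2r.
have h4 : 0 < cmod d * t by rewrite mulr_gt0.
lra.
Qed.

End LocallyInjective.

Section Boxes.
Variables (R : realType) (X : topologicalType) (c : flow_box R X).
Implicit Types (x y : X) (z w : R[i]) (t : fb_transversal c).

Definition zc x : R[i] := (fb_map c x).1.
Definition tc x : fb_transversal c := (fb_map c x).2.
Definition iv z t : X := fb_inv c (z, t).

Lemma zc_lt1 x : fb_dom c x -> cmod (zc x) < 1.
Proof.
have [[h _] _ _ _ _] := fb_homeo c; move=> /h [].
by rewrite unit_discE.
Qed.

Lemma disc_setT z t : cmod z < 1 -> (unit_disc R `*` setT) ((z, t) : Cplx R * fb_transversal c).
Proof. by move=> z1; split => //=; rewrite unit_discE. Qed.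

Lemma ivK x : fb_dom c x -> iv (zc x) (tc x) = x.
Proof.
have [_ h _ _ _] := fb_homeo c; move=> hx; have := h x; rewrite inE => /(_ hx).
by rewrite /iv /zc /tc; case: (fb_map c x).
Qed.

Lemma iv_dom z t : cmod z < 1 -> fb_dom c (iv z t).
Proof. by have [[_ h] _ _ _ _] := fb_homeo c; move=> z1; apply: h; exact: disc_setT. Qed.

Lemma ivE z t : cmod z < 1 -> zc (iv z t) = z /\ tc (iv z t) = t.
Proof.
have [_ _ h _ _] := fb_homeo c; move=> z1; have := h (z, t); rewrite inE => /(_ (disc_setT t z1)).
by rewrite /zc /tc /iv => ->.
Qed.

Lemma zc_iv z t : cmod z < 1 -> zc (iv z t) = z.
Proof. by move=> /ivE -/(_ t)[]. Qed.

Lemma tc_iv z t : cmod z < 1 -> tc (iv z t) = t.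
Proof. by move=> /ivE -/(_ t)[]. Qed.

Lemma fb_map_cont x : fb_dom c x -> {for x, continuous (fb_map c)}.
Proof.
have [_ _ _ h _] := fb_homeo c; move=> hx.
by rewrite continuous_open_subspace in h; [apply: h; rewrite inE|exact: fb_dom_open].
Qed.

Lemma fb_inv_cont z t : cmod z < 1 ->
  {for ((z, t) : Cplx R * fb_transversal c), continuous (fb_inv c)}.
Proof.
have [_ _ _ _ h] := fb_homeo c; move=> z1.
rewrite continuous_open_subspace in h.
  by apply: h; rewrite inE; exact: disc_setT.
rewrite openE => -[w s] [/= wD _]; exists (unit_disc R, setT) => //=.
by split; [apply: open_nbhs_nbhs; split => //; exact: open_unit_disc|exact: filterT].
Qed.

Lemma nbhs_dom x : fb_dom c x -> nbhs x (fb_dom c).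
Proof. by move=> hx; apply: open_nbhs_nbhs; split => //; exact: fb_dom_open. Qed.

Section Limits.
Variables (I : Type) (G : set_system I).
Context {UG : UltraFilter G}.

Lemma lim_dom (f : I -> X) x : f @ G --> x -> fb_dom c x -> \forall i \near G, fb_dom c (f i).
Proof. by move=> hf hx; apply: hf; exact: nbhs_dom. Qed.

Lemma lim_zc (f : I -> X) x : f @ G --> x -> fb_dom c x -> clim G (fun i => zc (f i)) (zc x).
Proof.
move=> hf hx; apply/climP => A hA.
have : nbhs (fb_map c x) (fst @^-1` A) by exact: cvg_fst.
by move=> /(fb_map_cont hx) /hf.
Qed.

Lemma lim_tc (f : I -> X) x : f @ G --> x -> fb_dom c x -> (fun i => tc (f i)) @ G --> tc x.
Proof.
move=> hf hx A hA.
have : nbhs (fb_map c x) (snd @^-1` A) by exact: cvg_snd.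
by move=> /(fb_map_cont hx) /hf.
Qed.

Lemma lim_iv (z : I -> R[i]) z0 (t : I -> fb_transversal c) t0 : cmod z0 < 1 -> clim G z z0 ->
  t @ G --> t0 -> (fun i => iv (z i) (t i)) @ G --> iv z0 t0.
Proof.
move=> z1 /climP hz ht A hA.
have h := @fb_inv_cont z0 t0 z1 A hA.
have [[U V] [hU hV] hUV] := h.
have h1 : G [set i | U (z i)] by exact: hz.
have h2 : G [set i | V (t i)] by exact: ht.
apply: (@filterS2 _ G _ _ _ _ _ h1 h2) => i k1 k2.
exact: (hUV (z i : Cplx R, t i)).
Qed.

End Limits.

End Boxes.

Arguments iv {R X} c z t.
Arguments zc {R X} c x.
Arguments tc {R X} c x.

Section Derivable.
Variable R : realType.

Lemma derivable_cder (f : Cplx R -> Cplx R) (z : R[i]) :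
  derivable f z 1 <-> exists d, cder f z d.
Proof.
split.
  move=> h; pose d : R[i] := lim ((fun h : Cplx R => h^-1 *: ((f \o shift z) (h *: 1) - f z)) @ 0^').
  exists d; have hl : (fun h : Cplx R => h^-1 *: ((f \o shift z) (h *: 1) - f z)) @ 0^' --> (d : Cplx R) by exact: h.
  apply/cderP => e e0.
  have : nbhs (d : Cplx R) [set w | cmod (w - d) < e] by apply/nbhs_cmod; exists e.
  move=> /hl; rewrite /nbhs /= /dnbhs => /nbhs_cmod[r r0 hr]; exists r => // w wr.
  have [->|wz] := eqVneq w z; first by rewrite !subrr mulr0 subr0 cmod0 mulr0.
  have wz0 : w - z != 0 by rewrite subr_eq0.
  have := hr (w - z); rewrite subr0 => /(_ wr wz0) /=.
  rewrite /GRing.scale /= mulr1 subrK => H.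
  have -> : f w - f z - d * (w - z) = ((w - z)^-1 * (f w - f z) - d) * (w - z).
    by field.
  by rewrite cmodM ler_wpM2r ?cmod_ge0 // ltW.
move=> [d [phi [cphi phid hphi]]]; apply/cvg_ex; exists (d : Cplx R) => A /nbhs_cmod[e e0 hA].
rewrite -phid in hA; have [r r0 hr] := cphi e e0.
rewrite /nbhs /= /dnbhs; apply/nbhs_cmod; exists r => // h hr' h0 /=.
apply: hA; rewrite subr0 in hr'.
have E : h + z - z = h by rewrite addrK.
rewrite /GRing.scale /= mulr1 hphi E mulrCA mulVf // mulr1; apply: hr; by rewrite E.
Qed.

End Derivable.

Section Leafwise.
Variables (R : realType) (X : topologicalType) (L : lamination R X).
Implicit Types (x y : X) (z w a : R[i]) (c : flow_box R X).

Lemma change_charts c c' z (t : fb_transversal c) : L c -> L c' -> cmod z < 1 ->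
  fb_dom c' (iv c z t) ->
  (exists d, cder (fun w => zc c' (iv c w t)) z d) /\
  exists2 r : R, 0 < r & forall w, cmod (w - z) < r ->
    [/\ cmod w < 1, fb_dom c' (iv c w t) & tc c' (iv c w t) = tc c' (iv c z t)].
Proof.
move=> Lc Lc' z1 hd; have zD : unit_disc R z by rewrite unit_discE.
have [d1 [tau ht]] := lam_compatible Lc Lc' zD hd; split.
  by apply/derivable_cder; exact: d1.
have h1 : \forall q \near ((z, t) : Cplx R * fb_transversal c), fb_dom c' (fb_inv c q).
  exact: (@fb_inv_cont _ _ c z t z1 _ (nbhs_dom hd)).
have [[U V] [hU hV] hUV] := filterI ht h1.
have [r r0 hr] := (nbhs_cmod _ _).1 hU.
have tV := nbhs_singleton hV.
exists (Num.min r (1 - cmod z)); first by rewrite lt_min r0 subr_gt0.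
move=> w; rewrite lt_min => /andP[wr w1].
have [e1 e2] := hUV (w, t) (conj (hr w wr) tV).
have zz : cmod (z - z) < r by rewrite subrr cmod0.
have [e3 _] := hUV (z, t) (conj (hr z zz) tV).
split => //; first by have := cmod_dist w z 0; rewrite !subr0; lra.
by move: e1 e3; rewrite /change_of_charts /tc /iv /= => -> ->.
Qed.

Definition in_plaque c (p : R[i] -> X) w (r : R) (t : fb_transversal c) :=
  forall w', cmod (w' - w) < r -> [/\ fb_dom c (p w'), tc c (p w') = t &
    exists d, cder (zc c \o p) w' d].

(** That [tc c] is constant along [p] near [w] takes the place of continuity for the leafwise
    topology; holomorphy is required on a whole neighbourhood of [w]. *)
Definition lhol (p : R[i] -> X) w := forall c, L c -> fb_dom c (p w) ->
  exists2 r : R, 0 < r & in_plaque p w r (tc c (p w)).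

Lemma in_plaque_iv c p w r t w' : @in_plaque c p w r t -> cmod (w' - w) < r ->
  p w' = iv c (zc c (p w')) t.
Proof. by move=> h /h[h1 <- _]; rewrite ivK. Qed.

(** One box is enough, because changes of charts carry plaques holomorphically into plaques. *)
Lemma lhol_of_box c p w r t : L c -> 0 < r -> @in_plaque c p w r t -> lhol p w.
Proof.
move=> Lc r0 hp c' Lc' hd.
have ww : cmod (w - w) < r by rewrite subrr cmod0.
have [h1 h2 [d hd0]] := hp w ww.
have pE := in_plaque_iv hp.
have hd' : fb_dom c' (iv c (zc c (p w)) t) by rewrite -pE.
have [_ [s s0 hs]] := change_charts Lc Lc' (zc_lt1 h1) hd'.
have [q q0 hq] := cder_cont hd0 s0.
exists (Num.min r q); first by rewrite lt_min r0.
move=> w'; rewrite lt_min => /andP[wr wq].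
have /hs[z1 k1 k2] := hq _ wq; have [_ _ [d' hd1]] := hp w' wr.
split.
- by rewrite (pE w' wr).
- by rewrite (pE w' wr) k2 -pE.
have [[e he] _] := change_charts Lc Lc' z1 k1.
have rr : 0 < r - cmod (w' - w) by rewrite subr_gt0.
exists (e * d'); apply: (cder_near rr _ (cder_comp hd1 he)) => v vr /=.
by rewrite -pE //; apply: le_lt_trans (cmod_dist _ w' _) _; lra.
Qed.

Lemma lhol_comp (p : R[i] -> X) (phi : R[i] -> R[i]) w (r : R) : 0 < r ->
  (forall w', cmod (w' - w) < r -> exists d, cder phi w' d) ->
  lhol p (phi w) -> lhol (p \o phi) w.
Proof.
move=> r0 dphi hp c Lc hd; have [s s0 hs] := hp c Lc hd.
have ww : cmod (w - w) < r by rewrite subrr cmod0.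
have [d hd0] := dphi w ww; have [q q0 hq] := cder_cont hd0 s0.
exists (Num.min r q); first by rewrite lt_min r0.
move=> w'; rewrite lt_min => /andP[wr wq]; have [h1 h2 [e he]] := hs _ (hq w' wq).
split => //; have [d' hd'] := dphi w' wr.
by eexists; exact: cder_comp hd' he.
Qed.

(* What remains of a holomorphic universal covering of a leaf by the disc: every
   plaque through a point p z lifts to a holomorphic map psi with psi |-> z. *)
Definition unif (p : R[i] -> X) := (forall z, cmod z < 1 -> lhol p z) /\
  forall z c, cmod z < 1 -> L c -> fb_dom c (p z) ->
    exists psi, [/\ disc_map psi, psi (zc c (p z)) = z &
      forall w, cmod w < 1 -> p (psi w) = iv c w (tc c (p z))].

Lemma unif_comp p phi phi' : unif p -> disc_map phi -> disc_map phi' ->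
  (forall z, cmod z < 1 -> phi' (phi z) = z /\ phi (phi' z) = z) -> unif (p \o phi).
Proof.
move=> [up pp] dphi dphi' phiK; split.
  move=> z z1; have r0 : 0 < 1 - cmod z by rewrite subr_gt0.
  apply: (lhol_comp r0); last by apply: up; have [] := dphi z z1.
  move=> w' w'r; have w'1 : cmod w' < 1 by have := cmod_dist w' z 0; rewrite !subr0; lra.
  by have [] := dphi w' w'1.
move=> z c z1 Lc hd; have [_ fz1] := dphi z z1.
have [psi [dpsi psi0 psiE]] := pp (phi z) c fz1 Lc hd.
exists (phi' \o psi); split.
- exact: disc_map_comp.
- by rewrite /= psi0; have [] := phiK z z1.
- move=> w w1 /=; have [_ pw1] := dpsi w w1; have [_ ->] := phiK _ pw1.
  exact: psiE.
Qed.

Lemma unif_mob p u : unif p -> cmod u < 1 -> unif (p \o mob u).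
Proof.
move=> up u1; have nu : cmod (- u) < 1 by rewrite cmodN.
apply: (unif_comp up (disc_map_mob u1) (disc_map_mob nu)) => z z1.
by rewrite mobK ?mobKN.
Qed.

Lemma disc_map_rot e : cmod e = 1 -> disc_map (fun z => e * z).
Proof.
move=> e1 z z1; split; last by rewrite cmodM e1 mul1r.
by exists (e * 1); exact: (cderZ e (cder_id z)).
Qed.

Lemma unif_rot p e : unif p -> cmod e = 1 -> unif (fun z => p (e * z)).
Proof.
move=> up e1; have e0 : e != 0 by rewrite -cmod_gt0 e1.
have e1' : cmod e^-1 = 1 by rewrite cmodV e1 invr1.
apply: (unif_comp up (disc_map_rot e1) (disc_map_rot e1')) => z z1.
by rewrite mulKf // mulVKf.
Qed.

(* psi is a section of zc c \o p near z, so its derivative does not vanish. *)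
Lemma unif_der p z c : unif p -> cmod z < 1 -> L c -> fb_dom c (p z) ->
  exists2 d, cder (zc c \o p) z d & d != 0.
Proof.
move=> [up pp] z1 Lc hd; have [r r0 hr] := up z z1 c Lc hd.
have [psi [dpsi psi0 psiE]] := pp z c z1 Lc hd.
have zz : cmod (z - z) < r by rewrite subrr cmod0.
have [_ _ [d hdz]] := hr z zz; exists d => //.
have zp := zc_lt1 hd; have [[e he] _] := dpsi _ zp.
have : cder ((zc c \o p) \o psi) (zc c (p z)) (d * e).
  by apply: cder_comp he _; rewrite psi0.
have k0 : 0 < 1 - cmod (zc c (p z)) by rewrite subr_gt0.
move=> /(cder_near k0 (g := id)) H.
have /(cder_uniq (cder_id _)) E : cder id (zc c (p z)) (d * e).
  apply: H => w wr /=; have w1 : cmod w < 1.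
    by have := cmod_dist w (zc c (p z)) 0; rewrite !subr0; lra.
  by rewrite psiE // zc_iv.
by apply/negP => /eqP d0; move/eqP: E; rewrite d0 mul0r oner_eq0.
Qed.

Lemma unif_locally_injective p z : unif p -> cmod z < 1 -> exists2 e : R, 0 < e &
  forall w w', cmod (w - z) < e -> cmod (w' - z) < e -> p w = p w' -> w = w'.
Proof.
move=> up z1; have [c Lc hd] := lam_cover L (p z).
have [r r0 hr] := up.1 z z1 c Lc hd; have [d hdz d0] := unif_der up z1 Lc hd.
have r2 : 0 < r / 2 by lra.
have [|e e0 he] := @hol_locally_injective R (zc c \o p) z d (r / 2) r2 _ hdz d0.
  by move=> w wr; have [] // := hr w ltac:(lra).
by exists e => // w w' h1 h2 E; apply: he => //=; rewrite E.
Qed.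

Section Lifts.
Variables (q f : R[i] -> X) (r : R).
Hypotheses (uq : unif q) (hf : forall w, cmod w < r -> lhol f w).

Let Lift w a := cmod a < 1 /\ q a = f w.

(** The lift through [a] is the lift psi of a plaque, composed with the coordinate of [f]. As psi is
    defined over the whole plaque, the radius does not depend on [a]. *)
Let loc z : cmod z < r -> exists2 d : R, 0 < d & forall w a,
  cmod (w - z) < d -> cmod w < r -> Lift w a -> exists g : R[i] -> R[i], g w = a /\
    forall v, cmod (v - z) < d -> cmod v < r ->
      [/\ exists k, cder g v k, ccont g v & Lift v (g v)].
Proof.
move=> zr; have [c Lc hd] := lam_cover L (f z); have [d d0 hd0] := hf zr Lc hd.
exists d => // w a wd wr [a1 qa].
have [h1 h2 _] := hd0 w wd; have hqa : fb_dom c (q a) by rewrite qa.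
have [psi [dpsi psi0 psiE]] := uq.2 a c a1 Lc hqa.
exists (psi \o (zc c \o f)); split; first by rewrite /= -qa.
move=> v vd vr; have [k1 k2 [e he]] := hd0 v vd.
have [[e' he'] p1] := dpsi _ (zc_lt1 k1).
have H := cder_comp he he'; split; first by eexists; exact: H.
  exact: cder_cont H.
split => //=; rewrite psiE; last exact: zc_lt1.
by rewrite qa h2 -k2 ivK.
Qed.

Let loc' z : cmod z < r -> exists2 d : R, 0 < d & forall w a,
  cmod (w - z) < d -> cmod w < r -> Lift w a -> exists g : R[i] -> R[i], g w = a /\
    forall v, cmod (v - z) < d -> cmod v < r -> ccont g v /\ Lift v (g v).
Proof.
move=> /loc[d d0 h]; exists d => // w a h1 h2 h3; have [g [g1 g2]] := h w a h1 h2 h3.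
by exists g; split => // v v1 v2; have [] := g2 v v1 v2.
Qed.

Let inj w a : cmod w < r -> Lift w a -> exists2 e : R, 0 < e &
  forall w' a' a'', cmod (w' - w) < e -> cmod w' < r -> cmod (a' - a) < e -> cmod (a'' - a) < e ->
    Lift w' a' -> Lift w' a'' -> a' = a''.
Proof.
move=> wr [a1 qa]; have [e e0 he] := unif_locally_injective uq a1; exists e => //.
by move=> w' a' a'' _ _ h1 h2 [_ E1] [_ E2]; apply: he => //; rewrite E1.
Qed.

(** The continuous lift is holomorphic because, by local injectivity of [q], it agrees near every
    point with a lift through a plaque. *)
Lemma unif_lift a0 : 0 < r -> cmod a0 < 1 -> q a0 = f 0 ->
  exists g, g 0 = a0 /\ forall v, cmod v < r ->
    [/\ exists d, cder g v d, cmod (g v) < 1 & q (g v) = f v].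
Proof.
move=> r0 a1 qa; have [g [g0 hg]] := @lifting R r Lift loc' inj a0 r0 (conj a1 qa).
exists g; split => // v vr; have [cg Lg] := hg v vr; have [g1 qg] := Lg.
split => //; have [d d0 hd] := loc vr.
have vv : cmod (v - v) < d by rewrite subrr cmod0.
have [h [hv hh]] := hd v _ vv vr Lg; have [[k hk] ch _] := hh v vv vr.
have [e e0 he] := inj vr Lg.
have [s s0 hs] := cg e e0; have [t t0 ht] := ch e e0.
have m0 : 0 < Num.min (Num.min d e) (Num.min (Num.min s t) (r - cmod v)).
  by rewrite !lt_min d0 e0 s0 t0 subr_gt0.
exists k; apply: (cder_near m0 _ hk) => w; rewrite !lt_min.
move=> /andP[/andP[w1 w2] /andP[/andP[w3 w4] w5]].
have wr : cmod w < r by have := cmod_dist w v 0; rewrite !subr0; lra.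
apply: (he w) => //.
- by have := ht w w4; rewrite hv.
- exact: hs.
- by have [] := hh w w1 wr.
- by have [] := hg w wr.
Qed.

Lemma unif_lift_uniq g h b : cmod b < r ->
  (forall v, cmod v < r -> [/\ ccont g v, cmod (g v) < 1 & q (g v) = f v]) ->
  (forall v, cmod v < r -> [/\ ccont h v, cmod (h v) < 1 & q (h v) = f v]) ->
  g b = h b -> forall v, cmod v < r -> g v = h v.
Proof.
move=> br hg hh gh; apply: (@lift_uniq R r Lift inj g h b) => // v vr.
  by have [? ? ?] := hg v vr.
by have [? ? ?] := hh v vr.
Qed.

End Lifts.

(** Each uniformization lifts through the other; the two lifts fix 0 and [F'] is a left inverse of
    [F], so [disc_rotation] applies. *)
Lemma unif_rotation p q : unif p -> unif q -> p 0 = q 0 ->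
  exists2 e, cmod e = 1 & forall z, cmod z < 1 -> q z = p (e * z).
Proof.
move=> up uq pq.
have c0 : cmod (0 : R[i]) < 1 by rewrite cmod0.
have [F [F0 hF]] := unif_lift up uq.1 ltr01 c0 pq.
have [F' [F'0 hF']] := unif_lift uq up.1 ltr01 c0 (esym pq).
have dF : disc_map F by move=> z /hF[].
have dF' : disc_map F' by move=> z /hF'[].
have FK z : cmod z < 1 -> F' (F z) = z.
  apply: (@unif_lift_uniq q q 1 uq (F' \o F) id 0) => //=; last by rewrite F0 F'0.
    move=> v v1; have [[d hd] Fv1 E] := hF v v1; have [[d' hd'] F'v1 E'] := hF' _ Fv1.
    by split => //; [exact: cder_cont (cder_comp hd hd')|rewrite /= E'].
  by move=> v v1; split => //; exact: ccont_id.
have [e e1 he] := disc_rotation dF dF' F0 F'0 FK.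
by exists e => // z z1; rewrite -he //; have [] := hF z z1.
Qed.

End Leafwise.

(** * Uniformizations from holomorphic universal coverings *)

Section Hyperbolic.
Variables (R : realType) (X : topologicalType) (L : lamination R X).
Hypothesis hyp : hyperbolic L.

Lemma plaque_leafwise_open (c : flow_box R X) (t : fb_transversal c) : L c ->
  leafwise_open [set y : leafwise L | fb_dom c y /\ tc c y = t].
Proof.
move=> Lc c' t' Lc'; rewrite openE => z [/= z1 [hd ht]].
rewrite unit_discE in z1.
have [_ [r r0 hr]] := change_charts Lc' Lc z1 hd.
apply/nbhs_cmod; exists r => // w /hr[w1 k1 k2]; split; first by rewrite unit_discE.
by split => //; rewrite -ht -k2.
Qed.

Lemma leafwise_holomorphic_lhol (p : Cplx R -> leafwise L) (w : R[i]) :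
  leafwise_holomorphic p -> cmod w < 1 -> lhol L (p : R[i] -> X) w.
Proof.
move=> [cp dp] w1 c Lc hd.
have cw : {for w, continuous p}.
  rewrite continuous_open_subspace in cp; last exact: open_unit_disc.
  by apply: cp; rewrite inE unit_discE.
have /cw/nbhs_cmod[r r0 hr] : nbhs (p w) [set y : leafwise L | fb_dom c y /\ tc c y = tc c (p w)].
  by apply: open_nbhs_nbhs; split => //; exact: plaque_leafwise_open.
exists (Num.min r (1 - cmod w)); first by rewrite lt_min r0 subr_gt0.
move=> w'; rewrite lt_min => /andP[/hr[h1 h2] w'w]; split => //.
apply/derivable_cder; apply: dp => //.
by rewrite unit_discE; have := cmod_dist w' w 0; rewrite !subr0; lra.
Qed.

Lemma plaque_map_cont (c : flow_box R X) (t : fb_transversal c) (w : R[i]) : L c ->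
  cmod w < 1 -> {for w, continuous ((fun z => iv c z t) : Cplx R -> leafwise L)}.
Proof.
move=> Lc w1 A /=; rewrite nbhsE => - [U [oU Uw] UA].
have : nbhs (w : Cplx R) [set z : Cplx R | unit_disc R z /\ U (fb_inv c (z, t))].
  apply: open_nbhs_nbhs; split; first exact: oU.
  by split; [rewrite unit_discE|].
by apply: filterS => z [_ ?]; exact: UA.
Qed.

Lemma plaque_in_leaf (c : flow_box R X) (t : fb_transversal c) (x : leafwise L) (z w : R[i]) :
  L c -> cmod z < 1 -> cmod w < 1 -> leaf x (iv c z t) -> leaf x (iv c w t).
Proof.
move=> Lc z1 w1 hz.
pose B := (fun s : R => iv c (seg z w s) t : leafwise L) @` `[0, 1].
apply: connected_component_trans hz _.
exists B; last by exists 1; rewrite ?seg1 //= in_itv /= ler01 lexx.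
split => //; first by exists 0; rewrite ?seg0 //= in_itv /= ler01 lexx.
apply: connected_continuous_connected; first exact: segment_connected.
have sc (s : R) : 0 <= s <= 1 -> cmod (seg z w s) < 1.
  by move=> s01; rewrite -[seg _ _ _]subr0; apply: seg_convex; rewrite ?subr0.
apply: continuous_in_subspaceT => s; rewrite inE /= in_itv /= => s01.
move=> A hA; have /nbhs_cmod[r r0 hr] := plaque_map_cont Lc (sc s s01) hA.
have k0 : 0 < cmod (w - z) + 1 by rewrite ltr_wpDl ?cmod_ge0.
apply/nbhs_ballP; exists (r / (cmod (w - z) + 1)); first by rewrite /= divr_gt0.
move=> s'; rewrite -ball_normE /= distrC ltr_pdivlMr // => hs; apply: hr.
by rewrite seg_dist; apply: le_lt_trans hs; rewrite ler_wpM2l // lerDl.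
Qed.

(* The holomorphic universal covering lifts plaques by simple connectedness of
   the disc, and the lifts are holomorphic since they are continuous sections. *)
Lemma hyperbolic_unif (x : X) : exists2 p : R[i] -> X, unif L p & p 0 = x.
Proof.
have [p [[_ [cp imp sheets]] hp]] := hyp x.
have lp w : cmod w < 1 -> lhol L p w by move=> w1; exact: leafwise_holomorphic_lhol.
have xl : leaf (x : leafwise L) x by exact: connected_component_refl.
have [a0 a0D pa0] : (p @` unit_disc R) x by rewrite imp.
rewrite unit_discE in a0D.
suff up : unif L p.
  by exists (p \o mob a0); [exact: unif_mob|rewrite /= mob0].
split=> // z c z1 Lc hd.
pose t := tc c (p z); pose z0 := zc c (p z); have z01 : cmod z0 < 1 by exact: zc_lt1.
(* The plaque is recentred, so that its lift starts at the centre of the disc. *)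
pose f w : leafwise L := iv c (mob z0 w) t.
have m1 w : cmod w < 1 -> cmod (mob z0 w) < 1 by exact: mob_lt1.
have f0 : f 0 = p z by rewrite /f mob0 ivK.
have pl a : cmod a < 1 -> leaf (x : leafwise L) (p a).
  by move=> a1; rewrite -imp; exists a => //; rewrite unit_discE.
have fl w : cmod w < 1 -> leaf (x : leafwise L) (f w).
  by move=> w1; apply: (@plaque_in_leaf c t x z0) => //; [exact: m1|rewrite ivK //; exact: pl].
have cf w : cmod w < 1 -> {for w, continuous (f : Cplx R -> leafwise L)}.
  move=> w1 A hA; have /nbhs_cmod[r r0 hr] := plaque_map_cont Lc (m1 w w1) hA.
  have [s s0 hs] := cder_cont (cder_mob (mob_den z01 (ltW w1))) r0.
  by apply/nbhs_cmod; exists s => // v /hs/hr.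
pose Lift w a := cmod a < 1 /\ p a = f w.
(* The sheets over an evenly covered neighbourhood of [f w], with relative openness unfolded into
   balls. *)
have key w : cmod w < 1 -> exists V : set (leafwise L), exists F : set (set (Cplx R)),
   [/\ V (f w), (exists2 d : R, 0 < d & forall v, cmod (v - w) < d -> cmod v < 1 -> V (f v)),
     (forall a, cmod a < 1 -> V (p a) -> exists2 W, F W & W a) &
     forall W, F W -> [/\ forall a, W a -> cmod a < 1,
        (forall a, W a -> exists2 e : R, 0 < e & forall b, cmod (b - a) < e -> W b) &
        exists g : leafwise L -> Cplx R, homeomorphism_between W V p g]].
  move=> w1; have [V [Vfw Vl oV [F [_ FE hF]]]] := sheets _ (fl w w1).
  exists V, F; split => //.
  - have [U oU UV] := (open_subspaceP _ _).1 oV.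
    have Ufw : U (f w).
      have : (V `&` leaf (x : leafwise L)) (f w) by split => //; exact: fl.
      by rewrite -UV => -[].
    have : nbhs (f w) U by apply: open_nbhs_nbhs.
    move=> /(cf w w1)/nbhs_cmod[d d0 hd']; exists d => // v /hd' Ufv v1.
    have : (U `&` leaf (x : leafwise L)) (f v) by split => //; exact: fl.
    by rewrite UV => -[].
  - move=> a a1 Va.
    have : (unit_disc R `&` p @^-1` V) a by split => //; rewrite unit_discE.
    by rewrite FE => -[W FW Wa]; exists W.
  - move=> W FW; have [oW [g hg]] := hF W FW.
    have WD a : W a -> cmod a < 1.
      move=> Wa; have : (\bigcup_(W in F) W) a by exists W.
      by rewrite -FE => -[]; rewrite unit_discE.
    split => //; last by exists g.
    move=> a Wa; have [U oU UW] := (open_subspaceP _ _).1 oW.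
    have : (U `&` unit_disc R) a by rewrite UW; split => //; rewrite unit_discE; exact: WD.
    move=> [Ua _]; have : nbhs (a : Cplx R) (U `&` unit_disc R).
      apply: filterI; first exact: open_nbhs_nbhs.
      by apply: open_nbhs_nbhs; split; [exact: open_unit_disc|rewrite unit_discE; exact: WD].
    by rewrite UW => /nbhs_cmod[e e0 he]; exists e => // b /he[].
have loc w : cmod w < 1 -> exists2 d : R, 0 < d & forall v a,
  cmod (v - w) < d -> cmod v < 1 -> Lift v a -> exists g : R[i] -> R[i], g v = a /\
    forall y, cmod (y - w) < d -> cmod y < 1 -> ccont g y /\ Lift y (g y).
  move=> w1; have [V [F [_ [d d0 hdV] cov hF]]] := key w w1.
  exists d => // v a vd v1 [a1 pa].
  have Vpa : V (p a) by rewrite pa; exact: hdV.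
  have [W FW Wa] := cov a a1 Vpa.
  have [WD oW [g [[_ gW] pK gK _ cg]]] := hF W FW.
  exists (g \o f); split; first by rewrite /= -pa pK // inE.
  move=> y yd y1; have Vy := hdV y yd y1; split; last first.
    by split; [apply: WD; exact: gW|apply: gK; rewrite inE].
  apply/ccontP => A hA.
  have hV : nbhs (f y : subspace V) (g @^-1` A) by exact: (cg (f y : subspace V) A hA).
  have {}hV : within V (nbhs (f y)) (g @^-1` A) by rewrite (nbhs_subspace_in Vy).
  have [e e0 he] := (nbhs_cmod _ _).1 (cf y y1 _ hV).
  apply/nbhs_cmod; exists (Num.min e (Num.min (d - cmod (y - w)) (1 - cmod y))).
    by rewrite !lt_min e0 !subr_gt0 yd.
  move=> y'; rewrite !lt_min => /and3P[h1 h2 h3]; apply: (he y' h1); apply: hdV.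
    by apply: le_lt_trans (cmod_dist _ y _) _; lra.
  by have := cmod_dist y' y 0; rewrite !subr0; lra.
have inj w a : cmod w < 1 -> Lift w a -> exists2 e : R, 0 < e &
  forall w' a' a'', cmod (w' - w) < e -> cmod w' < 1 -> cmod (a' - a) < e -> cmod (a'' - a) < e ->
    Lift w' a' -> Lift w' a'' -> a' = a''.
  move=> w1 [a1 pa]; have [V [F [Vw _ cov hF]]] := key w w1.
  have Vpa : V (p a) by rewrite pa.
  have [W FW Wa] := cov a a1 Vpa; have [_ oW [g [_ pK _ _ _]]] := hF W FW.
  have [e e0 he] := oW a Wa; exists e => // w' a' a'' _ _ /he Wa' /he Wa'' [_ E1] [_ E2].
  by rewrite -(pK a') ?inE // -(pK a'') ?inE // E1 E2.
have L0 : Lift 0 z by split.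
have [G [G0 hG]] := @lifting R 1 Lift loc inj z ltr01 L0.
have nz0 : cmod (- z0) < 1 by rewrite cmodN.
pose psi := G \o mob (- z0).
have psi1 w : cmod w < 1 -> cmod (psi w) < 1.
  by move=> w1; have [_ []] := hG _ (mob_lt1 nz0 w1).
have psiE w : cmod w < 1 -> p (psi w) = iv c w t.
  move=> w1; have [_ [_ ->]] := hG _ (mob_lt1 nz0 w1).
  by rewrite /f mobKN.
have cpsi w : cmod w < 1 -> ccont psi w.
  move=> w1; apply: ccont_comp; first exact: cder_cont (cder_mob (mob_den nz0 (ltW w1))).
  by have [] := hG _ (mob_lt1 nz0 w1).
exists psi; split => //; last by rewrite /psi /= mobNv.
move=> w w1; split; last exact: psi1.
have hdw : fb_dom c (p (psi w)) by rewrite psiE //; exact: iv_dom.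
have [r r0 hr] := lp _ (psi1 w w1) c Lc hdw.
pose s := Num.min (r / 2) ((1 - cmod w) / 2).
have s0 : 0 < s by rewrite lt_min !divr_gt0 // subr_gt0.
have [s1 s2] : s <= r / 2 /\ s <= (1 - cmod w) / 2 by rewrite /s !ge_min !lexx orbT.
apply: (@cder_inverse R (zc c \o p) psi w s s0).
  by move=> v vs; have [] // := hr v ltac:(lra).
move=> v vs; have v1 : cmod v < 1 by have := cmod_dist v w 0; rewrite !subr0; lra.
by split; [exact: cpsi|rewrite /= psiE // zc_iv].
Qed.

End Hyperbolic.

(** * Compactness of the family of uniformizations *)

Section Compactness.
Variables (X : topologicalType).
Hypotheses (X_compact : compact [set: X]) (X_hausdorff : hausdorff_space X).

Lemma xlim_uniq (I : Type) (G : set_system I) {UG : UltraFilter G} (f : I -> X) (x y : X) :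
  f @ G --> x -> f @ G --> y -> x = y.
Proof. by move=> hx hy; exact: (cvg_unique X_hausdorff hx hy). Qed.

Lemma lim_near (I : Type) (G : set_system I) {UG : UltraFilter G} (f g : I -> X) (x : X) :
  (\forall i \near G, f i = g i) -> f @ G --> x -> g @ G --> x.
Proof.
move=> fg hf A hA; have h : G [set i | A (f i)] by exact: hf.
by apply: (@filterS2 _ G _ _ _ _ _ fg h) => i /= ->.
Qed.

Lemma finite_subcover (K : X -> set X) : (forall x, nbhs x (K x)) ->
  exists s : seq X, forall y, exists2 x, x \in s & K x y.
Proof.
move=> hK; apply: contrapT => /forallNP h.
pose B (s : seq X) := [set y | forall x, x \in s -> ~ K x y].
have FB : ProperFilter (filter_from [set: seq X] B).
  apply: filter_from_proper; last first.
    move=> s _; have /existsNP[y hy] := h s; exists y => x xs Kxy.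
    by apply: hy; exists x.
  apply: filter_from_filter; first by exists [::].
  move=> s t _ _; exists (s ++ t) => // y hy.
  by split => x xs; apply: hy; rewrite mem_cat xs ?orbT.
have [G [UG FG]] := ultraFilterLemma FB.
have [x _ hx] := @compact_ultralim X G UG X setT idfun X_compact filterT.
have h1 : G (K x) by exact: hx (hK x).
have h2 : G (B [:: x]) by apply: FG; exists [:: x].
have [y [Ky By]] := filter_ex (filterI h1 h2).
exact: (By x (mem_head _ _)).
Qed.

Lemma regular_nbhs (x : X) (U : set X) : nbhs x U -> exists K : set X,
  [/\ nbhs x K, closed K & K `<=` U].
Proof.
move=> hU; have hT : nbhs x [set: X] by exact: filterT.
have := compact_regular X_hausdorff X_compact hT.
move=> /(_ U hU)[V hV VU]; exists (closure V); split => //.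
  by apply: filterS hV; exact: subset_closure.
exact: closed_closure.
Qed.

Lemma closed_lim (I : Type) (G : set_system I) {UG : UltraFilter G} (f : I -> X) (x : X) (K : set X) :
  closed K -> (\forall i \near G, K (f i)) -> f @ G --> x -> K x.
Proof.
move=> cK hK hx; apply: cK => U /hx hU.
by have [i [? ?]] := filter_ex (filterI hK hU); exists (f i).
Qed.

Section Laminations.
Variables (R : realType) (L : lamination R X).

Lemma lhol_lim (I : Type) (G : set_system I) {UG : UltraFilter G} (p : R[i] -> X) w
  (y : I -> R[i]) : lhol L p w -> clim G y w -> (fun i => p (y i)) @ G --> p w.
Proof.
move=> hp hy; have [c Lc hd] := lam_cover L (p w); have [r r0 hr] := hp c Lc hd.
have ww : cmod (w - w) < r by rewrite subrr cmod0.
have [_ _ [d hdw]] := hr w ww.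
pose proof (lim_iv (t := fun=> tc c (p w)) (zc_lt1 hd) (clim_ccont (cder_cont hdw) hy) (@cvg_cst _ _ _ _ _)) as Hlim0; move: Hlim0.
rewrite ivK //; move=> Hlim; apply: (lim_near _ Hlim).
by apply: filterS (hy r r0) => i /(in_plaque_iv hr) ->.
Qed.

Lemma lhol_nbhs (p : R[i] -> X) w (N : set X) : lhol L p w -> nbhs (p w) N ->
  exists2 r : R, 0 < r & forall w', cmod (w' - w) < r -> N (p w').
Proof.
move=> hp hN; have [c Lc hd] := lam_cover L (p w); have [r r0 hr] := hp c Lc hd.
have ww : cmod (w - w) < r by rewrite subrr cmod0.
have [_ _ [d hdw]] := hr w ww; have z1 := zc_lt1 hd.
rewrite -(ivK hd) in hN.
have [[U V] [hU hV] hUV] := @fb_inv_cont _ _ c _ (tc c (p w)) z1 N hN.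
have [e e0 he] := (nbhs_cmod _ _).1 hU; have [s s0 hs] := cder_cont hdw e0.
exists (Num.min r s); first by rewrite lt_min r0.
move=> w'; rewrite lt_min => /andP[wr ws]; rewrite (in_plaque_iv hr wr).
apply: (hUV (zc c (p w') : Cplx R, tc c (p w))); split; last exact: nbhs_singleton.
exact: he (hs _ ws).
Qed.

Lemma lhol_near (p q : R[i] -> X) w (r : R) : 0 < r ->
  (forall w', cmod (w' - w) < r -> p w' = q w') -> lhol L p w -> lhol L q w.
Proof.
move=> r0 pq hp c Lc; have ww : cmod (w - w) < r by rewrite subrr cmod0.
rewrite -pq // => hd; have [s s0 hs] := hp c Lc hd.
exists (Num.min r s); first by rewrite lt_min r0.
move=> w'; rewrite lt_min => /andP[wr ws]; rewrite -pq //; have [h1 h2 [d hdd]] := hs w' ws.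
split => //; exists d.
have rr : 0 < r - cmod (w' - w) by rewrite subr_gt0.
apply: (cder_near rr _ hdd) => v vr /=; rewrite pq //.
by apply: le_lt_trans (cmod_dist _ w' _) _; lra.
Qed.

(** The transversal coordinate is locally constant along a leafwise map, hence constant along the
    segments from the centre. *)
Lemma lhol_in_plaque c (p : R[i] -> X) a (r : R) : L c -> 0 < r ->
  (forall w, cmod (w - a) < r -> lhol L p w /\ fb_dom c (p w)) ->
  in_plaque p a r (tc c (p a)).
Proof.
move=> Lc r0 hp w wr; have [hw hd] := hp w wr; split => //; last first.
  have [s s0 hs] := hw c Lc hd; have ww : cmod (w - w) < s by rewrite subrr cmod0.
  by have [] := hs w ww.
have aa : cmod (a - a) < r by rewrite subrr cmod0.
rewrite -(seg1 a w); apply: (@segment_ind _ (fun t => tc c (p (seg a w t)) = tc c (p a))).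
  by rewrite seg0.
move=> t t01; have tr := seg_convex t01 aa wr; have [ht hdt] := hp _ tr.
have [s s0 hs] := ht c Lc hdt.
have k0 : 0 < cmod (w - a) + 1 by rewrite ltr_wpDl ?cmod_ge0.
have near (x : R) : `|x - t| < s / (cmod (w - a) + 1) -> tc c (p (seg a w x)) = tc c (p (seg a w t)).
  rewrite ltr_pdivlMr // => hx; have [|_ -> //] := hs (seg a w x).
  by rewrite seg_dist; apply: le_lt_trans hx; rewrite ler_wpM2l // lerDl.
exists (s / (cmod (w - a) + 1)); first by rewrite divr_gt0.
by move=> x x' _ _ /near h1 /near h2; rewrite h2 h1.
Qed.

Section UltraFamily.
Variables (I : Type) (G : set_system I).
Context {UG : UltraFilter G}.

Lemma xlim_ex (f : I -> R[i] -> X) : exists g : R[i] -> X, forall w, f ^~ w @ G --> g w.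
Proof.
have step w : exists x : X, f ^~ w @ G --> x.
  have [x _ hx] := @compact_ultralim I G UG X setT (f ^~ w) X_compact filterT.
  by exists x.
by have [g hg] := choice step; exists g.
Qed.

(** Continuous convergence at [w], which stands for locally uniform convergence. *)
Definition moving_lim (f : I -> R[i] -> X) (g : R[i] -> X) w :=
  forall y : I -> R[i], clim G y w -> (fun i => f i (y i)) @ G --> g w.

Section LimLocal.
Variables (f : I -> R[i] -> X) (g : R[i] -> X) (a : R[i]) (r : R).
Variables (c : flow_box R X) (K : set X).
Hypotheses (Lc : L c) (cK : closed K) (Kc : K `<=` fb_dom c) (r0 : 0 < r).
Hypothesis hf : \forall i \near G, forall w, cmod (w - a) < r -> lhol L (f i) w /\ K (f i w).
Hypothesis hg : forall w, cmod (w - a) < r -> f ^~ w @ G --> g w.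

Let gK w : cmod (w - a) < r -> fb_dom c (g w).
Proof.
move=> wr; apply: Kc; apply: closed_lim cK _ (hg wr).
by apply: filterS hf => i /(_ w wr)[].
Qed.

Let aa : cmod (a - a) < r. Proof. by rewrite subrr cmod0. Qed.

Let pl : \forall i \near G, in_plaque (f i) a r (tc c (f i a)).
Proof.
apply: filterS hf => i h; apply: (lhol_in_plaque Lc r0) => w /h[h1 h2].
by split => //; exact: Kc.
Qed.

Let dF w : cmod (w - a) < r -> \forall i \near G, forall w',
  cmod (w' - w) <= (r - cmod (w - a)) / 2 ->
  (exists d, cder (zc c \o f i) w' d) /\ cmod ((zc c \o f i) w') <= 1.
Proof.
move=> wr; apply: filterS pl => i h w' hw'.
have [h1 _ h2] := h w' ltac:(have := cmod_dist w' w a; lra).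
by split => //; apply: ltW; exact: zc_lt1.
Qed.

Let lF w w' : cmod (w - a) < r -> cmod (w' - w) < (r - cmod (w - a)) / 2 ->
  clim G ((fun i => zc c \o f i) ^~ w') ((zc c \o g) w').
Proof.
move=> wr hw'; have w'r : cmod (w' - a) < r by have := cmod_dist w' w a; lra.
exact: (lim_zc (hg w'r) (gK w'r)).
Qed.

Let rr w : cmod (w - a) < r -> 0 < (r - cmod (w - a)) / 2.
Proof. by move=> wr; rewrite divr_gt0 // subr_gt0. Qed.

Let gE w : cmod (w - a) < r -> g w = iv c (zc c (g w)) (tc c (g a)).
Proof.
move=> wr; apply: (xlim_uniq (hg wr)).
pose proof (lim_iv (zc_lt1 (gK wr)) (lim_zc (hg wr) (gK wr)) (lim_tc (hg aa) (gK aa))) as Hlim0; move: Hlim0.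
move=> Hlim; apply: (lim_near _ Hlim).
by apply: filterS pl => i /in_plaque_iv/(_ wr) <-.
Qed.

(** Each [f i] stays in a single plaque of the box, where it is a bounded holomorphic function; the
    transversal coordinates of these plaques converge, so the limit lies in one plaque, and its
    coordinate is a limit of holomorphic functions. *)
Lemma lim_local_plaque : in_plaque g a r (tc c (g a)).
Proof.
move=> w wr; split; first exact: gK.
  by rewrite [g w](gE wr) tc_iv //; apply: zc_lt1; exact: gK.
exact: (hol_lim_ex (rr wr) (dF wr) (fun w' => @lF w w' wr)).
Qed.

Lemma lim_local_lhol w : cmod (w - a) < r -> lhol L g w.
Proof.
move=> wr; apply: (lhol_of_box (t := tc c (g a)) Lc (rr wr)) => w' hw'.
by apply: lim_local_plaque; have := cmod_dist w' w a; lra.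
Qed.

Lemma lim_local_moving w : cmod (w - a) < r -> moving_lim f g w.
Proof.
move=> wr y hy.
have ww : cmod (w - w) < (r - cmod (w - a)) / 2 by rewrite subrr cmod0 rr.
pose proof (hol_lim_moving (dF wr) (fun w' => @lF w w' wr) ww hy) as h.
pose proof (lim_iv (zc_lt1 (gK wr)) h (lim_tc (hg aa) (gK aa))) as Hlim0; move: Hlim0.
rewrite -gE //; move=> Hlim; apply: (lim_near _ Hlim).
apply: filterS2 pl (hy _ (rr wr)) => i h1 h2.
rewrite -(in_plaque_iv h1) //; have := cmod_dist (y i) w a; lra.
Qed.

Lemma lim_local_der (D : I -> R[i]) : (\forall i \near G, cder (zc c \o f i) a (D i)) ->
  exists2 d, cder (zc c \o g) a d & clim G D d.
Proof. exact: (hol_lim (rr aa) (dF aa) (fun w' => @lF a w' aa)). Qed.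

End LimLocal.

(** Points of the closed disc that violate the conclusion would converge along the ultrafilter to a
    point of the disc, against continuous convergence there. *)
Lemma lim_uniform (f : I -> R[i] -> X) (g : R[i] -> X) a (r : R) (N : set X) :
  (forall w, cmod (w - a) <= r -> moving_lim f g w /\ nbhs (g w) N) ->
  \forall i \near G, forall w, cmod (w - a) <= r -> N (f i w).
Proof.
move=> h; apply: contrapT => /ultra_not h1.
have step i : exists w, (exists2 w, cmod (w - a) <= r & ~ N (f i w)) ->
    cmod (w - a) <= r /\ ~ N (f i w).
  by have [[w h2 h3]|n] := pselect (exists2 w, cmod (w - a) <= r & ~ N (f i w)); [exists w|exists 0].
have [y hy] := choice step.
have {}hy : \forall i \near G, cmod (y i - a) <= r /\ ~ N (f i (y i)).
  by apply: filterS h1 => i /existsNP[w /not_implyP[h2 h3]]; apply: hy; exists w.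
have [l hl] : exists l, clim G y l.
  apply: (@clim_ex _ _ _ _ _ (r + cmod a)); apply: filterS hy => i [h2 _].
  by have := cmod_dist (y i) a 0; rewrite !subr0; lra.
have lr : cmod (l - a) <= r.
  by apply: clim_le (climB hl (clim_cst a)) _; apply: filterS hy => i [].
have [/(_ y hl) h2 h3] := h l lr.
have h4 : \forall i \near G, N (f i (y i)) by exact: h2 h3.
by have [i [? []]] := ultra_ex (filterI h4 hy).
Qed.

End UltraFamily.

Hypothesis L_unif : forall x, exists2 p : R[i] -> X, unif L p & p 0 = x.

Lemma finite_box_cover : exists (s : seq X) (cs : X -> flow_box R X) (K : X -> set X),
  (forall x : X, [/\ L (cs x), closed (K x), K x `<=` fb_dom (cs x) & nbhs x (K x)]) /\
  forall y : X, exists2 x, x \in s & nbhs y (K x).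
Proof.
have step (x : X) : exists cK : flow_box R X * set X,
   [/\ L cK.1, closed cK.2, cK.2 `<=` fb_dom cK.1 & nbhs x cK.2].
  have [c Lc hd] := lam_cover L x; have [K [h1 h2 h3]] := regular_nbhs (nbhs_dom hd).
  by exists (c, K).
have [F hF] := choice step.
have [s hs] := @finite_subcover (fun x => interior (F x).2) (fun x => nbhs_interior (let: And4 _ _ _ h := hF x in h)).
by exists s, (fun x => (F x).1), (fun x => (F x).2); split.
Qed.

(** Hofer's choice of a point for Brody's rescaling; 1/e plays the role of the derivative, and
    [small z e] will mean that the disc of radius e about z is mapped into one box. If no point
    qualified, one could move again and again by at most n e while halving e. These moves add up to
    at most 2 n e0 <= 1/4, and their limit point would contradict local smallness. *)
Lemma hofer (small : R[i] -> R -> Prop) (e0 n : R) : 0 < e0 -> 0 < n -> n * e0 <= 1 / 8 ->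
  ~ small 0 e0 ->
  (forall z e e', small z e -> 0 < e' -> (e' <= e) -> small z e') ->
  (forall z, cmod z < 1 -> exists2 d : R, 0 < d & forall w, cmod (w - z) < d -> small w d) ->
  exists z (e : R), [/\ cmod z <= 1 / 4, 0 < e, e <= e0, ~ small z e &
    forall w, cmod (w - z) <= n * e -> small w (e / 2)].
Proof.
move=> e00 n0 ne ns smono sloc; apply: contrapT => no.
pose e k := e0 / 2 ^+ k.
have ep k : 0 < e k by rewrite divr_gt0 ?exprn_gt0.
have eS k : e k.+1 = e k / 2 by rewrite /e exprSr invfM mulrA.
have ele k : e k <= e0 by rewrite /e ler_pdivrMr ?exprn_gt0 // ler_peMr ?(ltW e00) // exprn_ege1 // ler1n.
have step (kz : nat * R[i]) : exists w, cmod kz.2 <= 1 / 4 -> ~ small kz.2 (e kz.1) ->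
    cmod (w - kz.2) <= n * e kz.1 /\ ~ small w (e kz.1.+1).
  case: kz => k z /=; have [h1|] := pselect (cmod z <= 1 / 4 /\ ~ small z (e k)); last first.
    by move=> h; exists 0 => h1 h2; case: h.
  have [w hw] : exists w, cmod (w - z) <= n * e k /\ ~ small w (e k / 2).
    apply: contrapT => /forallNP h; apply: no; exists z, (e k); case: h1 => h1 h2; split => //.
    by move=> w wz; apply: contrapT => nw; apply: (h w).
  by exists w; rewrite eS.
have [f hf] := choice step.
pose z := fix z k : R[i] := if k is k'.+1 then f (k', z k') else 0.
have hz k : cmod (z k) <= 2 * n * (e0 - e k) /\ ~ small (z k) (e k).
  elim: k => [|k [IH1 IH2]].
    have e0E : e 0%N = e0 by rewrite /e expr0 divr1.
    have z0E : z 0%N = 0 by [].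
    by rewrite e0E z0E subrr mulr0 cmod0.
  have ek := ep k; have nek : 0 < n * e k by rewrite mulr_gt0.
  have z14 : cmod (z k) <= 1 / 4 by apply: (le_trans IH1); rewrite mulrBr; lra.
  have [h1 h2] := hf (k, z k) z14 IH2; split => //.
  have zS : z k.+1 = f (k, z k) by [].
  rewrite zS eS -[f _](subrK (z k)); apply: le_trans (cmodD _ _) _.
  have -> : 2 * n * (e0 - e k / 2) = n * e k + 2 * n * (e0 - e k) by field.
  by rewrite lerD.
have [G [UG FG]] := @ultraFilterLemma _ \oo _.
have z14 k : cmod (z k) <= 1 / 4.
  have [h1 _] := hz k; apply: (le_trans h1); rewrite mulrBr.
  have : 0 < n * e k by rewrite mulr_gt0.
  lra.
have [l hl] : exists l, clim G z l by apply: (@clim_ex _ _ G UG _ (1 / 4)); apply: nearW.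
have l1 : cmod l <= 1 / 4 by apply: clim_le hl _; exact: nearW.
have l2 : cmod l < 1 by lra.
have [d d0 hd] := sloc l l2.
have ed : G [set k | e k <= d].
  apply: FG; have [m hm] : exists m : nat, e0 / d < m%:R.
    by exists (Num.bound (e0 / d)); apply: archi_boundP; rewrite divr_ge0 ?ltW.
  exists m => // k /= mk; rewrite /e ler_pdivrMr ?exprn_gt0 // mulrC -ler_pdivrMr //.
  apply: (le_trans (ltW hm)); rewrite -natrX ler_nat; exact: leq_trans mk (ltnW (ltn_expl _ _)).
have [k [h1 h2]] := ultra_ex (filterI (hl d d0) ed).
have [_] := hz k; apply; apply: smono (hd _ h1) (ep k) h2.
Qed.

(** Brody's argument. Equicontinuity takes the form of a radius on which every uniformization stays
    in one of finitely many boxes; recentring by automorphisms carries it to all other points of the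
    disc. If it fails, rescaling at the points given by [hofer] produces a map from the whole plane
    to a leaf. *)
Lemma equicontinuity (s : seq X) (cs : X -> flow_box R X) (K : X -> set X) :
  (forall x : X, [/\ L (cs x), closed (K x), K x `<=` fb_dom (cs x) & nbhs x (K x)]) ->
  (forall y : X, exists2 x, x \in s & nbhs y (K x)) ->
  exists2 rho : R, 0 < rho < 1 & forall p, unif L p ->
    exists2 x, x \in s & forall w, cmod w < rho -> K x (p w).
Proof.
move=> hK hs; apply: contrapT => no.
pose small (p : R[i] -> X) z (e : R) := exists2 x, x \in s & forall w, cmod (w - z) < e -> K x (p w).
have smono p z (e e' : R) : small p z e -> 0 < e' -> e' <= e -> small p z e'.
  by move=> [x xs hx] _ e'e; exists x => // w we; apply: hx; exact: lt_le_trans we e'e.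
have sloc p z : unif L p -> cmod z < 1 -> exists2 d : R, 0 < d & forall w, cmod (w - z) < d -> small p w d.
  move=> up z1; have [x xs hx] := hs (p z); have [r r0 hr] := lhol_nbhs (up.1 z z1) hx.
  exists (r / 2); first by rewrite divr_gt0.
  move=> w wr; exists x => // v vr; apply: hr.
  by apply: le_lt_trans (cmod_dist _ w _) _; lra.
have step (N : nat) : exists pze : (R[i] -> X) * (R[i] * R), [/\ unif L pze.1,
    cmod pze.2.1 <= 1 / 4, 0 < pze.2.2, N.+1%:R * pze.2.2 <= 1 / 8 &
    ~ small pze.1 pze.2.1 pze.2.2 /\ forall w, cmod (w - pze.2.1) <= N.+1%:R * pze.2.2 -> small pze.1 w (pze.2.2 / 2)].
  have n0 : (0 : R) < N.+1%:R by rewrite ltr0n.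
  pose e0 : R := 1 / 8 / N.+1%:R.
  have e00 : 0 < e0 by rewrite !divr_gt0.
  have e01 : e0 < 1.
    rewrite /e0 ltr_pdivrMr // mul1r; have h1 : (1 : R) <= N.+1%:R by rewrite ler1n.
    by lra.
  have [p [up np]] : exists p, unif L p /\ ~ small p 0 e0.
    apply: contrapT => /forallNP h; apply: no; exists e0; first by rewrite e00.
    move=> p up; have /not_andP[//|/contrapT[x xs hx]] := h p.
    by exists x => // w we; apply: hx; rewrite subr0.
  have ne : N.+1%:R * e0 <= 1 / 8 by rewrite /e0 mulrC divfK // gt_eqF.
  have [z [e [h1 h2 h3 h4 h5]]] := hofer e00 n0 ne np (@smono p) (fun z => @sloc p z up).
  exists (p, (z, e)); split => //=; apply: le_trans ne; by rewrite ler_pM2l.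
have [F hF] := choice step.
have [G [UG FG]] := @ultraFilterLemma _ \oo _.
(* The rescaled maps are leafwise holomorphic for |u| < N. Around each point a with |a| + 1 < N they
   send the disc of radius 1/2 into one of the [K x], which is the smallness at half the scale. *)
pose f N u := (F N).1 ((F N).2.1 + (F N).2.2%:C * u).
have [g hg] := @xlim_ex nat G UG f.
have eC N : cmod ((F N).2.2%:C : R[i]) = (F N).2.2.
  by have [_ _ h _ _] := hF N; rewrite cmodC gtr0_norm.
have large (b : R) : G [set N : nat | b < N%:R].
  apply: FG; exists (Num.bound `|b|) => // N /= hN.
  apply: le_lt_trans (ler_norm b) _; apply: lt_le_trans (archi_boundP _) _ => //.
  by rewrite ler_nat.
have inD N u : cmod u < N%:R -> cmod ((F N).2.1 + (F N).2.2%:C * u) < 1.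
  move=> uN; have [_ h1 h2 h3 _] := hF N; apply: le_lt_trans (cmodD _ _) _.
  rewrite cmodM eC; have : (F N).2.2 * cmod u <= N.+1%:R * (F N).2.2.
    by rewrite mulrC ler_pM2r // (le_trans (ltW uN)) // ler_nat.
  lra.
have lf N u : cmod u < N%:R -> lhol L (f N) u.
  move=> uN; have [[up _] _ _ _ _] := hF N.
  apply: (@lhol_comp _ _ _ (F N).1 (fun u => (F N).2.1 + (F N).2.2%:C * u) u 1) => //.
    move=> w _; exists (0 + (F N).2.2%:C * 1).
    by apply: cderD; [exact: cder_cst|apply: cderZ; exact: cder_id].
  by apply: up; exact: inD.
have loc a : exists2 x, x \in s & \forall N \near G, forall w, cmod (w - a) < 2^-1 ->
    lhol L (f N) w /\ K x (f N w).
  apply: ultra_big; apply: filterS (large (cmod a + 1)) => N /= hN.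
  have [_ _ h2 _ [_ h4]] := hF N.
  have aN : cmod ((F N).2.1 + (F N).2.2%:C * a - (F N).2.1) <= N.+1%:R * (F N).2.2.
    rewrite [_ + _ - _]addrC addKr cmodM eC mulrC ler_pM2r //.
    by apply: (@le_trans _ _ N%:R); [lra|rewrite ler_nat].
  have [x xs hx] := h4 _ aN; exists x => // w wa; split.
    by apply: lf; have := cmod_dist w a 0; rewrite !subr0; lra.
  apply: hx; rewrite (_ : _ - _ = (F N).2.2%:C * (w - a)); last by ring.
  by rewrite cmodM eC ltr_pM2l.
have half : (0 : R) < 2^-1 by rewrite invr_gt0.
have locg a : lhol L g a /\ moving_lim G f g a.
  have aa : cmod (a - a) < (2^-1 : R) by rewrite subrr cmod0.
  have [x xs hx] := loc a; have [k1 k2 k3 _] := hK x; split.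
    exact: (lim_local_lhol k1 k2 k3 half hx (fun w _ => hg w) aa).
  exact: (lim_local_moving k1 k2 k3 half hx (fun w _ => hg w) aa).
(* On the disc of radius N the limit lifts through [q] to the unit disc. By the Schwarz lemma the
   lift of [z] has modulus at most |z| / N, which tends to 0. *)
have gcst z : g z = g 0.
  have [q uq q0] := L_unif (g 0).
  have c0 : cmod (0 : R[i]) < 1 by rewrite cmod0.
  have lft (N : nat) : exists y, cmod z < N%:R -> q y = g z /\ N%:R * cmod y <= cmod z.
    have [zN|] := boolP (cmod z < N%:R); last by exists 0.
    have N0 : (0 : R) < N%:R by apply: le_lt_trans zN; exact: cmod_ge0.
    have [h [h0 hh]] := unif_lift uq (fun w (_ : cmod w < N%:R) => (locg w).1) N0 c0 q0.
    exists (h z) => _; split; first by have [] := hh z zN.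
    by apply: schwarz_rho => // w /hh[//] _ /ltW.
  have [y hy] := choice lft.
  have y0 : clim G y 0.
    move=> e e0; apply: filterS2 (large (cmod z)) (large ((cmod z + 1) / e)) => N /= h1 h2.
    have [_ h3] := hy N h1; rewrite subr0.
    have N0 : (0 : R) < N%:R by apply: le_lt_trans h1; exact: cmod_ge0.
    rewrite ltr_pdivrMr // in h2; rewrite -(ltr_pM2l N0); lra.
  pose proof (lhol_lim (uq.1 0 c0) y0) as h1; rewrite q0 in h1.
  apply: (@xlim_uniq nat G UG (fun N => q (y N))) h1.
  apply: (@lim_near nat G UG (fun=> g z)); last exact: cvg_cst.
  by apply: filterS (large (cmod z)) => N /hy[].
have [x xs hx] := hs (g 0).
(* Since the limit is constant, the rescaled unit discs end up in one box, whereas the chosen points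
   are not small at their own scale. *)
have : \forall N \near G, forall w, cmod (w - 0) <= 1 -> K x (f N w).
  by apply: (lim_uniform (g := g)) => w _; split; [have [] := locg w|rewrite gcst].
move=> /ultra_ex[N hN]; have [_ _ h2 _ [h3 _]] := hF N; apply: h3; exists x => // w wz.
have e0 : (F N).2.2%:C != 0 :> R[i] by rewrite -cmod_gt0 eC.
have := hN ((w - (F N).2.1) / (F N).2.2%:C); rewrite /f (_ : _ + _ * (_ / _) = w); last by field.
by apply; rewrite subr0 cmod_div eC ler_pdivrMr // mul1r ltW.
Qed.

Section UnifLimits.
Variables (I : Type) (G : set_system I).
Context {UG : UltraFilter G}.
Variables (p : I -> R[i] -> X) (q : R[i] -> X).
Hypothesis up : \forall i \near G, unif L (p i).
Hypothesis pq : forall w, cmod w < 1 -> p ^~ w @ G --> q w.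

(** An automorphism brings [a] to the centre, where the common radius of [equicontinuity] puts all
    the maps into one box. *)
Lemma unif_lim_local a : cmod a < 1 -> lhol L q a /\ moving_lim G p q a.
Proof.
move=> a1; have [s [cs [K [hK hs]]]] := finite_box_cover.
have [rho /andP[rho0 rho1] hrho] := equicontinuity hK hs.
have [x xs hx] : exists2 x, x \in s & \forall i \near G, forall w, cmod w < rho -> K x ((p i \o mob a) w).
  apply: ultra_big; apply: filterS up => i upi.
  by have [x xs hx] := hrho _ (unif_mob upi a1); exists x.
have [k1 k2 k3 _] := hK x.
have h1 : \forall i \near G, forall w, cmod (w - 0) < rho -> lhol L (p i \o mob a) w /\ K x ((p i \o mob a) w).
  apply: filterS2 up hx => i upi hi w; rewrite subr0 => wr; split; last exact: hi.
  by apply: (unif_mob upi a1).1; exact: lt_trans wr rho1.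
have h2 w : cmod (w - 0) < rho -> (fun i => p i \o mob a) ^~ w @ G --> (q \o mob a) w.
  by rewrite subr0 => wr; apply: pq; apply: mob_lt1 => //; exact: lt_trans wr rho1.
have c00 : cmod (0 - 0 : R[i]) < rho by rewrite subr0 cmod0.
have na : cmod (- a) < 1 by rewrite cmodN.
have r0 : 0 < 1 - cmod a by rewrite subr_gt0.
have in1 w : cmod (w - a) < 1 - cmod a -> cmod w < 1.
  by move=> h; have := cmod_dist w a 0; rewrite !subr0; lra.
split.
  pose proof (lim_local_lhol k1 k2 k3 rho0 h1 h2 c00) as H.
  apply: (@lhol_near ((q \o mob a) \o mob (- a)) q a _ r0).
    by move=> w /in1 w1 /=; rewrite mobKN.
  apply: (lhol_comp r0); last by rewrite mobNv.
  by move=> w /in1 w1; eexists; exact: (cder_mob (mob_den na (ltW w1))).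
move=> y hy; pose proof (lim_local_moving k1 k2 k3 rho0 h1 h2 c00) as H.
have hy' : clim G (fun i => mob (- a) (y i)) 0.
  rewrite -(mobNv a); apply: clim_ccont hy.
  exact: cder_cont (cder_mob (mob_den na (ltW a1))).
have := H _ hy'; rewrite /= mob0; move=> Hlim; apply: (lim_near _ Hlim).
by apply: filterS (hy _ r0) => i /in1 y1 /=; rewrite mobKN.
Qed.

Lemma unif_lim_box a c : cmod a < 1 -> L c -> fb_dom c (q a) ->
  exists (K : set X) (r : R), [/\ closed K, K `<=` fb_dom c, 0 < r, cmod a + r < 1 &
    \forall i \near G, forall w, cmod (w - a) < r -> lhol L (p i) w /\ K (p i w)].
Proof.
move=> a1 Lc hd; have [K [h1 h2 h3]] := regular_nbhs (nbhs_dom hd).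
have hi : nbhs (q a) (interior K) by exact: nbhs_interior h1.
have [r r0 hr] := lhol_nbhs (unif_lim_local a1).1 hi.
pose e := Num.min (r / 2) ((1 - cmod a) / 2).
have e0 : 0 < e by rewrite lt_min !divr_gt0 // subr_gt0.
have [e1 e2] : e <= r / 2 /\ e <= (1 - cmod a) / 2 by rewrite /e !ge_min !lexx orbT.
exists K, e; split => //; first lra.
have in1 w : cmod (w - a) <= e -> cmod w < 1.
  by move=> h; have := cmod_dist w a 0; rewrite !subr0; lra.
have : \forall i \near G, forall w, cmod (w - a) <= e -> K (p i w).
  apply: (lim_uniform (g := q)) => w we; split; first exact: (unif_lim_local (in1 w we)).2.
  by apply: hr; lra.
apply: filterS2 up => i upi h w we; split; last by apply: h; exact: ltW.
by apply: upi.1; apply: in1; exact: ltW.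
Qed.

Lemma unif_lim_der a c (D : I -> R[i]) : cmod a < 1 -> L c -> fb_dom c (q a) ->
  (\forall i \near G, cder (zc c \o p i) a (D i)) ->
  exists2 d, cder (zc c \o q) a d & clim G D d.
Proof.
move=> a1 Lc hd hD; have [K [r [h1 h2 h3 h4 h5]]] := unif_lim_box a1 Lc hd.
apply: (lim_local_der Lc h1 h2 h3 h5 _ hD) => w wr.
by apply: pq; have := cmod_dist w a 0; rewrite !subr0; lra.
Qed.

(** The lifts of the plaques through [p i z] converge by [disc_map_ultralim], since all of them take
    the interior value [z] at the base point; their limit lifts the plaque through [q z]. *)
Lemma unif_lim : unif L q.
Proof.
split=> [a /unif_lim_local[] //|z c z1 Lc hd].
have [_ mov] := unif_lim_local z1.
pose proof (lim_dom (pq z1) hd) as hdi.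
have step i : exists psi, unif L (p i) -> fb_dom c (p i z) -> [/\ disc_map psi,
    psi (zc c (p i z)) = z & forall w, cmod w < 1 -> p i (psi w) = iv c w (tc c (p i z))].
  have [[h1 h2]|n] := pselect (unif L (p i) /\ fb_dom c (p i z)).
    by have [psi h] := h1.2 z c z1 Lc h2; exists psi.
  by exists id => h1 h2; case: n.
have [psi hpsi] := choice step.
have hi : \forall i \near G, [/\ disc_map (psi i),
    psi i (zc c (p i z)) = z & forall w, cmod w < 1 -> p i (psi i w) = iv c w (tc c (p i z))].
  by apply: filterS2 up hdi => i; exact: hpsi.
pose proof (lim_zc (pq z1) hd) as l1.
have d1 : \forall i \near G, disc_map (psi i) by apply: filterS hi => i [].
have l2 : clim G (fun i => psi i (zc c (p i z))) z.
  by apply: clim_near (clim_cst z); apply: filterS hi => i [_ ->].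
have [f [df f0 hf]] := disc_map_ultralim d1 (zc_lt1 hd) l1 z1 l2.
exists f; split => // w w1; have [_ fw1] := df w w1.
apply: (@xlim_uniq I G UG (fun i => p i (psi i w))).
  exact: (unif_lim_local fw1).2 _ (hf w (fun=> w) w1 (clim_cst w)).
pose proof (lim_iv w1 (clim_cst w) (lim_tc (pq z1) hd)) as Hlim0; move: Hlim0.
by move=> Hlim; apply: (lim_near _ Hlim); apply: filterS hi => i [_ _ ->].
Qed.

End UnifLimits.
End Laminations.
End Compactness.

(** * Unordered sums and packing *)

Section Sums.
Variable R : realType.
Implicit Types (T : R[i] -> R[i]) (A B : seq R[i]) (s w : R[i]).

Lemma sum_split (V : zmodType) (F : R[i] -> V) A B : uniq A -> uniq B -> {subset A <= B} ->
  \sum_(w <- B) F w = \sum_(w <- A) F w + \sum_(w <- B | w \notin A) F w.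
Proof.
move=> uA uB AB; rewrite (bigID (mem A)) /=; congr (_ + _).
rewrite -big_filter; apply: perm_big; apply: uniq_perm => //; first exact: filter_uniq.
move=> w; rewrite mem_filter; case: (boolP (w \in A)) => //= wA; exact: AB.
Qed.

Definition sum_bounded T (M : R) := forall A, uniq A -> \sum_(w <- A) cmod (T w) <= M.

(** Unordered summation over all complex numbers, along the finite sets ordered by inclusion; the
    points of a slice need not be enumerated. *)
Definition issum T s := forall e : R, 0 < e -> exists2 A0, uniq A0 &
  forall A, uniq A -> {subset A0 <= A} -> cmod (\sum_(w <- A) T w - s) <= e.

Lemma sub_undup_l A B : {subset A <= undup (A ++ B)}.
Proof. by move=> w wA; rewrite mem_undup mem_cat wA. Qed.

Lemma sub_undup_r A B : {subset B <= undup (A ++ B)}.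
Proof. by move=> w wB; rewrite mem_undup mem_cat wB orbT. Qed.

Lemma issum_uniq T s s' : issum T s -> issum T s' -> s = s'.
Proof.
move=> h h'; apply/eqP; rewrite -subr_eq0 -cmod_eq0 eq_le cmod_ge0 andbT.
apply: (@eps_le _ _ _ 2) => e e0; rewrite add0r.
have [A uA hA] := h e e0; have [B uB hB] := h' e e0.
have := hA _ (undup_uniq _) (@sub_undup_l A B).
have := hB _ (undup_uniq _) (@sub_undup_r A B).
set S := \sum_(w <- _) _ => h1 h2.
by have := cmod_dist s S s'; rewrite (cmodBC s S); lra.
Qed.

Lemma issum_ex T M : sum_bounded T M -> exists s, issum T s.
Proof.
move=> bT.
pose D A0 := [set A | uniq A /\ {subset A0 <= A}].
have FD : ProperFilter (filter_from [set: seq R[i]] D).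
  apply: filter_from_proper; last first.
    by move=> A _; exists (undup A); split; [exact: undup_uniq|move=> w; rewrite mem_undup].
  apply: filter_from_filter; first by exists [::].
  move=> A B _ _; exists (A ++ B) => // C [uC sC].
  by split; split => // w wA; apply: sC; rewrite mem_cat wA ?orbT.
have [G [UG FG]] := ultraFilterLemma FD.
have GD A0 : G (D A0) by apply: FG; exists A0.
have [s hs] : exists s, clim G (fun A => \sum_(w <- A) T w) s.
  apply: (@clim_ex _ _ G UG _ M); apply: filterS (GD [::]) => A [uA _].
  by apply: le_trans (cmod_sum _ _) _; exact: bT.
exists s => e e0.
pose S := [set x | exists2 A, uniq A & x = \sum_(w <- A) cmod (T w)].
have hS : has_sup S.
  split; first by exists 0, [::]; rewrite ?big_nil.
  by exists M => _ [A uA ->]; exact: bT.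
have e2 : 0 < e / 2 by lra.
have [_ [A0 uA0 ->] hA0] := sup_adherent e2 hS.
have est A : uniq A -> {subset A0 <= A} ->
    cmod (\sum_(w <- A) T w - \sum_(w <- A0) T w) <= e / 2.
  move=> uA sA; rewrite (sum_split T uA0 uA sA) [_ + _ - _]addrC addKr.
  rewrite -big_filter; apply: le_trans (cmod_sum _ _) _; rewrite big_filter.
  have : \sum_(w <- A) cmod (T w) <= sup S by apply: sup_upper_bound => //; exists A.
  by rewrite (sum_split (fun w => cmod (T w)) uA0 uA sA); lra.
have est2 : cmod (s - \sum_(w <- A0) T w) <= e / 2.
  apply: (clim_le (climB hs (clim_cst _))); apply: filterS (GD A0) => A [uA sA].
  exact: est.
exists A0 => // A uA sA; apply: le_trans (cmod_dist _ (\sum_(w <- A0) T w) _) _.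
by have := est A uA sA; rewrite (cmodBC _ s); lra.
Qed.

Lemma issum_le T s M : sum_bounded T M -> issum T s -> cmod s <= M.
Proof.
move=> bT h; apply: (@eps_le _ _ _ 1) => e e0; rewrite mul1r.
have [A uA hA] := h e e0; have h1 := hA A uA (fun w => id).
have h2 := cmod_dist s (\sum_(w <- A) T w) 0; rewrite !subr0 cmodBC in h2.
have h3 := le_trans (cmod_sum A T) (bT A uA); lra.
Qed.

Lemma issumZ a T s : issum T s -> issum (fun w => a * T w) (a * s).
Proof.
move=> h e e0; have k0 : 0 < cmod a + 1 by rewrite ltr_wpDl ?cmod_ge0.
have [A uA hA] := h _ (divr_gt0 e0 k0); exists A => // B uB AB.
rewrite -big_distrr -mulrBr cmodM /=; have := hA B uB AB.
rewrite ler_pdivlMr // => h1; apply: le_trans h1; rewrite mulrC ler_wpM2l ?cmod_ge0 //.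
by rewrite lerDl.
Qed.

Lemma issumD T T' s s' : issum T s -> issum T' s' -> issum (fun w => T w + T' w) (s + s').
Proof.
move=> h h' e e0; have e2 : 0 < e / 2 by lra.
have [A uA hA] := h _ e2; have [B uB hB] := h' _ e2.
exists (undup (A ++ B)); first exact: undup_uniq.
move=> C uC sC; rewrite big_split /=.
have h1 := hA C uC (fun w wA => sC w (@sub_undup_l A B w wA)).
have h2 := hB C uC (fun w wB => sC w (@sub_undup_r A B w wB)).
rewrite (_ : _ - _ = (\sum_(w <- C) T w - s) + (\sum_(w <- C) T' w - s')); last by ring.
by apply: le_trans (cmodD _ _) _; lra.
Qed.

Lemma issum_eq T T' s : T =1 T' -> issum T s -> issum T' s.
Proof. by move=> /funext ->. Qed.

Lemma issum_dist T T' s s' M : issum T s -> issum T' s' ->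
  sum_bounded (fun w => T w - T' w) M -> cmod (s - s') <= M.
Proof.
move=> h h' hM; apply: (issum_le hM); have := issumD h (issumZ (-1) h').
by rewrite mulN1r; apply: issum_eq => w; rewrite mulN1r.
Qed.

(** Only the supports have to correspond, because automorphisms of the disc are inverse to each
    other only on the disc. *)
Lemma issum_reindex T T' (h h' : R[i] -> R[i]) s :
  (forall w, T w != 0 -> h (h' w) = w /\ T' (h' w) = T w) ->
  (forall w, T' w != 0 -> h' (h w) = w /\ T (h w) = T' w) -> issum T s -> issum T' s.
Proof.
move=> hT hT' hs e e0; have [A uA hA] := hs e e0.
pose A' := [seq h' w | w <- A & T w != 0].
have uA' : uniq A'.
  rewrite map_inj_in_uniq ?filter_uniq // => x y.
  rewrite !mem_filter => /andP[/hT[hx _] _] /andP[/hT[hy _] _] E.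
  by rewrite -hx E hy.
exists A' => // B uB sB.
have sup F (C : seq R[i]) : \sum_(w <- C) F w = \sum_(w <- C | F w != 0) F w :> R[i].
  by rewrite (bigID (fun w => F w != 0)) /= addrC big1 ?add0r // => w /negPn/eqP.
pose B' := [seq h w | w <- B & T' w != 0].
have uB' : uniq B'.
  rewrite map_inj_in_uniq ?filter_uniq // => x y.
  rewrite !mem_filter => /andP[/hT'[hx _] _] /andP[/hT'[hy _] _] E.
  by rewrite -hx E hy.
have -> : \sum_(w <- B) T' w = \sum_(w <- B') T w.
  rewrite /B' big_map big_filter sup; apply: eq_bigr => w /hT'[_ ->] //.
have -> : \sum_(w <- B') T w = \sum_(w <- undup (B' ++ A)) T w.
  rewrite (sum_split T uB' (undup_uniq _) (@sub_undup_l B' A)) [X in _ + X]big1_seq ?addr0 //.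
  move=> w /andP[wB']; rewrite mem_undup mem_cat (negPf wB') /= => wA.
  apply/eqP/negPn/negP => Tw; have [hw T'w] := hT w Tw; move/negP: wB'; apply.
  apply/mapP; exists (h' w) => //; rewrite mem_filter T'w Tw /=; apply: sB.
  by apply/mapP; exists w => //; rewrite mem_filter Tw.
apply: hA; [exact: undup_uniq|exact: sub_undup_r].
Qed.

(** The square [-1, 1]^2 is cut into (2m)^2 cells of side 1/m, and two points of one cell are closer
    than 2/m. *)
Lemma packing_count A (m : nat) : (0 < m)%N -> uniq A -> (forall w, w \in A -> cmod w < 1) ->
  (forall w w', w \in A -> w' \in A -> w != w' -> 2 / m%:R <= cmod (w - w')) ->
  (size A <= (2 * m) ^ 2)%N.
Proof.
move=> m0 uA A1 sepA.
have mR : 0 < m%:R :> R by rewrite ltr0n.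
pose k := (2 * m).-1; have kE : k.+1 = (2 * m)%N by rewrite /k prednK // muln_gt0.
pose cell (x : R) : 'I_k.+1 := inord (Num.truncn ((x + 1) * m%:R)).
have cellP (x : R) : `|x| < 1 -> (cell x)%:R <= (x + 1) * m%:R < (cell x)%:R + 1.
  rewrite ltr_norml => /andP[x1 x2].
  have x0 : 0 <= (x + 1) * m%:R by rewrite mulr_ge0 // ltW //; lra.
  have /andP[t1 t2] := truncn_itv x0.
  have lt : (Num.truncn ((x + 1) * m%:R) < k.+1)%N.
    rewrite kE -(ltr_nat R); apply: le_lt_trans t1 _.
    by rewrite natrM ltr_pM2r //; lra.
  by rewrite /cell inordK // t1 natr1.
pose f (w : R[i]) := (cell (complex.Re w), cell (complex.Im w)).
have finj : {in A &, injective f}.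
  move=> w w' wA w'A [] /(congr1 (fun i : 'I__ => (i : nat)%:R : R)) e1.
  move=> /(congr1 (fun i : 'I__ => (i : nat)%:R : R)) e2.
  apply/eqP/negPn/negP => ww; have := sepA w w' wA w'A ww.
  have c1 v : v \in A -> `|complex.Re v| < 1 /\ `|complex.Im v| < 1.
    by move=> /A1 h; split; apply: le_lt_trans h; [exact: cmod_Re|exact: cmod_Im].
  have [a1 a2] := c1 w wA; have [b1 b2] := c1 w' w'A.
  move: (cellP _ a1) (cellP _ a2) (cellP _ b1) (cellP _ b2); rewrite e1 e2.
  move=> /andP[p1 p2] /andP[q1 q2] /andP[p3 p4] /andP[q3 q4].
  rewrite ler_pdivrMr //; apply/negP; rewrite -ltNge.
  have d1 : `|complex.Re w - complex.Re w'| * m%:R < 1.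
    by rewrite -{1}(gtr0_norm mR) -normrM ltr_norml mulrBl; apply/andP; split; lra.
  have d2 : `|complex.Im w - complex.Im w'| * m%:R < 1.
    by rewrite -{1}(gtr0_norm mR) -normrM ltr_norml mulrBl; apply/andP; split; lra.
  apply: le_lt_trans (_ : (`|complex.Re w - complex.Re w'| + `|complex.Im w - complex.Im w'|) * m%:R < _).
    rewrite ler_pM2r //; have := cmod_le (w - w').
    by case: (w) => ? ?; case: (w').
  by rewrite mulrDl; lra.
have -> : size A = size [seq f w | w <- A] by rewrite size_map.
have /card_uniqP <- : uniq [seq f w | w <- A] by rewrite map_inj_in_uniq.
by rewrite (leq_trans (max_card _)) // card_prod !card_ord kE -mulnn.
Qed.

(** Up to constants this is separation in the hyperbolic metric. *)
Definition separated_seq (del : R) A := [/\ uniq A, forall w, w \in A -> cmod w < 1 &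
  forall w w', w \in A -> w' \in A -> w != w' -> del * (1 - cmod w) <= cmod (w - w')].

(** In the annulus where 1 - |w| is between 2^-(N+1) and 2^-N, separation allows at most 4 K^2 4^N
    points, each contributing at most 8^-N; the annuli add up to a geometric series. *)
Lemma packing (del : R) : 0 < del -> exists2 C : R, 0 < C & forall A, separated_seq del A ->
  \sum_(w <- A) (1 - cmod w) ^+ 3 <= C.
Proof.
move=> d0; pose K := (Num.bound (4 / del)).+1.
have K0 : (0 < K%:R :> R) by rewrite ltr0n.
have hK : 4 / del < K%:R.
  by apply: lt_trans (archi_boundP _) _; rewrite ?ltr_nat // divr_ge0 // ltW.
have KS : 0 < K%:R ^+ 2 :> R by rewrite exprn_gt0.
exists (32 * K%:R ^+ 2); first by rewrite mulr_gt0.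
move=> A [uA A1 sA].
have step (N : nat) B : uniq B -> {subset B <= A} ->
    (forall w, w \in B -> (2 ^+ N)^-1 < 1 - cmod w) ->
    \sum_(w <- B) (1 - cmod w) ^+ 3 <= 32 * K%:R ^+ 2 * (1 - (2 ^+ N)^-1).
  elim: N B => [|N IH] B uB BA hB.
    rewrite expr0 invr1 subrr mulr0 big1_seq // => w /hB; rewrite expr0 invr1.
    by have := cmod_ge0 w; lra.
  pose B1 := [seq w <- B | (2 ^+ N)^-1 < 1 - cmod w].
  pose B2 := [seq w <- B | ~~ ((2 ^+ N)^-1 < 1 - cmod w)].
  have -> : \sum_(w <- B) (1 - cmod w) ^+ 3 =
      \sum_(w <- B1) (1 - cmod w) ^+ 3 + \sum_(w <- B2) (1 - cmod w) ^+ 3.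
    rewrite -big_cat; apply: perm_big; rewrite perm_sym.
    exact: (permEl (perm_filterC (fun w => (2 ^+ N)^-1 < 1 - cmod w) B)).
  have h1 : \sum_(w <- B1) (1 - cmod w) ^+ 3 <= 32 * K%:R ^+ 2 * (1 - (2 ^+ N)^-1).
    apply: IH; first exact: filter_uniq.
      by move=> w; rewrite mem_filter => /andP[_]; exact: BA.
    by move=> w; rewrite mem_filter => /andP[].
  have sub2 w : w \in B2 -> w \in B by rewrite mem_filter => /andP[].
  have x0 : 0 < (2 ^+ N)^-1 :> R by rewrite invr_gt0 exprn_gt0.
  have E : (2 ^+ N.+1)^-1 = (2 ^+ N)^-1 / 2 :> R by rewrite exprSr invfM.
  have h2 : (size B2 <= (2 * (K * 2 ^ N)) ^ 2)%N.
    apply: packing_count; first by rewrite muln_gt0 expn_gt0.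
    - exact: filter_uniq.
    - by move=> w /sub2/BA; exact: A1.
    - move=> w w' hw hw' ww; apply: le_trans (sA w w' (BA _ (sub2 _ hw)) (BA _ (sub2 _ hw')) ww).
      have h3 := hB w (sub2 _ hw); rewrite E in h3.
      have : del * ((2 ^+ N)^-1 / 2) <= del * (1 - cmod w) by rewrite ler_pM2l // ltW.
      apply: le_trans; rewrite natrM natrX invfM mulrA.
      have : 2 / K%:R <= del / 2.
        rewrite ler_pdivrMr //; move: hK; rewrite ltr_pdivrMr //; lra.
      by rewrite -(ler_pM2r x0) => h4; apply: (le_trans h4); lra.
  have h3 : \sum_(w <- B2) (1 - cmod w) ^+ 3 <= (size B2)%:R * ((2 ^+ N)^-1) ^+ 3.
    rewrite -sum1_size natr_sum mulr_suml big_seq [X in _ <= X]big_seq.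
    apply: ler_sum => w wB2; rewrite mul1r.
    move: (wB2); rewrite mem_filter -leNgt => /andP[hw _].
    by rewrite lerXn2r ?nnegrE ?(ltW x0) // subr_ge0 ltW // A1 // BA // sub2.
  have h4 : (size B2)%:R * ((2 ^+ N)^-1) ^+ 3 <= 4 * K%:R ^+ 2 * (2 ^+ N)^-1 * 4 :> R.
    apply: (@le_trans _ _ (((2 * (K * 2 ^ N)) ^ 2)%:R * ((2 ^+ N)^-1) ^+ 3)).
      by rewrite ler_wpM2r ?exprn_ge0 ?(ltW x0) // ler_nat.
    have y0 : (2 ^+ N : R) != 0 by rewrite expf_neq0.
    rewrite natrX !natrM natrX (_ : _ * _ = 4 * K%:R ^+ 2 * (2 ^+ N)^-1).
      by rewrite ler_peMr // ?mulr_ge0 ?(ltW x0) ?(ltW KS) //; lra.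
    by field.
  have h5 : (0 : R) < K%:R ^+ 2 * (2 ^+ N)^-1 by apply: mulr_gt0.
  rewrite E; have -> : 32 * K%:R ^+ 2 * (1 - (2 ^+ N)^-1 / 2) =
    32 * K%:R ^+ 2 * (1 - (2 ^+ N)^-1) + 16 * (K%:R ^+ 2 * (2 ^+ N)^-1) :> R.
    by field; rewrite expf_neq0.
  apply: lerD => //; apply: (le_trans h3); apply: (le_trans h4); lra.
have [N hN] : exists N : nat, forall w, w \in A -> (2 ^+ N)^-1 < 1 - cmod w.
  elim: (A) A1 => [|w B IH] B1; first by exists 0%N.
  have [|N hN] := IH; first by move=> v vB; apply: B1; rewrite in_cons vB orbT.
  have w1 : 0 < 1 - cmod w by rewrite subr_gt0 B1 // mem_head.
  pose M := Num.bound (1 - cmod w)^-1.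
  have hM : (2 ^+ M)^-1 < 1 - cmod w.
    rewrite invf_plt ?posrE ?exprn_gt0 //.
    apply: lt_trans (archi_boundP _) _; first by rewrite invr_ge0 ltW.
    by rewrite -natrX ltr_nat ltn_expl.
  have mono (a b : nat) : (2 ^+ (a + b))^-1 <= (2 ^+ a)^-1 :> R.
    by rewrite lef_pV2 ?posrE ?exprn_gt0 // ler_weXn2l ?ler1n // leq_addr.
  exists (N + M)%N => v; rewrite in_cons => /orP[/eqP ->|/hN h].
    by rewrite addnC; apply: le_lt_trans (mono _ _) hM.
  exact: le_lt_trans (mono _ _) h.
apply: (le_trans (step N A uA (fun w => id) hN)); rewrite ler_piMr //.
Qed.

End Sums.

(** * Poincare series *)

Section Derivative.
Variable R : realType.

(** The value is 0 where [f] has no derivative. *)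
Definition der (f : R[i] -> R[i]) z : R[i] := xget 0 [set d | cder f z d].

Lemma derE f z d : cder f z d -> der f z = d.
Proof.
move=> h; apply: (cder_uniq _ h).
have e : exists x, [set d | cder f z d] x by exists d.
exact: (@xgetPex _ 0 _ e).
Qed.

Lemma mob_distE (u w : R[i]) : cmod u < 1 -> cmod w < 1 ->
  (1 - cmod u) * cmod (mob (- u) w) <= cmod (w - u) /\
  cmod (w - u) <= 2 * cmod (mob (- u) w).
Proof.
move=> u1 w1; have nu : cmod (- u) < 1 by rewrite cmodN.
have d0 := mob_den nu (ltW w1); have E : w - u = mob (- u) w * (1 + cj (- u) * w).
  by rewrite /mob divfK.
have c1 : cmod (cj (- u) * w) <= cmod u * 1.
  by rewrite cmodM cmod_cj cmodN ler_wpM2l ?cmod_ge0 // ltW.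
have -> : cmod (w - u) = cmod (mob (- u) w) * cmod (1 + cj (- u) * w) by rewrite {1}E cmodM.
split.
  rewrite mulrC ler_wpM2l ?cmod_ge0 //.
  by have := cmod_lerB 1 (- (cj (- u) * w)); rewrite cmod1 cmodN opprK; lra.
rewrite mulrC ler_wpM2r ?cmod_ge0 //; apply: le_trans (cmodD _ _) _; rewrite cmod1; lra.
Qed.

End Derivative.

(** * Uniform separation of the lifts of a slice *)

Section Slices.
Variables (R : realType) (X : topologicalType).
Hypotheses (X_compact : compact [set: X]) (X_hausdorff : hausdorff_space X).
Variable L : lamination R X.
Hypothesis L_unif : forall x, exists2 p : R[i] -> X, unif L p & p 0 = x.
Variables (c : flow_box R X) (K : set X).
Hypotheses (Lc : L c) (cK : closed K) (Kc : K `<=` fb_dom c).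

(** Compactness of the family of uniformizations: counterexamples with radii tending to 0 would
    converge to some [q] with [q 0] in [K], while the box is a neighbourhood of [q 0]. *)
Lemma uniform_radius : exists2 rho : R, 0 < rho < 1 & forall p, unif L p -> K (p 0) ->
  forall u, cmod u < rho -> fb_dom c (p u).
Proof.
apply: contrapT => no.
(* The radii are 1/(n+2), since they have to be less than 1. *)
have step (n : nat) : exists pu : (R[i] -> X) * R[i], [/\ unif L pu.1, K (pu.1 0),
    cmod pu.2 < n.+2%:R^-1 & ~ fb_dom c (pu.1 pu.2)].
  apply: contrapT => /forallNP h; apply: no; exists (n.+2%:R^-1).
    by rewrite invr_gt0 ltr0n /= invf_lt1 ?ltr0n // ltr1n.
  move=> p up Kp u hu; apply: contrapT => nd; apply: (h (p, u)); by split.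
have [F hF] := choice step.
have [G [UG FG]] := @ultraFilterLemma _ \oo _.
have [q hq] := @xlim_ex X X_compact R nat G UG (fun n => (F n).1).
have hu : \forall n \near G, unif L (F n).1 by apply: nearW => n; have [] := hF n.
have c0 : cmod (0 : R[i]) < 1 by rewrite cmod0.
have [_ mov] := unif_lim_local X_compact X_hausdorff L_unif hu (fun w _ => hq w) c0.
have y0 : clim G (fun n => (F n).2) 0.
  move=> e e0; apply: FG; exists (Num.bound e^-1) => // n /= hn.
  have [_ _ h _] := hF n; rewrite subr0; apply: (lt_trans h).
  rewrite invf_plt ?posrE ?ltr0n //; apply: lt_le_trans (archi_boundP _) _; first by rewrite invr_ge0 ltW.
  by rewrite ler_nat; apply: leq_trans hn (leq_trans (leqnSn _) (leqnSn _)).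
have Kq : K (q 0).
  by apply: (closed_lim cK _ (hq 0)); apply: nearW => n; have [] := hF n.
pose proof (lim_dom (mov _ y0) (Kc Kq)) as h.
by have [n hn] := ultra_ex h; have [_ _ _] := hF n.
Qed.

(** After recentring at [w], the uniformization stays on the disc of radius rho in one plaque of the
    box, and the lift psi of that plaque inverts [zc c] there. The coordinate is thus injective on
    this disc, so no second point of the slice lies in it, and rho serves as [del]. *)
Lemma slice_separated : exists2 del : R, 0 < del < 1 & forall p, unif L p ->
  forall w w', cmod w < 1 -> cmod w' < 1 -> K (p w) -> zc c (p w) = zc c (p w') ->
    w != w' -> fb_dom c (p w') -> del * (1 - cmod w) <= cmod (w - w').
Proof.
have [rho rho01 hrho] := uniform_radius; exists rho => // p up w w' w1 w'1 Kw E ww' _.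
have [rho0 rho1] := andP rho01; rewrite leNgt; apply/negP => lt.
pose p' := p \o mob w; have up' : unif L p' := unif_mob up w1.
have p'0 : p' 0 = p w by rewrite /p' /= mob0.
have nw : cmod (- w) < 1 by rewrite cmodN.
pose u := mob (- w) w'; have u1 : cmod u < 1 := mob_lt1 nw w'1.
have p'u : p' u = p w' by rewrite /p' /= /u mobKN.
have ur : cmod u < rho.
  have [h _] := mob_distE w1 w'1; rewrite cmodBC in h.
  have w10 : 0 < 1 - cmod w by rewrite subr_gt0.
  by rewrite -(ltr_pM2l w10) -/u mulrC (mulrC _ rho); apply: le_lt_trans lt; rewrite mulrC.
have dom v : cmod v < rho -> fb_dom c (p' v) by apply: hrho => //; rewrite p'0.
have pl : in_plaque p' 0 rho (tc c (p' 0)).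
  apply: (lhol_in_plaque Lc rho0) => v; rewrite subr0 => vr; split; last exact: dom.
  by apply: up'.1; exact: lt_trans vr rho1.
have c0 : cmod (0 : R[i]) < 1 by rewrite cmod0.
have c00 : cmod (0 : R[i]) < rho by rewrite cmod0.
have [psi [dpsi psi0 psiE]] := up'.2 0 c c0 Lc (dom 0 c00).
have H := @unif_lift_uniq _ _ _ p' p' rho up' (psi \o (zc c \o p')) id 0 c00.
have {}H v : cmod v < rho -> psi (zc c (p' v)) = v.
  apply: H => //; last first.
    move=> y yr; split; [exact: ccont_id|exact: lt_trans yr rho1|by []].
  move=> y yr; have yr0 : cmod (y - 0) < rho by rewrite subr0.
  have [h1 h2 [d hd]] := pl y yr0; have [[e he] hy1] := dpsi _ (zc_lt1 h1).
  split => //; first exact: cder_cont (cder_comp hd he).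
  by rewrite /= psiE ?zc_lt1 // -h2 ivK.
have : u = 0 by rewrite -(H u ur) -(H 0 c00) p'u p'0 E.
move=> /(mob_eq0 w1 (ltW w'1)) E2; by rewrite E2 eqxx in ww'.
Qed.

Lemma slice_packing : exists del C : R, [/\ 0 < del < 1, 0 < C & forall p z1, unif L p ->
  forall A, uniq A -> (forall w, w \in A -> [/\ cmod w < 1, K (p w) & zc c (p w) = z1]) ->
    separated_seq del A /\ \sum_(w <- A) (1 - cmod w) ^+ 3 <= C].
Proof.
have [del del01 hdel] := slice_separated; have [del0 _] := andP del01.
have [C C0 hC] := packing del0; exists del, C; split => // p z1 up A uA hA.
suff sA : separated_seq del A by split => //; exact: hC.
split => // [w /hA[] //|w w' wA w'A ww'].
have [h1 h2 h3] := hA w wA; have [h4 h5 h6] := hA w' w'A.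
by apply: (hdel p up) => //; [rewrite h3|exact: Kc].
Qed.

End Slices.

Section PoincareSeries.
Variables (R : realType) (X : topologicalType).
Hypotheses (X_compact : compact [set: X]) (X_hausdorff : hausdorff_space X).
Variable L : lamination R X.
Hypothesis L_unif : forall x, exists2 p : R[i] -> X, unif L p & p 0 = x.
Variables (c : flow_box R X) (K : set X) (b : X -> R) (z1 : R[i]) (k : nat).
Hypotheses (Lc : L c) (cK : closed K) (Kc : K `<=` fb_dom c).
Hypotheses (b01 : forall x, 0 <= b x <= 1) (bK : forall x, b x != 0 -> K x).
Implicit Types (p : R[i] -> X) (u w : R[i]) (phi : R[i] -> R[i]).

Definition on_slice p w := [/\ cmod w < 1, fb_dom c (p w) & zc c (p w) = z1].

(* The value at w of the derivative of the coordinate zc c \o p, normalized by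
   the hyperbolic metric. *)
Definition nder p w : R[i] := der (zc c \o (p \o mob w)) 0.

Definition phase (d : R[i]) : R[i] := d / (cmod d)%:C.

(* The value at z = 0 of b(p w) (phase (1 - |w|^2) / (1 - conj(w) z)^2)^k dz^k,
   the Poincare kernel at w; the phase makes the k-form independent of the
   uniformization p. *)
Definition term p w : R[i] := if asbool (on_slice p w) then
  (b (p w))%:C * ((1 - cmod w ^+ 2)%:C * phase (nder p w)) ^+ k else 0.

Lemma termE p w : on_slice p w ->
  term p w = (b (p w))%:C * ((1 - cmod w ^+ 2)%:C * phase (nder p w)) ^+ k.
Proof. by move=> h; rewrite /term asboolT. Qed.

Lemma nderE p w d : cmod w < 1 -> cder (zc c \o p) w d ->
  nder p w = d * (1 - cmod w ^+ 2)%:C.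
Proof.
move=> w1 hd; apply: derE.
have d0 : 1 + cj w * 0 != 0 by rewrite mulr0 addr0 oner_neq0.
have := cder_mob d0; rewrite mulr0 addr0 expr1n divr1 mul_cj => h.
have -> : (1 - cmod w ^+ 2)%:C = 1 - (cmod w ^+ 2)%:C by rewrite rmorphB rmorph1.
by apply: (cder_comp (f := zc c \o p) h); rewrite mob0.
Qed.

Lemma phase_mod d : d != 0 -> cmod (phase d) = 1.
Proof.
move=> d0; rewrite /phase cmod_div cmodC ger0_norm ?cmod_ge0 // divff // cmod_eq0 //.
Qed.

Lemma phase_mul d e : phase (d * e) = phase d * phase e.
Proof. by rewrite /phase cmodM rmorphM invfM; ring. Qed.

Lemma phase_pos (x : R) : 0 < x -> phase x%:C = 1.
Proof.
move=> x0; rewrite /phase cmodC gtr0_norm // divff //.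
by rewrite -cmod_gt0 cmodC gtr0_norm.
Qed.

Lemma cmod_sq_gt0 w : cmod w < 1 -> 0 < 1 - cmod w ^+ 2.
Proof. by move=> w1; rewrite subr_gt0 sq_lt1 ?cmod_ge0. Qed.

Lemma phase_nder p w d : cmod w < 1 -> cder (zc c \o p) w d -> phase (nder p w) = phase d.
Proof. by move=> w1 hd; rewrite (nderE w1 hd) phase_mul phase_pos ?mulr1 // cmod_sq_gt0. Qed.

Lemma nder_neq0 p w : unif L p -> on_slice p w -> nder p w != 0.
Proof.
move=> up [w1 hd _]; have [d hdw d0] := unif_der up w1 Lc hd.
rewrite (nderE w1 hdw) mulf_neq0 // -cmod_gt0 cmodC.
by rewrite gtr0_norm; exact: cmod_sq_gt0.
Qed.

Lemma term_neq0 p w : term p w != 0 -> on_slice p w /\ K (p w).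
Proof.
rewrite /term; case: asboolP => [h|]; last by rewrite eqxx.
by rewrite mulf_eq0 negb_or => /andP[b0 _]; split => //; apply: bK; apply: contra b0 => /eqP ->.
Qed.

Lemma cmod_term p w : unif L p -> on_slice p w ->
  cmod (term p w) = b (p w) * (1 - cmod w ^+ 2) ^+ k.
Proof.
move=> up hs; have [w1 _ _] := hs; have w0 := cmod_sq_gt0 w1.
have [b0 _] := andP (b01 (p w)).
rewrite termE // cmodM cmodC ger0_norm // cmodX cmodM cmodC gtr0_norm //.
by rewrite phase_mod ?mulr1 // nder_neq0.
Qed.

(** The weight [phi] = 1 gives the value of the form at 0; other weights give its derivative at 0
    and its values elsewhere. The default 0 is taken where the sum does not exist. *)
Definition poincare phi p : R[i] := xget 0 [set s | issum (fun w => phi w * term p w) s].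

Section Bounds.
Variables (del C : R).
Hypothesis pack : forall p z1, unif L p ->
  forall A, uniq A -> (forall w, w \in A -> [/\ cmod w < 1, K (p w) & zc c (p w) = z1]) ->
    separated_seq del A /\ \sum_(w <- A) (1 - cmod w) ^+ 3 <= C.
Hypothesis k3 : (3 <= k)%N.

(** Three of the k factors 1 - |w|^2 <= 2 (1 - |w|) pay for convergence through the packing bound.
    The other k - 3 give the decay, exploited with r near 1 for continuity and with k large for
    domination by one term. *)
Lemma term_tail p (r : R) A : unif L p -> 0 <= r <= 1 -> uniq A ->
  (forall w, w \in A -> term p w != 0 -> r <= cmod w) ->
  \sum_(w <- A) cmod (term p w) <= (1 - r ^+ 2) ^+ (k - 3) * (8 * C).
Proof.
move=> up /andP[r0 r1] uA hA.
pose B := [seq w <- A | term p w != 0].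
have -> : \sum_(w <- A) cmod (term p w) = \sum_(w <- B) cmod (term p w).
  rewrite /B big_filter [LHS](bigID (fun w => term p w != 0)) /= addrC big1 ?add0r //.
  by move=> w /negPn/eqP ->; rewrite cmod0.
have hB w : w \in B -> [/\ cmod w < 1, K (p w) & zc c (p w) = z1].
  by rewrite mem_filter => /andP[/term_neq0[[]]].
have [_ h] := pack up (filter_uniq _ uA) hB.
have r20 : 0 <= 1 - r ^+ 2 by rewrite subr_ge0 expr_le1.
apply: le_trans (_ : \sum_(w <- B) (1 - r ^+ 2) ^+ (k - 3) * (8 * (1 - cmod w) ^+ 3) <= _).
  rewrite big_seq [X in _ <= X]big_seq; apply: ler_sum => w wB.
  move: (wB); rewrite mem_filter => /andP[tw wA]; have [hs _] := term_neq0 tw.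
  have [w1 _ _] := hs; have w0 := cmod_sq_gt0 w1.
  rewrite cmod_term //; have [b0 b1] := andP (b01 (p w)).
  apply: (@le_trans _ _ ((1 - cmod w ^+ 2) ^+ k)); first by rewrite ler_piMl // exprn_ge0 // ltW.
  rewrite -{1}(subnK k3) exprD ler_pM ?exprn_ge0 ?(ltW w0) //.
    rewrite lerXn2r ?nnegrE ?(ltW w0) // lerD2l lerN2.
    by rewrite lerXn2r ?nnegrE ?cmod_ge0 // hA.
  have -> : 8 * (1 - cmod w) ^+ 3 = (2 * (1 - cmod w)) ^+ 3 by ring.
  have w2 : 0 <= 1 - cmod w by rewrite subr_ge0 ltW.
  rewrite lerXn2r ?nnegrE ?(ltW w0) ?mulr_ge0 //.
  have := cmod_ge0 w; nra.
rewrite -big_distrr -big_distrr /= ler_wpM2l ?exprn_ge0 //.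
by rewrite ler_pM2l.
Qed.

Lemma poincare_bounded phi p (M : R) : unif L p -> 0 <= M ->
  (forall w, cmod w < 1 -> cmod (phi w) <= M) ->
  sum_bounded (fun w => phi w * term p w) (M * (8 * C)).
Proof.
move=> up M0 hphi A uA.
have := @term_tail p 0 A up; rewrite lexx ler01 => /(_ isT uA (fun w _ _ => cmod_ge0 w)).
rewrite expr0n subr0 expr1n mul1r => h.
apply: le_trans (_ : \sum_(w <- A) M * cmod (term p w) <= _); last first.
  by rewrite -big_distrr /= ler_wpM2l.
apply: ler_sum => w _; rewrite cmodM.
have [->|/term_neq0[[w1 _ _] _]] := eqVneq (term p w) 0; first by rewrite cmod0 !mulr0.
by rewrite ler_wpM2r ?cmod_ge0 ?hphi.
Qed.

Lemma poincareP phi p (M : R) : unif L p -> (forall w, cmod w < 1 -> cmod (phi w) <= M) ->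
  issum (fun w => phi w * term p w) (poincare phi p).
Proof.
move=> up hphi.
have M0 : 0 <= M by apply: le_trans (cmod_ge0 _) (hphi 0 _); rewrite cmod0.
have [s hs] := issum_ex (poincare_bounded up M0 hphi).
have e : exists x, [set s | issum (fun w => phi w * term p w) s] x by exists s.
exact: (@xgetPex _ 0 _ e).
Qed.

Lemma term_rot p e w : unif L p -> cmod e = 1 ->
  term (fun z => p (e * z)) w = e ^+ k * term p (e * w).
Proof.
move=> up e1; have ew : cmod (e * w) = cmod w by rewrite cmodM e1 mul1r.
have sE : on_slice (fun z => p (e * z)) w <-> on_slice p (e * w).
  by rewrite /on_slice ew.
rewrite /term; case: asboolP => [/sE h|nh]; last first.
  by rewrite asboolF ?mulr0 // => /sE.
rewrite asboolT // ew; have [w1 hd _] := h; have [d hdw d0] := unif_der up w1 Lc hd.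
have w1' : cmod w < 1 by rewrite -ew.
have hd2 : cder (zc c \o (fun z => p (e * z))) w (d * (e * 1)).
  exact: cder_comp (cderZ e (cder_id w)) hdw.
have pe : phase e = e by rewrite /phase e1 divr1.
rewrite (phase_nder w1 hdw) (phase_nder w1' hd2) mulr1 phase_mul pe.
by rewrite !exprMn; ring.
Qed.

Lemma poincare_rot p e : unif L p -> cmod e = 1 ->
  poincare (fun=> 1) (fun z => p (e * z)) = e ^+ k * poincare (fun=> 1) p.
Proof.
move=> up e1; have e0 : e != 0 by rewrite -cmod_gt0 e1.
have c1 w : cmod w < 1 -> cmod (1 : R[i]) <= 1 by rewrite cmod1.
have h := issumZ (e ^+ k) (poincareP up c1).
apply: (issum_uniq (poincareP (unif_rot up e1) c1)).
apply: (issum_reindex (h := fun w => e * w) (h' := fun w => e^-1 * w)) h => w _ /=.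
  by rewrite mulVKf // !mul1r term_rot // mulVKf.
by rewrite mulKf // !mul1r term_rot.
Qed.

(** Covariance of the kernel under automorphisms of the disc: for p \o mob u, the kernel of [w] at 0
    is the kernel of [mob u w] for [p] at [u], times the k-th power of the derivative 1 - |u|^2 of
    [mob u] at 0. The phase absorbs the argument of the derivative of [mob u] at [w]. *)
Lemma term_mob p u w : unif L p -> cmod u < 1 -> cmod w < 1 ->
  term (p \o mob u) w = (1 - cmod u ^+ 2)%:C ^+ k / (1 - u * cj (mob u w)) ^+ (2 * k) * term p (mob u w).
Proof.
move=> up u1 w1; have mw1 := mob_lt1 u1 w1.
have sE : on_slice (p \o mob u) w <-> on_slice p (mob u w).
  by split => -[h1 h2 h3]; split.
rewrite /term; case: asboolP => [/sE h|nh]; last first.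
  by rewrite asboolF ?mulr0 // => /sE.
rewrite asboolT //; have [_ hd _] := h; have [d hdw d0] := unif_der up mw1 Lc hd.
have den := mob_den u1 (ltW w1).
have hd2 := cder_comp (cder_mob den) hdw.
rewrite (phase_nder mw1 hdw) (phase_nder w1 hd2) phase_mul /=.
set D := 1 + cj u * w in den *; pose D' : R[i] := 1 + u * cj w.
have D'E : cj D = D' by rewrite /D rmorphD rmorph1 rmorphM /= conjcK.
have DD : D * D' = (cmod D ^+ 2)%:C by rewrite -D'E mul_cj.
have U : 1 - u * cj u = (1 - cmod u ^+ 2)%:C by rewrite mul_cj rmorphB rmorph1.
have u0 := cmod_sq_gt0 u1; have w0 := cmod_sq_gt0 w1.
have Un0 : (1 - cmod u ^+ 2)%:C != 0 :> R[i] by rewrite -cmod_gt0 cmodC gtr0_norm.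
have D'0 : D' != 0 by rewrite -D'E -cmod_gt0 cmod_cj cmod_gt0.
have DD0 : (cmod D ^+ 2)%:C != 0 :> R[i] by rewrite -DD mulf_neq0.
have E1 : 1 - u * cj (mob u w) = (1 - cmod u ^+ 2)%:C / D'.
  rewrite /mob fmorph_div rmorphD /= -/D D'E -U /D'.
  by field.
have E2 : phase ((1 - u * cj u) / D ^+ 2) = D' / D.
  rewrite U phase_mul phase_pos // mul1r /phase cmodV cmodX fmorphV invrK.
  by rewrite /= -DD; field.
have E3 : (1 - cmod (mob u w) ^+ 2)%:C =
   (1 - cmod u ^+ 2)%:C * (1 - cmod w ^+ 2)%:C / (D * D').
  by rewrite (mob_norm u1 (ltW w1)) -/D fmorph_div rmorphM DD.
rewrite E1 E2 E3; set W := (1 - cmod w ^+ 2)%:C; set U' := (1 - cmod u ^+ 2)%:C in Un0 *.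
have -> : W * (phase d * (D' / D)) = U' / (U' / D') ^+ 2 * (U' * W / (D * D') * phase d).
  by field; rewrite D'0 den /=; move: Un0; rewrite /U' rmorphB rmorph1 rmorphXn.
by rewrite [in LHS]exprMn [(U' / _) ^+ k]exprMn exprVn -exprM mulrCA.
Qed.

(** Reindexing by [mob u] exhibits the series of the recentred uniformization as the form at the
    point [u]; the remaining sum depends on [u] only through the holomorphic kernel. *)
Lemma poincare_mob p u : unif L p -> cmod u < 1 ->
  poincare (fun=> 1) (p \o mob u) = (1 - cmod u ^+ 2)%:C ^+ k *
    poincare (fun w => 1 / (1 - u * cj w) ^+ (2 * k)) p.
Proof.
move=> up u1; have nu : cmod (- u) < 1 by rewrite cmodN.
have c1 w : cmod w < 1 -> cmod (1 : R[i]) <= 1 by rewrite cmod1.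
have c2 w : cmod w < 1 -> cmod (1 / (1 - u * cj w) ^+ (2 * k)) <= (1 - cmod u) ^- (2 * k).
  move=> w1; have h : 1 - cmod u <= cmod (1 - u * cj w).
    have := cmod_lerB 1 (u * cj w); rewrite cmod1 cmodM cmod_cj.
    have : cmod u * cmod w <= cmod u by rewrite ler_piMr ?cmod_ge0 // ltW.
    lra.
  have u0 : 0 < 1 - cmod u by rewrite subr_gt0.
  have h0 : 0 < cmod (1 - u * cj w) by exact: lt_le_trans u0 h.
  rewrite cmod_div cmod1 cmodX mul1r lef_pV2 ?posrE ?exprn_gt0 //.
  by rewrite lerXn2r ?nnegrE ?(ltW u0) ?cmod_ge0 // exprn_gt0.
have h := issumZ ((1 - cmod u ^+ 2)%:C ^+ k) (poincareP up c2).
apply: (issum_uniq (poincareP (unif_mob up u1) c1)).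
have t1 q w : term q w != 0 -> cmod w < 1 by move=> /term_neq0[[]].
apply: (issum_reindex (h := mob u) (h' := mob (- u))) h => w.
  move=> tw; have w1 : cmod w < 1.
    by apply: (t1 p); apply: contra tw => /eqP ->; rewrite !mulr0.
  have mw1 := mob_lt1 nu w1; rewrite mobKN // !mul1r term_mob // mobKN //; split => //; ring.
move=> tw; have w1 : cmod w < 1.
  by apply: (t1 (p \o mob u)); apply: contra tw => /eqP ->; rewrite !mulr0.
rewrite mobK // !mul1r term_mob //; split => //; ring.
Qed.

End Bounds.
End PoincareSeries.

Section FiniteSums.
Variable R : realType.

Lemma issum_finite (F : R[i] -> R[i]) (B : seq R[i]) : uniq B ->
  issum (fun w => if w \in B then F w else 0) (\sum_(w <- B) F w).
Proof.
move=> uB e e0; exists B => // A uA sA.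
have -> : \sum_(w <- A) (if w \in B then F w else 0) = \sum_(w <- B) F w.
  rewrite (sum_split _ uB uA sA) [X in _ + X]big1 ?addr0; last by move=> w /negPf ->.
  by rewrite big_seq [RHS]big_seq; apply: eq_bigr => w ->.
by rewrite subrr cmod0 ltW.
Qed.

Lemma near_all_seq (I : Type) (G : set_system I) {FG : Filter G} (J : eqType) (s : seq J)
  (P : J -> I -> Prop) : (forall j, j \in s -> \forall i \near G, P j i) ->
  \forall i \near G, forall j, j \in s -> P j i.
Proof.
elim: s => [|j s IH] h; first by apply: nearW => i j.
have h1 : \forall i \near G, forall j', j' \in s -> P j' i.
  by apply: IH => j' j's; apply: h; rewrite in_cons j's orbT.
apply: filterS2 (h j (mem_head _ _)) h1 => i hj hs j'; rewrite in_cons => /orP[/eqP -> //|].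
exact: hs.
Qed.

Lemma clim_sum_seq (I : Type) (G : set_system I) {UG : UltraFilter G} (J : eqType) (s : seq J)
  (f : J -> I -> R[i]) (l : J -> R[i]) : (forall j, j \in s -> clim G (f j) (l j)) ->
  clim G (fun i => \sum_(j <- s) f j i) (\sum_(j <- s) l j).
Proof.
elim: s => [|j s IH] h.
  by rewrite big_nil; apply: clim_near (clim_cst 0); apply: nearW => i; rewrite big_nil.
rewrite big_cons; apply: (@clim_near _ _ G UG (fun i => f j i + \sum_(j0 <- s) f j0 i)).
  by apply: nearW => i; rewrite big_cons.
apply: climD; first by apply: h; rewrite mem_head.
by apply: IH => j' j's; apply: h; rewrite in_cons j's orbT.
Qed.

(** The kernel at u conj(w) to first order; the constant is independent of [w], which permits
    summation over the slice. *)
Lemma geometric_expansion (k : nat) : exists2 C : R, 0 <= C & forall x : R[i], cmod x < 1 / 2 ->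
  cmod (1 / (1 - x) ^+ (2 * k) - 1 - (2 * k)%:R * x) <= C * cmod x ^+ 2.
Proof.
pose n := (2 * k)%N; pose M : R := (1 / 2) ^- n.
have X (m : nat) : cder (fun w : R[i] => (1 - w) ^+ m) 0 (- m%:R).
  elim: m => [|m IH]; first by rewrite oppr0; exact: cder_cst.
  have := cderM (cderB (cder_cst 1 0) (cder_id (0 : R[i]))) IH.
  rewrite (_ : _ + _ = - m.+1%:R); last by rewrite subr0 expr1n -natr1; ring.
  by apply: (@cder_near _ _ _ _ _ 1) => // w _; rewrite exprS.
have hz w : cmod (w - 0 : R[i]) <= 1 / 2 -> 1 / 2 <= cmod (1 - w).
  by rewrite subr0 => h; have := cmod_lerB 1 w; rewrite cmod1; lra.
have M0 : 0 <= M by rewrite invr_ge0 exprn_ge0.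
exists (8 * M / (1 / 2) ^+ 2); first by rewrite divr_ge0 ?exprn_ge0 ?mulr_ge0.
move=> x xr.
have d0 : (1 - 0 : R[i]) ^+ n != 0 by rewrite subr0 expr1n oner_neq0.
have hd : cder (fun w : R[i] => 1 / (1 - w) ^+ n) 0 n%:R.
  have := cderM (cder_cst 1 0) (@cderV R (fun w => (1 - w) ^+ n) 0 _ d0 (X n)).
  by rewrite opprK subr0 !expr1n !divr1 ?mul0r add0r mul1r.
have h0 : (0 : R) < 1 / 2 by rewrite divr_gt0.
have xr0 : cmod (x - 0) < 1 / 2 by rewrite subr0.
have H1 w : cmod (w - 0) <= 1 / 2 -> exists e, cder (fun w : R[i] => 1 / (1 - w) ^+ n) w e.
  move=> wr; have w0 : 1 - w != 0 by rewrite -cmod_gt0; apply: lt_le_trans h0 (hz w wr).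
  have [e he] := cderX n (cderB (cder_cst 1 w) (cder_id w)).
  by apply: (@cder_div _ (fun=> 1) (fun w => (1 - w) ^+ n) w _ _ (cder_cst 1 w) he); rewrite expf_neq0.
have H2 w : cmod (w - 0) <= 1 / 2 -> cmod (1 / (1 - w : R[i]) ^+ n) <= M.
  move=> /hz wr; have w0 : 0 < cmod (1 - w) by exact: lt_le_trans h0 wr.
  rewrite cmod_div cmod1 cmodX mul1r lef_pV2 ?posrE ?exprn_gt0 //.
  by rewrite lerXn2r ?nnegrE ?cmod_ge0 // ltW.
by have [_] := second_order h0 H1 H2 hd xr0; rewrite subr0 expr1n divr1 !subr0.
Qed.

End FiniteSums.

(** * Expansion of the series at the centre and its continuity in the uniformization *)

Section SeriesLimits.
Variables (R : realType) (X : topologicalType).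
Hypotheses (X_compact : compact [set: X]) (X_hausdorff : hausdorff_space X).
Variable L : lamination R X.
Hypothesis L_unif : forall x, exists2 p : R[i] -> X, unif L p & p 0 = x.
Variables (c : flow_box R X) (K : set X) (b : X -> R) (z1 : R[i]) (k : nat).
Hypotheses (Lc : L c) (cK : closed K) (Kc : K `<=` fb_dom c).
Hypotheses (b01 : forall x, 0 <= b x <= 1) (bK : forall x, b x != 0 -> K x).
Hypothesis b_cont : forall x, {for x, continuous b}.
Hypothesis z11 : cmod z1 < 1.
Variables (del C : R).
Hypotheses (del0 : 0 < del) (C0 : 0 < C).
Hypothesis pack : forall p z1, unif L p ->
  forall A, uniq A -> (forall w, w \in A -> [/\ cmod w < 1, K (p w) & zc c (p w) = z1]) ->
    separated_seq del A /\ \sum_(w <- A) (1 - cmod w) ^+ 3 <= C.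
Hypothesis k4 : (4 <= k)%N.
Implicit Types (p : R[i] -> X) (u w : R[i]) (phi : R[i] -> R[i]).

Let k3 : (3 <= k)%N. Proof. exact: ltnW. Qed.
Local Notation tm := (term c b z1 k).
Local Notation ps := (poincare c b z1 k).
Local Notation sl := (on_slice c z1).

Lemma poincare_expansion p : unif L p -> exists C1 : R, forall u, cmod u < 1 / 2 ->
  cmod (ps (fun w => 1 / (1 - u * cj w) ^+ (2 * k)) p -
     (ps (fun=> 1) p + u * ps (fun w => (2 * k)%:R * cj w) p)) <= C1 * cmod u ^+ 2.
Proof.
move=> up; have [C1 C10 hC1] := geometric_expansion R k.
exists (C1 * (8 * C)) => u ur.
have uw w : cmod w < 1 -> cmod (u * cj w) <= cmod u.
  by move=> w1; rewrite cmodM cmod_cj ler_piMr ?cmod_ge0 // ltW.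
have D w : cmod w < 1 -> cmod (1 / (1 - u * cj w) ^+ (2 * k) - 1 - (2 * k)%:R * (u * cj w)) <=
    C1 * cmod u ^+ 2.
  move=> w1; apply: le_trans (hC1 _ _) _; first exact: le_lt_trans (uw w w1) ur.
  by rewrite ler_wpM2l // lerXn2r ?nnegrE ?cmod_ge0 ?uw.
have B1 w : cmod w < 1 -> cmod (1 : R[i]) <= 1 by rewrite cmod1.
have B2 w : cmod w < 1 -> cmod ((2 * k)%:R * cj w) <= (2 * k)%:R.
  by move=> w1; rewrite cmodM cmod_nat cmod_cj ler_piMr ?ler0n // ltW.
have B3 w : cmod w < 1 -> cmod (1 / (1 - u * cj w) ^+ (2 * k)) <=
    C1 * cmod u ^+ 2 + (1 + (2 * k)%:R * cmod u).
  move=> w1; have := D w w1; set E := _ - 1 - _ => hE.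
  have -> : 1 / (1 - u * cj w) ^+ (2 * k) = E + (1 + (2 * k)%:R * (u * cj w)) by rewrite /E; ring.
  apply: le_trans (cmodD _ _) _; rewrite lerD //; apply: le_trans (cmodD _ _) _.
  by rewrite cmod1 lerD2l cmodM cmod_nat ler_wpM2l ?ler0n ?uw.
have S1 := poincareP z1 Lc b01 bK pack k3 up B1.
have S2 := issumZ u (poincareP z1 Lc b01 bK pack k3 up B2).
have S3 := poincareP z1 Lc b01 bK pack k3 up B3.
apply: (issum_dist S3 (issumD S1 S2)).
have M0 : 0 <= C1 * cmod u ^+ 2 by rewrite mulr_ge0 ?exprn_ge0 ?cmod_ge0.
have H := poincare_bounded z1 Lc b01 bK pack k3 up M0 D.
have -> : C1 * (8 * C) * cmod u ^+ 2 = C1 * cmod u ^+ 2 * (8 * C) by ring.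
move=> A uA; apply: le_trans _ (H A uA); apply: ler_sum => w _.
by rewrite le_eqVlt; apply/orP; left; apply/eqP; congr cmod; ring.
Qed.

(** Each lift of modulus at most r contributes at least (1 - r)^3 to the packing sum, so the number
    of such lifts is bounded for all uniformizations at once. *)
Lemma support_count (r : R) : r < 1 -> exists N : nat, forall p, unif L p -> forall A, uniq A ->
  (forall w, w \in A -> cmod w <= r /\ tm p w != 0) -> (size A <= N)%N.
Proof.
move=> r1; have q0 : 0 < (1 - r) ^+ 3 by rewrite exprn_gt0 // subr_gt0.
exists (Num.bound (C / (1 - r) ^+ 3)) => p up A uA hA.
have [|_ h] := pack up uA (z1 := z1).
  by move=> w /hA[_ /(term_neq0 bK)[[]]].
have : (size A)%:R * (1 - r) ^+ 3 <= C.
  apply: le_trans h; rewrite -sum1_size natr_sum mulr_suml big_seq [X in _ <= X]big_seq.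
  apply: ler_sum => w /hA[wr _]; rewrite mul1r lerXn2r ?nnegrE; lra.
rewrite -ler_pdivlMr // => h1; rewrite -(ler_nat R); apply: (le_trans h1).
by apply: ltW; apply: archi_boundP; rewrite divr_ge0 ?ltW.
Qed.

Lemma finite_support p (r : R) : unif L p -> r < 1 -> exists W : seq R[i], [/\ uniq W,
  forall w, w \in W -> cmod w <= r /\ tm p w != 0 &
  forall w, cmod w <= r -> tm p w != 0 -> w \in W].
Proof.
move=> up r1; have [N hN] := support_count r1; apply: contrapT => /forallNP no.
have [A [uA hA sA]] : exists A : seq R[i], [/\ uniq A,
    forall w, w \in A -> cmod w <= r /\ tm p w != 0 & size A = N.+1].
  elim: (N.+1) => [|n [A [uA hA sA]]]; first by exists [::].
  have [w [w1 w2 w3]] : exists w, [/\ cmod w <= r, tm p w != 0 & w \notin A].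
    apply: contrapT => /forallNP h; apply: (no A); split => // w w1 w2.
    by apply/negPn/negP => w3; apply: (h w).
  exists (w :: A); split; rewrite /= ?w3 ?sA // => v.
  by rewrite in_cons => /orP[/eqP ->|/hA].
by have := hN p up A uA hA; rewrite sA ltnn.
Qed.

Section Limit.
Variables (I : Type) (G : set_system I).
Context {UG : UltraFilter G}.
Variables (p : I -> R[i] -> X) (q : R[i] -> X).
Hypothesis up : \forall i \near G, unif L (p i).
Hypothesis pq : forall w, cmod w < 1 -> p ^~ w @ G --> q w.

Let uq : unif L q.
Proof. exact: (unif_lim X_compact X_hausdorff L_unif up pq). Qed.

Let mov w : cmod w < 1 -> moving_lim G p q w.
Proof. by move=> w1; have [] := unif_lim_local X_compact X_hausdorff L_unif up pq w1. Qed.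

Lemma clim_lt1 (y : I -> R[i]) w : cmod w < 1 -> clim G y w -> \forall i \near G, cmod (y i) < 1.
Proof.
move=> w1 hy; have r0 : 0 < 1 - cmod w by rewrite subr_gt0.
by apply: filterS (hy _ r0) => i h; have := cmod_dist (y i) w 0; rewrite !subr0; lra.
Qed.

(** Recentring at the moving points [y i] turns the claim into the convergence of derivatives at 0
    for the uniformizations p i \o mob (y i). *)
Lemma clim_nder (y : I -> R[i]) w : cmod w < 1 -> fb_dom c (q w) -> clim G y w ->
  clim G (fun i => nder c (p i) (y i)) (nder c q w).
Proof.
move=> w1 hd hy; have y1 := clim_lt1 w1 hy.
pose P i := p i \o mob (y i); pose Q := q \o mob w.
have uP : \forall i \near G, unif L (P i) by apply: filterS2 up y1 => i; exact: unif_mob.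
have PQ v : cmod v < 1 -> P ^~ v @ G --> Q v.
  move=> v1; apply: (mov (mob_lt1 w1 v1)).
  apply: climM; first by apply: climD hy; exact: clim_cst.
  apply: climV; first exact: (mob_den w1 (ltW v1)).
  apply: climD; first exact: clim_cst.
  by apply: climM; [exact: clim_cj|exact: clim_cst].
have c0 : cmod (0 : R[i]) < 1 by rewrite cmod0.
have hd0 : fb_dom c (Q 0) by rewrite /Q /= mob0.
have hD : \forall i \near G, cder (zc c \o P i) 0 (nder c (p i) (y i)).
  apply: filterS3 up y1 (lim_dom (mov w1 hy) hd) => i upi yi hdi.
  have hd' : fb_dom c ((p i \o mob (y i)) 0) by rewrite /= mob0.
  have [d hdy _] := unif_der (unif_mob upi yi) c0 Lc hd'.
  by rewrite /nder (derE hdy).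
have [d hdd hl] := unif_lim_der X_compact X_hausdorff L_unif uP PQ c0 Lc hd0 hD.
by rewrite /nder (derE hdd).
Qed.

Lemma clim_b (y : I -> R[i]) w : cmod w < 1 -> clim G y w ->
  clim G (fun i => (b (p i (y i)))%:C) (b (q w))%:C.
Proof.
move=> w1 hy e e0.
have hb : nbhs (q w) (b @^-1` ball (b (q w)) e) by apply: b_cont; exact: nbhsx_ballx.
have h : G [set i | ball (b (q w)) e (b (p i (y i)))] by exact: (mov w1 hy hb).
apply: filterS h => i; rewrite -ball_normE => h1; rewrite -rmorphB cmodC distrC.
exact: h1.
Qed.

Lemma clim_term (y : I -> R[i]) w : cmod w < 1 -> clim G y w -> sl q w ->
  (\forall i \near G, zc c (p i (y i)) = z1) -> clim G (fun i => tm (p i) (y i)) (tm q w).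
Proof.
move=> w1 hy hs hz; have [_ hd _] := hs.
have n0 := nder_neq0 Lc uq hs; have hn := clim_nder w1 hd hy.
have hc : clim G (fun i => (b (p i (y i)))%:C *
   ((1 - (cmod (y i))%:C ^+ 2) * phase (nder c (p i) (y i))) ^+ k) (tm q w).
  rewrite termE // rmorphB rmorph1 rmorphXn; apply: climM; first exact: clim_b.
  apply: climX; apply: climM.
    by apply: climB; [exact: clim_cst|apply: climX; exact: clim_cmodC].
  apply: climM => //; apply: climV; last exact: clim_cmodC.
  by rewrite -cmod_gt0 cmodC normr_gt0 cmod_eq0.
apply: clim_near hc; apply: filterS3 hz (clim_lt1 w1 hy) (lim_dom (mov w1 hy) hd) => i zi yi di.
by rewrite termE // rmorphB rmorph1 rmorphXn.
Qed.

(** The plaque through [p i w] lifts to the disc, and its point of coordinate [z1] is the wanted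
    slice point; by Schwarz-Pick it is close to [w], because the coordinate of [p i w] tends to
    [z1]. *)
Lemma slice_points w : sl q w -> exists2 y : I -> R[i], clim G y w &
  \forall i \near G, sl (p i) (y i).
Proof.
move=> [w1 hd hz].
have step i : exists psi, unif L (p i) -> fb_dom c (p i w) -> [/\ disc_map psi,
    psi (zc c (p i w)) = w & forall v, cmod v < 1 -> p i (psi v) = iv c v (tc c (p i w))].
  have [[h1 h2]|n] := pselect (unif L (p i) /\ fb_dom c (p i w)).
    by have [psi h] := h1.2 w c w1 Lc h2; exists psi.
  by exists id => h1 h2; case: n.
have [psi hpsi] := choice step.
pose proof (lim_dom (pq w1) hd) as hdi.
have hi : \forall i \near G, fb_dom c (p i w) /\ [/\ disc_map (psi i),
    psi i (zc c (p i w)) = w & forall v, cmod v < 1 -> p i (psi i v) = iv c v (tc c (p i w))].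
  by apply: filterS2 up hdi => i h1 h2; split => //; exact: hpsi.
pose proof (lim_zc (pq w1) hd) as hzl; rewrite hz in hzl.
have den : 1 + cj (- z1) * z1 != 0 by apply: mob_den; [rewrite cmodN|exact: ltW].
have hm : clim G (fun i => mob (- zc c (p i w)) z1) 0.
  rewrite -(mobNv z1); apply: climM; first by apply: climD; [exact: clim_cst|exact: climN].
  apply: climV => //; apply: climD; first exact: clim_cst.
  by apply: climM; [apply: clim_cj; exact: climN|exact: clim_cst].
exists (fun i => psi i z1).
  move=> e e0; have e2 : 0 < e / 2 by lra.
  apply: filterS2 hi (hm _ e2) => i [di [dpsi psi0 _]]; rewrite subr0 => hmi.
  have z01 := zc_lt1 di; have := schwarz_pick dpsi z01 z11; rewrite psi0 => sp.
  have [_ p1] := dpsi z1 z11.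
  by have [_ h] := mob_distE w1 p1; apply: (le_lt_trans h); lra.
apply: filterS hi => i [di [dpsi psi0 psiE]]; have [_ p1] := dpsi z1 z11.
by split => //; rewrite psiE //; [exact: iv_dom|exact: zc_iv].
Qed.

(** The finitely many terms of [q] within radius r are limits of terms of [p i], and the tails are
    uniformly small. New slice points of [p i] may appear within radius r, but their terms tend to
    0, and their number is bounded independently of the index. *)
Lemma poincare_lim phi (M : R) : (forall w, cmod w < 1 -> ccont phi w) ->
  (forall w, cmod w < 1 -> cmod (phi w) <= M) ->
  clim G (fun i => ps phi (p i)) (ps phi q).
Proof.
(* Four errors [eps] arise: the tail and the extra terms of [p i], the finite sums, and the tail of
   [q]. The fifth makes the inequality strict. *)
move=> cphi hphi e e0; pose eps := e / 5; have eps0 : 0 < eps by rewrite /eps; lra.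
have M0 : 0 <= M by apply: le_trans (cmod_ge0 _) (hphi 0 _); rewrite cmod0.
have MC0 : 0 < M * (8 * C) + 1 by rewrite ltr_wpDl // mulr_ge0 // mulr_ge0 // ltW.
pose t := Num.min 1 (eps / (M * (8 * C) + 1)).
have t0 : 0 < t by rewrite lt_min ltr01 divr_gt0.
have [t1 t2] : t <= 1 /\ t <= eps / (M * (8 * C) + 1) by rewrite /t !ge_min !lexx orbT.
(* Then 1 - r^2 <= t, and k >= 4 leaves at least one such factor in [term_tail]. *)
pose r := 1 - t / 2; have r01 : 0 <= r <= 1 by rewrite /r; apply/andP; split; lra.
have r1 : r < 1 by rewrite /r; lra.
have r2 : 0 <= 1 - r ^+ 2 <= t by rewrite /r; apply/andP; split; nra.
pose F p' w := phi w * tm p' w.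
have F0 p' w : tm p' w = 0 -> F p' w = 0 by rewrite /F => ->; rewrite mulr0.
have tail p' A : unif L p' -> uniq A -> (forall w, w \in A -> tm p' w != 0 -> r <= cmod w) ->
    \sum_(w <- A) cmod (F p' w) <= eps.
  move=> up' uA hA; have h := term_tail Lc b01 bK pack k3 up' r01 uA hA.
  apply: le_trans (_ : M * \sum_(w <- A) cmod (tm p' w) <= _).
    rewrite big_distrr /=; apply: ler_sum => w _; rewrite /F cmodM.
    have [->|/(term_neq0 bK)[[w1 _ _] _]] := eqVneq (tm p' w) 0; first by rewrite cmod0 !mulr0.
    by rewrite ler_wpM2r ?cmod_ge0 ?hphi.
  apply: le_trans (_ : M * (t * (8 * C)) <= _).
    rewrite ler_wpM2l //; apply: (le_trans h); rewrite ler_pM2r ?mulr_gt0 //.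
    have [h1 h2] := andP r2; apply: le_trans h2.
    have := k4; case: (k) => [|[|[|[|n]]]] // _; rewrite subSS subSS subSS subn0 exprS.
    by rewrite ler_piMr // exprn_ile1 //; lra.
  have : t * (M * (8 * C) + 1) <= eps by rewrite -ler_pdivlMr.
  lra.
have [N hN] := support_count r1.
have [W [uW hW sW]] := finite_support uq r1.
have step w : exists y : I -> R[i], w \in W ->
    clim G y w /\ \forall i \near G, sl (p i) (y i).
  have [wW|] := boolP (w \in W); last by exists (fun=> 0).
  have [_ /(term_neq0 bK)[hs _]] := hW w wW.
  by have [y hy1 hy2] := slice_points hs; exists y.
have [Y hY] := choice step.
have W1 w : w \in W -> cmod w < 1 by move=> /hW[? _]; lra.
have WT w : w \in W -> clim G (fun i => tm (p i) (Y w i)) (tm q w).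
  move=> wW; have [h1 h2] := hY w wW; have [_ /(term_neq0 bK)[hs _]] := hW w wW.
  by apply: clim_term => //; [exact: W1|apply: filterS h2 => i []].
have lim1 : clim G (fun i => \sum_(w <- W) F (p i) (Y w i)) (\sum_(w <- W) F q w).
  apply: clim_sum_seq => w wW; apply: climM; last exact: WT.
  by apply: clim_ccont; [exact: cphi (W1 w wW)|have [] := hY w wW].
have uY : \forall i \near G, uniq [seq Y w i | w <- W].
  have : \forall i \near G, forall w, w \in W -> forall w', w' \in W -> w != w' -> Y w i != Y w' i.
    apply: near_all_seq => w wW; apply: near_all_seq => w' w'W.
    have [<-|ww] := eqVneq w w'; first by apply: nearW => i; rewrite eqxx.
    have d0 : 0 < cmod (w - w') / 2 by rewrite divr_gt0 // cmod_gt0 subr_eq0.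
    have [h1 _] := hY w wW; have [h2 _] := hY w' w'W.
    apply: filterS2 (h1 _ d0) (h2 _ d0) => i k1 k2 _; apply/negP => /eqP E.
    rewrite E cmodBC in k1; have := cmod_dist w (Y w' i) w'; lra.
  apply: filterS => i h; rewrite map_inj_in_uniq // => w w' wW w'W E.
  by apply/eqP/negPn/negP => ww; have := h w wW w' w'W ww; rewrite E eqxx.
(* Extra slice points with terms that are not small would converge to a point of [W] where the bump
   function is positive; next to the slice point [Y w i] with the same limit this contradicts
   separation. *)
have nb : \forall i \near G, forall v, cmod v <= r -> tm (p i) v != 0 ->
    v \notin [seq Y w i | w <- W] -> cmod (F (p i) v) <= eps / N.+1%:R.
  apply: contrapT => /ultra_not h.
  have bad i : exists v, (exists v, [/\ cmod v <= r, tm (p i) v != 0,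
      v \notin [seq Y w i | w <- W] & eps / N.+1%:R < cmod (F (p i) v)]) ->
     [/\ cmod v <= r, tm (p i) v != 0,
      v \notin [seq Y w i | w <- W] & eps / N.+1%:R < cmod (F (p i) v)].
    have [[v hv]|] := pselect (exists v, [/\ cmod v <= r, tm (p i) v != 0,
      v \notin [seq Y w i | w <- W] & eps / N.+1%:R < cmod (F (p i) v)]); first by exists v.
    by exists 0.
  have [v hv] := choice bad.
  have {h}hv : \forall i \near G, [/\ cmod (v i) <= r, tm (p i) (v i) != 0,
      v i \notin [seq Y w i | w <- W] & eps / N.+1%:R < cmod (F (p i) (v i))].
    apply: filterS h => i h; apply: hv; apply: contrapT => /forallNP nh; apply: h => x x1 x2 x3.
    by rewrite leNgt; apply/negP => x4; apply: (nh x).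
  have [w hw] : exists w, clim G v w.
    by apply: (@clim_ex _ _ G UG _ r); apply: filterS hv => i [].
  have wr : cmod w <= r by apply: clim_le hw _; apply: filterS hv => i [].
  have w1 : cmod w < 1 by lra.
  have vs : \forall i \near G, sl (p i) (v i) /\ K (p i (v i)).
    by apply: filterS hv => i [_ /(term_neq0 bK)].
  have Kq : K (q w).
    by apply: (closed_lim cK _ (mov w1 hw)); apply: filterS vs => i [].
  pose proof (lim_zc (mov w1 hw) (Kc Kq)) as hz.
  have hs : sl q w.
    split => //; first exact: Kc; apply: (clim_uniq hz).
    by apply: clim_near (clim_cst z1); apply: filterS vs => i [[]].
  have tv : clim G (fun i => tm (p i) (v i)) (tm q w).
    by apply: clim_term => //; apply: filterS vs => i [[]].
  have Fv : clim G (fun i => F (p i) (v i)) (F q w).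
    by apply: climM => //; apply: clim_ccont hw; exact: cphi.
  have Fw : eps / N.+1%:R <= cmod (F q w).
    by apply: (clim_ge Fv); apply: filterS hv => i [_ _ _ /ltW].
  have tw : tm q w != 0.
    apply/negP => /eqP tw; move: Fw; rewrite (F0 _ _ tw) cmod0 leNgt.
    by rewrite divr_gt0 // ltr0n.
  have wW := sW w wr tw; have [y1 y2] := hY w wW.
  have bw : b (q w) != 0.
    by apply: contra tw => /eqP bw; rewrite termE // bw mul0r.
  have by0 : \forall i \near G, K (p i (Y w i)).
    have bp : 0 < b (q w) by rewrite lt_def bw; have [] := andP (b01 (q w)).
    apply: filterS (clim_b w1 y1 bp) => i h; apply: bK; apply/negP => /eqP E.
    by move: h; rewrite E -rmorphB cmodC sub0r normrN gtr0_norm // ltxx.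
  have d0 : 0 < del * (1 - r) / 2 by rewrite divr_gt0 // mulr_gt0 // subr_gt0.
  pose proof (filterI (filterI (filterI hv vs) (filterI y2 by0)) (filterI up (filterI (hw _ d0) (y1 _ d0)))) as all.
  have [i [[[[v1 v2 v3 _] [[vs1 vs2 vs3] vs4]] [[ys1 ys2 ys3] ys4]] [upi [k1 k2]]]] := ultra_ex all.
  have vy : v i != Y w i by apply: contra v3 => /eqP ->; apply/mapP; exists w.
  have uv : uniq [:: v i; Y w i] by rewrite /= inE vy.
  have [|[_ _ sep] _] := pack upi uv (z1 := z1).
    by move=> x; rewrite !inE => /orP[]/eqP ->.
  have := sep (v i) (Y w i); rewrite !inE !eqxx orbT => /(_ isT isT vy) h.
  have : del * (1 - r) <= del * (1 - cmod (v i)) by rewrite ler_pM2l //; lra.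
  have := cmod_dist (v i) w (Y w i); rewrite (cmodBC w); lra.
have fin p' (B : seq R[i]) (x : R) : unif L p' -> uniq B -> 0 <= x ->
    (forall v, cmod v <= r -> tm p' v != 0 -> v \notin B -> cmod (F p' v) <= x / N.+1%:R) ->
    cmod (ps phi p' - \sum_(w <- B) F p' w) <= x + eps.
  move=> up' uB x0 hB.
  apply: (issum_dist (poincareP z1 Lc b01 bK pack k3 up' hphi) (issum_finite (F p') uB)).
  move=> A uA; pose A1 := [seq w <- A | [&& cmod w <= r, tm p' w != 0 & w \notin B]].
  pose A2 := [seq w <- A | ~~ (cmod w <= r)].
  apply: le_trans (_ : \sum_(w <- A1) cmod (F p' w) + \sum_(w <- A2) cmod (F p' w) <= _).
    rewrite /A1 /A2 !big_filter big_mkcond [X in _ <= _ + X]big_mkcond /= [X in _ <= X + _]big_mkcond -big_split /=.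
    apply: ler_sum => w _; rewrite -/(F p' w).
    have c0 := cmod_ge0 (F p' w).
    case: (boolP (w \in B)) => wB.
      rewrite subrr cmod0 !andbF add0r; by case: ifP.
    rewrite subr0 !andbT; case: (leP (cmod w) r) => wr /=; last by rewrite add0r.
    by case: eqVneq => tw /=; rewrite ?addr0 // (F0 _ _ tw) cmod0.
  apply: lerD; last first.
    apply: tail => //; first exact: filter_uniq.
    by move=> w; rewrite mem_filter -ltNge => /andP[/ltW].
  have sA : (size A1 <= N)%N.
    apply: (hN p' up'); first exact: filter_uniq.
    by move=> w; rewrite mem_filter => /andP[/and3P[? ? _] _].
  apply: le_trans (_ : (size A1)%:R * (x / N.+1%:R) <= _).
    rewrite -sum1_size natr_sum mulr_suml big_seq [X in _ <= X]big_seq.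
    apply: ler_sum => w; rewrite mem_filter mul1r => /andP[/and3P[h1 h2 h3] _].
    exact: hB.
  have sR : (size A1)%:R <= N.+1%:R :> R by rewrite ler_nat; exact: leqW.
  have n0 : (0 : R) < N.+1%:R by rewrite ltr0n.
  rewrite mulrA ler_pdivrMr // mulrC ler_wpM2l //.
have q1 : cmod (ps phi q - \sum_(w <- W) F q w) <= 0 + eps.
  by apply: fin => // v v1 v2; rewrite (sW v v1 v2).
have e1 : 0 < eps by [].
apply: filterS3 (filterI up uY) nb (lim1 _ e1) => i [upi uYi] nbi li.
have p1 : cmod (ps phi (p i) - \sum_(w <- [seq Y w i | w <- W]) F (p i) w) <= eps + eps.
  by apply: fin => //; exact: ltW.
rewrite big_map in p1.
apply: le_lt_trans (cmod_dist _ (\sum_(w <- W) F (p i) (Y w i)) _) _.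
have h2 := cmod_dist (\sum_(w <- W) F (p i) (Y w i)) (\sum_(w <- W) F q w) (ps phi q).
have {}li : cmod (\sum_(w <- W) F (p i) (Y w i) - \sum_(w <- W) F q w) < eps by [].
rewrite cmodBC in q1.
have e5 : e = eps + eps + eps + (0 + eps) + eps by rewrite /eps; field.
rewrite e5; apply: le_lt_trans (lerD p1 h2) _.
apply: le_lt_trans (lerD (lexx _) (lerD (ltW li) q1)) _; rewrite !addrA ltrDl //.
Qed.

End Limit.
End SeriesLimits.

(** * Automorphic forms along the leaves *)

Lemma cder_of_expansion (R : realType) (h : R[i] -> R[i]) (a b : R[i]) (C : R) :
  (forall u, cmod u < 1 / 2 -> cmod (h u - (a + u * b)) <= C * cmod u ^+ 2) ->
  h 0 = a /\ cder h 0 b.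
Proof.
move=> H; have h0 : h 0 = a.
  apply/eqP; rewrite -subr_eq0 -cmod_eq0 eq_le cmod_ge0 andbT.
  have := H 0; rewrite cmod0 mul0r addr0 expr0n mulr0; apply; lra.
split=> //; apply/cderP => e e0.
have C0 : 0 < `|C| + 1 by rewrite ltr_wpDl.
exists (Num.min (1 / 2) (e / (`|C| + 1))); first by rewrite lt_min !divr_gt0.
move=> u; rewrite subr0 lt_min => /andP[u1 u2]; have := H u u1.
rewrite h0 (_ : h u - (a + u * b) = h u - a - b * u); last by ring.
move=> /le_trans; apply; rewrite expr2 mulrA ler_wpM2r ?cmod_ge0 //.
rewrite ltr_pdivlMr // in u2.
apply: le_trans (_ : `|C| * cmod u <= _); first by rewrite ler_wpM2r ?cmod_ge0 ?ler_norm.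
have := cmod_ge0 u; lra.
Qed.

Lemma bump (R : realType) (X : topologicalType) (X_compact : compact [set: X])
  (X_hausdorff : hausdorff_space X) (x : X) (U : set X) : nbhs x U ->
  exists (b : X -> R) (K : set X), [/\ (forall y, {for y, continuous b}),
    (forall y, 0 <= b y <= 1), b x = 1, closed K /\ K `<=` U & forall y, b y != 0 -> K y].
Proof.
move=> xU; have [K [xK cK KU]] := regular_nbhs X_compact X_hausdorff xU.
have nB : ~ (~` (K^°)) x by move=> /=; apply.
have cB : closed (~` (K^°)) by apply: open_closedC; exact: open_interior.
have sep := @normal_completely_regular R X (compact_normal X_hausdorff X_compact)
  (hausdorff_accessible X_hausdorff) x _ cB nB.
have [f [cf rf f0 f1]] := (@uniform_separatorP X R _ _).1 sep.
have f01 y : 0 <= f y <= 1 by have := rf (f y); rewrite /= in_itv /=; apply; exists y.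
exists (fun y => 1 - f y), K; split=> //.
- by move=> y; apply: continuousB; [exact: cst_continuous|exact: cf].
- by move=> y /=; have /andP[h1 h2] := f01 y; apply/andP; split; lra.
- by have -> : f x = 0 by [apply: f0; exists x]; rewrite subr0.
move=> y; apply: contraNP => nK; have -> : f y = 1; last by rewrite subrr.
by apply: f1; exists y => // /interior_subset.
Qed.

Section Forms.
Variables (R : realType) (X : topologicalType).
Hypotheses (X_compact : compact [set: X]) (X_hausdorff : hausdorff_space X).
Variable L : lamination R X.
Hypothesis L_unif : forall x, exists2 p : R[i] -> X, unif L p & p 0 = x.
Implicit Types (p q : R[i] -> X) (u w : R[i]) (A B : (R[i] -> X) -> R[i]).

(* A form of weight k on the leaf uniformized by p is f(z) dz^k; A p and B p
   stand for f(0) and f'(0). *)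
Definition autform (k : nat) A B :=
  [/\ forall p e, unif L p -> cmod e = 1 -> A (fun z => p (e * z)) = e ^+ k * A p,
      forall p, unif L p -> exists h, [/\ cder h 0 (B p), h 0 = A p &
        forall u, cmod u < 1 / 2 -> A (p \o mob u) = (1 - cmod u ^+ 2)%:C ^+ k * h u]
    & forall (I : Type) (G : set_system I) (UG : UltraFilter G) (p : I -> R[i] -> X) q,
        (\forall i \near G, unif L (p i)) -> (forall w, cmod w < 1 -> p ^~ w @ G --> q w) ->
        clim G (fun i => A (p i)) (A q) /\ clim G (fun i => B (p i)) (B q)].

Lemma autformM k k' A B A' B' : autform k A B -> autform k' A' B' ->
  autform (k + k') (fun p => A p * A' p) (fun p => B p * A' p + A p * B' p).
Proof.
move=> [r1 h1 l1] [r2 h2 l2]; split.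
- by move=> p e up e1; rewrite r1 // r2 // exprD; ring.
- move=> p up; have [h [dh h0 hE]] := h1 p up; have [h' [dh' h'0 hE']] := h2 p up.
  exists (fun u => h u * h' u); split.
  + by rewrite -h0 -h'0; exact: cderM.
  + by rewrite h0 h'0.
  + by move=> u u1; rewrite hE // hE' // exprD; ring.
- move=> I G UG p q up pq.
  have [a b] := l1 I G UG p q up pq; have [a' b'] := l2 I G UG p q up pq.
  by split; [exact: climM|apply: climD; exact: climM].
Qed.

Lemma autformD k A B A' B' : autform k A B -> autform k A' B' ->
  autform k (fun p => A p + A' p) (fun p => B p + B' p).
Proof.
move=> [r1 h1 l1] [r2 h2 l2]; split.
- by move=> p e up e1; rewrite r1 // r2 // -mulrDr.
- move=> p up; have [h [dh h0 hE]] := h1 p up; have [h' [dh' h'0 hE']] := h2 p up.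
  exists (fun u => h u + h' u); split.
  + exact: cderD.
  + by rewrite h0 h'0.
  + by move=> u u1; rewrite hE // hE' // -mulrDr.
- move=> I G UG p q up pq.
  have [a b] := l1 I G UG p q up pq; have [a' b'] := l2 I G UG p q up pq.
  by split; exact: climD.
Qed.

Lemma autform1 : autform 0 (fun=> 1) (fun=> 0).
Proof.
split.
- by move=> p e _ _; rewrite expr0 mul1r.
- by move=> p _; exists (fun=> 1); split => // [|u _]; [exact: cder_cst|rewrite expr0 mul1r].
- by move=> *; split; exact: clim_cst.
Qed.

Lemma autformX k A B n : autform k A B ->
  autform (n * k) (fun p => A p ^+ n) (fun p => n%:R * A p ^+ n.-1 * B p).
Proof.
move=> f; elim: n => [|n IH].
  have := autform1; congr autform; apply/funext => p; by rewrite !mul0r.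
have := autformM f IH; congr autform; apply/funext => p; first by rewrite exprS.
case: n {IH} => [|n] /=; first by rewrite !mul0r mulr0 addr0 expr0 mulr1 mul1r mul1r.
by rewrite -[n.+2]addn1 natrD exprS; ring.
Qed.

(** Uniformizations are total functions on the plane. That a form only sees their values on the disc
    follows from its continuity, applied to a constant family. *)
Lemma autform_ext k A B p q : autform k A B -> unif L p -> unif L q ->
  (forall w, cmod w < 1 -> p w = q w) -> A p = A q.
Proof.
move=> [_ _ l] up uq pq.
have [G [UG FG]] := @ultraFilterLemma _ \oo _.
have lim w : cmod w < 1 -> (fun=> p w) @ G --> q w by move=> /pq ->; exact: cvg_cst.
have [h _] := l nat G UG (fun=> p) q (nearW _ (fun=> up)) lim.
exact: (clim_uniq (clim_cst _) h).
Qed.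


Section Series.
Variables (c : flow_box R X) (K : set X) (b : X -> R).
Hypotheses (Lc : L c) (cK : closed K) (Kc : K `<=` fb_dom c).
Hypotheses (b01 : forall x, 0 <= b x <= 1) (bK : forall x, b x != 0 -> K x).
Variables (del C : R).
Hypothesis C0 : 0 < C.
Hypothesis pack : forall p z1, unif L p ->
  forall A : seq R[i], uniq A -> (forall w, w \in A -> [/\ cmod w < 1, K (p w) & zc c (p w) = z1]) ->
    separated_seq del A /\ \sum_(w <- A) (1 - cmod w) ^+ 3 <= C.

(** The derivative of the kernel 1 / (1 - u conj(w))^(2k) with respect to u at u = 0. *)
Definition first_order (k : nat) w : R[i] := (2 * k)%:R * cj w.

Lemma first_order_bound k w : cmod w < 1 -> cmod (first_order k w) <= (2 * k)%:R.
Proof. by move=> w1; rewrite cmodM cmod_nat cmod_cj ler_piMr // ltW. Qed.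

Lemma poincare_autform z1 k : (forall x, {for x, continuous b}) -> cmod z1 < 1 -> 0 < del ->
  (4 <= k)%N ->
  autform k (poincare c b z1 k (fun=> 1)) (poincare c b z1 k (first_order k)).
Proof.
move=> b_cont z11 del0 k4; have k3 : (3 <= k)%N by exact: ltnW.
split.
- by move=> p e up e1; exact: (poincare_rot z1 Lc b01 bK pack k3).
- move=> p up; have [C1 hC1] := poincare_expansion z1 Lc b01 bK pack k4 up.
  have [h0 dh] := cder_of_expansion hC1.
  exists (fun u => poincare c b z1 k (fun w => 1 / (1 - u * cj w) ^+ (2 * k)) p).
  split; [exact: dh|exact: h0|] => u u1; have {}u1 : cmod u < 1 by apply: (lt_trans u1); lra.
  exact: (poincare_mob z1 Lc b01 bK pack k3 up u1).
- move=> I G UG p q up pq; split.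
  + apply: (poincare_lim X_compact X_hausdorff L_unif Lc cK Kc b01 bK b_cont z11 del0 C0 pack k4 up pq (M := 1)).
      by move=> w _; exact: ccont_cst.
    by move=> w _; rewrite cmod1.
  apply: (poincare_lim X_compact X_hausdorff L_unif Lc cK Kc b01 bK b_cont z11 del0 C0 pack k4 up pq (M := (2 * k)%:R)).
    move=> w _ e e0; have n0 : 0 < (2 * k)%:R + 1 :> R by rewrite ltr_wpDl.
    exists (e / ((2 * k)%:R + 1)); first exact: divr_gt0.
    move=> v; rewrite ltr_pdivlMr // => hv; apply: le_lt_trans hv.
    by rewrite /first_order -mulrBr -rmorphB cmodM cmod_nat cmod_cj mulrC ler_wpM2l ?cmod_ge0 // lerDl.
  exact: first_order_bound.
Qed.

Lemma poincare_approx z1 k (phi : R[i] -> R[i]) p (M r : R) (W : seq R[i]) : (3 <= k)%N ->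
  unif L p -> 0 <= M -> (forall w, cmod w < 1 -> cmod (phi w) <= M) -> uniq W -> 0 <= r <= 1 ->
  (forall w, w \notin W -> term c b z1 k p w != 0 -> r <= cmod w) ->
  cmod (poincare c b z1 k phi p - \sum_(w <- W) phi w * term c b z1 k p w) <=
    M * ((1 - r ^+ 2) ^+ (k - 3) * (8 * C)).
Proof.
move=> k3 up M0 hphi uW r01 hW; set F := fun w => phi w * term c b z1 k p w.
apply: (issum_dist (poincareP z1 Lc b01 bK pack k3 up hphi) (issum_finite F uW)) => A uA.
pose A1 := [seq w <- A | w \notin W].
apply: le_trans (_ : M * \sum_(w <- A1) cmod (term c b z1 k p w) <= _); last first.
  rewrite ler_wpM2l //; apply: (term_tail Lc b01 bK pack k3 up r01); first exact: filter_uniq.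
  by move=> w; rewrite mem_filter => /andP[wW _]; exact: hW.
rewrite big_distrr /= /A1 big_filter [X in _ <= X]big_mkcond /=.
apply: ler_sum => w _; case: ifPn => /= [wW|wW]; first by rewrite subrr cmod0.
rewrite subr0 cmodM; have [->|/(term_neq0 bK)[[w1 _ _] _]] := eqVneq (term c b z1 k p w) 0.
  by rewrite cmod0 !mulr0.
by rewrite ler_wpM2r ?cmod_ge0 ?hphi.
Qed.

End Series.

Lemma geometric_small (a M e : R) : 0 <= a < 1 -> 0 < e ->
  exists n0, forall n, (n0 <= n)%N -> a ^+ n * M <= e.
Proof.
move=> /andP[a0 a1] e0; have M0 : 0 < `|M| + 1 by rewrite ltr_wpDl.
have a1' : `|a| < 1 by rewrite ger0_norm.
have [n0 _ hn0] := (@cvgr0Pnorm_lt R R^o nat \oo _ _).1 (cvg_expr a1') _ (divr_gt0 e0 M0).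
exists n0 => n /hn0 /=; rewrite normrX (ger0_norm a0) ltr_pdivlMr // => h.
apply: le_trans (ltW h); rewrite ler_wpM2l ?exprn_ge0 //.
by have := ler_norm M; lra.
Qed.

(** [T0] and [T1] are the dominant terms, at the lifts 0 and w1 of two slices, [e] is the
    first-order weight at w1, and [m] stands for 2k. Since the first-order weight vanishes at 0, [B]
    is small and the Wronskian is close to T0 e T1. *)
Lemma wronskian_estimate (T0 T1 e A A' B B' : R[i]) (tau s m : R) : cmod T0 = 1 ->
  0 <= tau <= 1 / 4 -> 0 < m -> cmod (A - T0) <= tau -> cmod B <= m * tau ->
  cmod (A' - T1) <= tau -> cmod (B' - e * T1) <= m * tau -> cmod e = m * s -> cmod T1 <= 1 ->
  4 * tau < s * cmod T1 -> A * B' - B * A' != 0.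
Proof.
move=> t0 /andP[tau0 tau4] m0 hA hB hA' hB' he t1 ht.
apply/negP => /eqP/subr0_eq/(congr1 (@cmod R)); rewrite !cmodM.
have {}hA : 3 / 4 <= cmod A by have := cmod_lerB T0 A; rewrite cmodBC t0; lra.
have {}hA' : cmod A' <= 5 / 4 by have := cmod_lerB A' T1; lra.
have {}hB' : m * (s * cmod T1 - tau) <= cmod B'.
  have := cmod_lerB (e * T1) B'; rewrite cmodBC cmodM he; lra.
have h1 : cmod B * cmod A' <= m * tau * (5 / 4).
  by apply: ler_pM => //; exact: cmod_ge0.
have h2 : 3 / 4 * (m * (s * cmod T1 - tau)) <= cmod A * cmod B'.
  by apply: ler_pM => //; apply: mulr_ge0; [exact: ltW|lra].
have h3 : m * (4 * tau) < m * (s * cmod T1) by rewrite ltr_pM2l.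
have h4 : 0 <= m * tau by apply: mulr_ge0 => //; exact: ltW.
lra.
Qed.

(** The two forms are the Poincare series of the slices through [p 0] and through a nearby point
    [p w1] of its plaque, with the same bump function. *)
Lemma slice_forms p q : unif L p -> unif L q -> p 0 <> q 0 -> exists k0, forall k, (k0 <= k)%N ->
  exists A B A' B', [/\ autform k A B, autform k A' B', 3 / 4 <= cmod (A p), cmod (A q) <= 1 / 4
    & A p * B' p - B p * A' p != 0].
Proof.
move=> up uq pq; have [c Lc hd] := lam_cover L (p 0).
have lp0 : lhol L p 0 by apply up.1; rewrite cmod0.
have lq0 : lhol L q 0 by apply uq.1; rewrite cmod0.
have oq : open (~` [set q 0]).
  by apply: closed_openC; apply: accessible_closed_set1; exact: hausdorff_accessible.
(* The support of the bump function avoids a neighbourhood of [q 0], which is what makes the first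
   form small at [q]. *)
have nU : nbhs (p 0) (fb_dom c `&` ~` [set q 0]).
  by apply: filterI; [exact: nbhs_dom|exact: open_nbhs_nbhs].
have [b [K [bc b01 bp0 [cK KU] bK]]] := @bump R X X_compact X_hausdorff _ _ nU.
have Kc : K `<=` fb_dom c by move=> y /KU[].
have [del [C [/andP[del0 del1] C0 pack]]] := slice_packing X_compact X_hausdorff L_unif Lc cK Kc.
have nb : nbhs (p 0) (fb_dom c `&` [set y | 1 / 2 < b y]).
  apply: filterI; first exact: nbhs_dom.
  have h : nbhs (b (p 0)) [set t : R | 1 / 2 < t] by rewrite bp0; apply: lt_nbhsr; lra.
  exact: (bc (p 0) _ h).
have [r0 r00 hr0] := lhol_nbhs lp0 nb.
(* The bound [s < r0] keeps the bump function above 1/2 at the second point; [s < del / 8] makes its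
   lift closer to 0 than every other contributing lift of its slice. *)
pose s : R := Num.min r0 (del / 8) / 2.
have m0 : 0 < Num.min r0 (del / 8) by rewrite lt_min r00 divr_gt0.
have s0 : 0 < s by rewrite divr_gt0.
have [sr sd] : s < r0 /\ s < del / 8.
  have h1 : Num.min r0 (del / 8) <= r0 by rewrite ge_min lexx.
  have h2 : Num.min r0 (del / 8) <= del / 8 by rewrite ge_min lexx orbT.
  by rewrite /s; split; lra.
pose w1 : R[i] := s%:C; have cw1 : cmod w1 = s by rewrite cmodC gtr0_norm.
have [dw1 bw1] : fb_dom c (p w1) /\ 1 / 2 < b (p w1) by apply: hr0; rewrite subr0 cw1.
have s1 : s < 1 by lra.
have nK : nbhs (q 0) (~` K).
  by apply: open_nbhs_nbhs; split; [exact: closed_openC|move=> /KU[_]; apply].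
have [r1 r10 hr1] := lhol_nbhs lq0 nK.
pose rq := Num.min r1 1; have rq0 : 0 < rq by rewrite lt_min r10 ltr01.
have [rq1 rqr] : rq <= 1 /\ rq <= r1 by rewrite !ge_min !lexx orbT.
(* The term at [w1] has size at least [d ^+ k] / 2, and the rest of its series at most a constant
   times [a ^+ (k - 3)]. As [a < d], the former prevails for large k. *)
pose d := 1 - s ^+ 2; pose a := 1 - (del / 4) ^+ 2.
have d0 : 0 < d by rewrite /d; nra.
have a0 : 0 <= a by rewrite /a; nra.
have ad : a < d by rewrite /a /d; nra.
have d1 : d <= 1 by rewrite /d; nra.
have ad01 : 0 <= a / d < 1 by rewrite divr_ge0 ?ltr_pdivrMr ?mul1r // ltW.
have e1 : 0 < s * d ^+ 3 / 4 by apply: divr_gt0 => //; apply: mulr_gt0 => //; exact: exprn_gt0.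
have [n1 hn1] := geometric_small (32 * C) ad01 e1.
have a01 : 0 <= a < 1 by rewrite a0 (lt_le_trans ad).
have e4 : 0 < 1 / 4 :> R by rewrite divr_gt0.
have [n2 hn2] := geometric_small (8 * C) a01 e4.
have rq01 : 0 <= 1 - rq ^+ 2 < 1 by apply/andP; split; nra.
have [n3 hn3] := geometric_small (8 * C) rq01 e4.
exists (n1 + n2 + n3 + 4)%N => k hk.
have k4 : (4 <= k)%N by apply: leq_trans hk; rewrite leq_addl.
have k3 : (3 <= k)%N by exact: ltnW.
have {}hk : (n1 + n2 + n3 <= k - 3)%N.
  by rewrite leq_subRL // addnC; apply: leq_trans hk; rewrite leq_add2l.
have k1 : (n1 <= k - 3)%N by apply: leq_trans hk; rewrite -addnA leq_addr.
have k2 : (n2 <= k - 3)%N by apply: leq_trans hk; rewrite addnAC leq_addl.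
have k3' : (n3 <= k - 3)%N by apply: leq_trans hk; rewrite leq_addl.
pose tau := a ^+ (k - 3) * (8 * C).
have tau0 : 0 <= tau by rewrite mulr_ge0 ?exprn_ge0 // mulr_ge0 // ltW.
have tau4 : tau <= 1 / 4 by exact: hn2.
have taud : 4 * tau <= s * d ^+ k / 4.
  have := hn1 _ k1; rewrite expr_div_n mulrAC ler_pdivrMr ?exprn_gt0 //.
  rewrite (_ : _ / 4 * _ = s * d ^+ (3 + (k - 3)) / 4); last by rewrite exprD; ring.
  by rewrite subnKC // /tau; apply: le_trans; rewrite le_eqVlt; apply/orP; left; apply/eqP; ring.
have del4 : 0 <= del / 4 <= 1 by apply/andP; split; lra.
(* A contributing lift other than [v] has distance at least del (1 - |v|) from [v], hence modulus at
   least del / 4. *)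
have apx v phi (M : R) : cmod v <= del / 8 -> K (p v) -> 0 <= M ->
    (forall w, cmod w < 1 -> cmod (phi w) <= M) ->
    cmod (poincare c b (zc c (p v)) k phi p - phi v * term c b (zc c (p v)) k p v) <= M * tau.
  move=> vd Kv M0 hphi.
  have := @poincare_approx c K b Lc b01 bK del C pack (zc c (p v)) k phi p M (del / 4) [:: v] k3 up M0 hphi isT del4.
  rewrite big_seq1; apply=> w; rewrite inE => wv /(term_neq0 bK)[[hw1 _ hw2] hw3].
  have uvw : uniq [:: v; w] by rewrite /= inE eq_sym wv.
  have [|[_ _ sep] _] := pack p (zc c (p v)) up _ uvw.
    by move=> y; rewrite !inE => /orP[]/eqP ->; split => //; lra.
  have := sep v w; rewrite !inE !eqxx orbT eq_sym wv => /(_ isT isT isT) h.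
  have h2 := cmodB v w; nra.
have Kp0 : K (p 0) by apply: bK; rewrite bp0 oner_neq0.
have Kw1 : K (p w1) by apply: bK; apply/negP => /eqP E; move: bw1; rewrite E; lra.
have z01 := zc_lt1 hd; have z11 := zc_lt1 dw1.
have D8 : cmod 0 <= del / 8 by rewrite cmod0; lra.
have D8' : cmod w1 <= del / 8 by rewrite cw1 ltW.
pose z0 := zc c (p 0); pose z1 := zc c (p w1).
exists (poincare c b z0 k (fun=> 1)), (poincare c b z0 k (first_order k)).
exists (poincare c b z1 k (fun=> 1)), (poincare c b z1 k (first_order k)).
have one w : cmod w < 1 -> cmod (1 : R[i]) <= 1 :> R by rewrite cmod1.
have fo := @first_order_bound k.
have k20 : 0 < (2 * k)%:R :> R by rewrite ltr0n muln_gt0 /=; apply: leq_trans k4.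
have A0 := apx 0 _ _ D8 Kp0 ler01 one.
have B0 := apx 0 _ _ D8 Kp0 (ltW k20) fo.
have A1 := apx w1 _ _ D8' Kw1 ler01 one.
have B1 := apx w1 _ _ D8' Kw1 (ltW k20) fo.
have t0 : cmod (term c b z0 k p 0) = 1.
  rewrite (cmod_term k Lc b01 up); last by split => //; rewrite cmod0.
  by rewrite bp0 cmod0 expr0n subr0 expr1n mulr1.
have t1 : cmod (term c b z1 k p w1) = b (p w1) * d ^+ k.
  by rewrite (cmod_term k Lc b01 up) ?cw1 //; split => //; rewrite cw1.
have A3 : 1 - tau <= cmod (poincare c b z0 k (fun=> 1) p).
  rewrite !mul1r -/z0 in A0; move: A0; rewrite cmodBC => A0.
  have := cmod_lerB (term c b z0 k p 0) (poincare c b z0 k (fun=> 1) p); rewrite t0 => h.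
  by rewrite lerBlDl -lerBlDr; exact: le_trans h A0.
split.
- exact: (poincare_autform Lc cK Kc b01 bK C0 pack).
- exact: (poincare_autform Lc cK Kc b01 bK C0 pack).
- by apply: le_trans A3; clear -tau4; lra.
(* No lift of modulus less than [rq] contributes at [q]: the whole series is a tail. *)
- have rqq : 0 <= rq <= 1 by rewrite ltW.
  have := @poincare_approx c K b Lc b01 bK del C pack z0 k (fun=> 1) q 1 rq [::] k3 uq ler01 one isT rqq.
  rewrite big_nil subr0 mul1r => h; apply: le_trans (h _) (hn3 _ k3').
  move=> w _ /(term_neq0 bK)[_ Kw]; rewrite leNgt; apply/negP => wr.
  by apply: (hr1 w) Kw; rewrite subr0; exact: lt_le_trans rqr.
rewrite -/z0 -/z1 in A0 B0 A1 B1; rewrite !mul1r in A0 A1.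
have fo0 : first_order k 0 = 0 by apply/eqP; rewrite -cmod_eq0 cmodM cmod_cj cmod0 mulr0.
rewrite fo0 mul0r subr0 in B0.
have dk : 0 < d ^+ k by exact: exprn_gt0.
apply: (wronskian_estimate t0 _ k20 A0 B0 A1 B1).
- by rewrite tau0 tau4.
- by rewrite cmodM cmod_nat cmod_cj cw1.
- rewrite t1; have /andP[h1 h2] := b01 (p w1); apply: mulr_ile1 => //; first exact: ltW.
  by apply: exprn_ile1 => //; exact: ltW.
rewrite t1; apply: le_lt_trans taud _; rewrite -mulrA ltr_pM2l //.
have : 1 / 2 * d ^+ k < b (p w1) * d ^+ k by rewrite ltr_pM2r.
lra.
Qed.

End Forms.

(** * Finitely many forms that separate points and directions *)

Lemma ultra_nbhs (X : topologicalType) (x : X) (Q : set X) :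
  (forall G : set_system X, UltraFilter G -> G --> x -> G Q) -> nbhs x Q.
Proof.
move=> h; apply: contrapT => nQ.
have FW : ProperFilter (within (~` Q) (nbhs x)).
  split; last exact: within_filter.
  by rewrite /within /= => hx; apply: nQ; apply: filterS hx => y /= hy; apply: contrapT => /hy.
have [G [UG WG]] := ultraFilterLemma FW.
have Gx : G --> x by move=> A hA; apply: WG; exact: filterS hA.
have nG : G (~` Q) by apply: WG; rewrite /within /=; apply: nearW.
have [y []] := filter_ex (filterI nG (h G UG Gx)); exact.
Qed.

Section Separation.
Variables (R : realType) (X : topologicalType).
Hypotheses (X_compact : compact [set: X]) (X_hausdorff : hausdorff_space X).
Variable L : lamination R X.
Variable P : X -> R[i] -> X.
Hypotheses (P_unif : forall x, unif L (P x)) (P0 : forall x, P x 0 = x).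
Implicit Types (x y : X) (p q : R[i] -> X) (A B : (R[i] -> X) -> R[i]).

Let L_unif x : exists2 p : R[i] -> X, unif L p & p 0 = x.
Proof. by exists (P x). Qed.

(** The rotation rule differentiated at the centre; the chain rule supplies one more factor [e]. *)
Lemma autform_rot_der k A B p e : autform L k A B -> unif L p -> cmod e = 1 ->
  B (fun z => p (e * z)) = e ^+ k.+1 * B p.
Proof.
move=> [rot exps _] up e1; have [h [dh _ hE]] := exps p up.
have [h' [dh' _ hE']] := exps _ (unif_rot up e1).
have de : cder (fun u => e ^+ k * h (e * u)) 0 (e ^+ k * (B p * (e * 1))).
  apply: cderZ; apply: (@cder_comp _ h (fun u => e * u)); first exact: cderZ (cder_id 0).
  by rewrite mulr0.
rewrite exprSr mulr1 in de *; rewrite -mulrA [e * _]mulrC; apply: cder_uniq dh' _.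
have half : 0 < 1 / 2 :> R by rewrite divr_gt0.
apply: cder_near half _ de => u; rewrite subr0 => u1.
have ue : cmod (e * u) < 1 / 2 by rewrite cmodM e1 mul1r.
have u1' : 0 < 1 - cmod u ^+ 2 by apply: cmod_sq_gt0; lra.
apply: (@mulfI _ ((1 - cmod u ^+ 2)%:C ^+ k)).
  by rewrite expf_neq0 // -cmod_gt0 cmodC gtr0_norm.
rewrite -hE' // mulrCA; have -> : cmod u = cmod (e * u) by rewrite cmodM e1 mul1r.
have eue : cmod (e * u) < 1 by lra.
rewrite -hE // -(rot _ _ (unif_mob up eue) e1); congr A; apply/funext => z /=.
have -> // : e * mob u z = mob (e * u) (e * z).
have ee : cj (e * u) * (e * z) = cj u * z.
  by rewrite rmorphM mulrACA [cj e * e]mulrC mul_cj e1 expr1n mul1r.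
by rewrite /mob ee -mulrDr mulrA.
Qed.

(** The uniformizations [P y] are chosen arbitrarily and need not depend continuously on [y]. Along
    an ultrafilter converging to [x] they have a limit, which is [P x] up to a rotation; the same
    [e] serves for all forms, so that it cancels in ratios and does not affect zeros. *)
Lemma form_lim x (G : set_system X) : UltraFilter G -> G --> x ->
  exists2 e : R[i], cmod e = 1 & forall k A B, autform L k A B ->
    clim G (fun y => A (P y)) (e ^+ k * A (P x)) /\
    clim G (fun y => B (P y)) (e ^+ k.+1 * B (P x)).
Proof.
move=> UG Gx; have [q hq] := xlim_ex X_compact P (G := G).
have up : \forall y \near G, unif L (P y) by exact: nearW.
have pq w : cmod w < 1 -> P ^~ w @ G --> q w by move=> _; exact: hq.
have uq : unif L q by exact: (unif_lim X_compact X_hausdorff L_unif up pq).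
have q0 : P x 0 = q 0.
  have h : P ^~ 0 @ G --> P x 0.
    have E : P ^~ 0 = id by apply/funext => y; exact: P0.
    by rewrite E P0; exact: Gx.
  exact: (xlim_uniq X_hausdorff h (hq 0)).
have [e e1 qe] := unif_rotation (P_unif x) uq q0; exists e => // k A B f.
have [rot _ lim] := f.
have pq' w : cmod w < 1 -> P ^~ w @ G --> P x (e * w) by move=> w1; rewrite -qe //; exact: hq.
have [h1 h2] := lim X G UG P (fun z => P x (e * z)) up pq'.
by rewrite -rot // -(autform_rot_der f).
Qed.

(** The numerator of the derivative of A' / A, the quotient of two forms of equal weight. *)
Definition wronskian A B A' B' p : R[i] := A p * B' p - B p * A' p.

(** That [s.1] does not vanish is included because the common weight is reached by multiplying with
    powers of it. *)
Definition local_pair (s : ((R[i] -> X) -> R[i]) * ((R[i] -> X) -> R[i]))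
  (s' : ((R[i] -> X) -> R[i]) * ((R[i] -> X) -> R[i])) x :=
  s.1 (P x) * wronskian s.1 s.2 s'.1 s'.2 (P x) != 0.

Lemma local_pair_near k s s' x : autform L k s.1 s.2 -> autform L k s'.1 s'.2 ->
  local_pair s s' x -> \forall y \near x, local_pair s s' y.
Proof.
move=> f f' h; apply: ultra_nbhs => G UG Gx; have [e e1 he] := form_lim UG Gx.
have [a b] := he _ _ _ f; have [a' b'] := he _ _ _ f'.
pose proof (climM a (climB (climM a b') (climM b a'))) as lim.
have e0 : e != 0 by rewrite -cmod_gt0 e1.
set l := (X in clim _ _ X) in lim.
have l0 : 0 < cmod l.
  rewrite cmod_gt0 /l (_ : _ * _ = e ^+ (k + k + k.+1) * (s.1 (P x) * wronskian s.1 s.2 s'.1 s'.2 (P x))).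
    by rewrite mulf_neq0 ?expf_neq0.
  by rewrite !exprD /wronskian; ring.
have := lim _ l0; apply: filterS => y /= hy; apply/negP => /eqP E.
by move: hy; rewrite -/(wronskian s.1 s.2 s'.1 s'.2 (P y)) E sub0r cmodN ltxx.
Qed.

Local Notation form := ((R[i] -> X) -> R[i]).

Definition pair_data (D : nat * ((form * form) * (form * form))) :=
  [/\ (0 < D.1)%N, autform L D.1 D.2.1.1 D.2.1.2 & autform L D.1 D.2.2.1 D.2.2.2].

Lemma local_pair_ex x y : x <> y -> exists D, pair_data D /\ local_pair D.2.1 D.2.2 x.
Proof.
move=> xy; have xy' : P x 0 <> P y 0 by rewrite !P0.
have [k hk] := slice_forms X_compact X_hausdorff L_unif (P_unif x) (P_unif y) xy'.
have [A [B [A' [B' [f f' hA _ W]]]]] := hk k.+1 (leqnSn k).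
exists (k.+1, ((A, B), (A', B'))); split; first by split.
by rewrite /local_pair mulf_neq0 // -cmod_gt0 /=; lra.
Qed.

Definition separates_points (A A' : form) x y := A (P x) * A' (P y) - A (P y) * A' (P x) != 0.

(** [A] is large at [x] and small at [y], and [A'] conversely. The pair is (A + A', A), since its
    first member must not vanish at either point if separation is to survive the passage to powers;
    the determinant is at least 9/16 - 1/16 in modulus. *)
Lemma separating_ex x y : x <> y -> exists D, [/\ pair_data D,
  D.2.1.1 (P x) != 0, D.2.1.1 (P y) != 0 & separates_points D.2.1.1 D.2.2.1 x y].
Proof.
move=> xy; have xy' : P x 0 <> P y 0 by rewrite !P0.
have yx' : P y 0 <> P x 0 by rewrite !P0 => /esym.
have [k hk] := slice_forms X_compact X_hausdorff L_unif (P_unif x) (P_unif y) xy'.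
have [k' hk'] := slice_forms X_compact X_hausdorff L_unif (P_unif y) (P_unif x) yx'.
have [|A [B [_ [_ [f _ hx hy _]]]]] := hk (k + k').+1; first by rewrite leqW ?leq_addr.
have [|A' [B' [_ [_ [f' _ hy' hx' _]]]]] := hk' (k + k').+1; first by rewrite leqW ?leq_addl.
exists ((k + k').+1, ((fun p => A p + A' p, fun p => B p + B' p), (A, B))); split => /=.
- by split => //; exact: autformD.
- by rewrite -cmod_gt0; have := cmod_lerB (A (P x)) (- A' (P x)); rewrite opprK cmodN; lra.
- by rewrite -cmod_gt0; have := cmod_lerB (A' (P y)) (- A (P y)); rewrite opprK cmodN [A' _ + _]addrC; lra.
rewrite /separates_points (_ : _ - _ = A' (P x) * A (P y) - A (P x) * A' (P y)); last by ring.
rewrite subr_eq0; apply/negP => /eqP/(congr1 (@cmod R)); rewrite !cmodM => E.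
have h1 : cmod (A' (P x)) * cmod (A (P y)) <= 1 / 4 * (1 / 4) by apply: ler_pM; rewrite ?cmod_ge0.
have h2 : 3 / 4 * (3 / 4) <= cmod (A (P x)) * cmod (A' (P y)) by apply: ler_pM.
clear -E h1 h2; lra.
Qed.

(* Replacing (A, A') by (A^m, A^(m-1) A') multiplies the weight by m and leaves
   the quotient A'/A unchanged; this gives finitely many pairs a common weight. *)
Lemma pair_power D (K : nat) : pair_data D -> (0 < K)%N -> (D.1 %| K)%N -> exists t : (form * form) * (form * form),
  [/\ autform L K t.1.1 t.1.2, autform L K t.2.1 t.2.2,
    forall x, local_pair D.2.1 D.2.2 x -> wronskian t.1.1 t.1.2 t.2.1 t.2.2 (P x) != 0
  & forall x y, D.2.1.1 (P x) != 0 -> D.2.1.1 (P y) != 0 ->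
    separates_points D.2.1.1 D.2.2.1 x y -> separates_points t.1.1 t.2.1 x y].
Proof.
case: D => k [[A B] [A' B']] [/= k0 f f'] K0 /dvdnP[m mK].
have : (0 < m)%N by move: K0; rewrite mK; case: (m).
case: m mK => // m -> _; have fm := autformX m f.
exists ((fun p => A p ^+ m.+1, fun p => m.+1%:R * A p ^+ m * B p),
  (fun p => A p ^+ m * A' p, fun p => m%:R * A p ^+ m.-1 * B p * A' p + A p ^+ m * B' p)).
split => /=.
- exact: (autformX m.+1 f).
- by rewrite mulSn addnC; exact: (autformM fm f').
- move=> x; rewrite /local_pair /wronskian /= mulf_eq0 negb_or => /andP[a0 W].
  rewrite (_ : _ - _ = A (P x) ^+ (m + m) * (A (P x) * B' (P x) - B (P x) * A' (P x))).
    by rewrite mulf_neq0 // expf_neq0.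
  case: m {fm K0} => [|m] /=; first by ring.
  by rewrite !exprD !exprS -[m.+2]addn1 -[m.+1]addn1 !natrD; ring.
move=> x y ax ay; rewrite /separates_points => h.
rewrite (_ : _ - _ = A (P x) ^+ m * A (P y) ^+ m *
  (A (P x) * A' (P y) - A (P y) * A' (P x))); last by rewrite !exprS; ring.
by rewrite !mulf_neq0 // expf_neq0.
Qed.

(** Index 0 carries a pair that separates [x] from [y], the other indices carry pairs given by a
    finite subcover; the product of all the weights is the common weight. *)
Lemma embedding_forms x y : x <> y -> exists (K n : nat) (F G : 'I_n.+1 -> form),
  [/\ forall i, autform L K (F i) (G i),
      forall z : X, exists i j, wronskian (F i) (G i) (F j) (G j) (P z) != 0
    & exists i j, separates_points (F i) (F j) x y].
Proof.
move=> xy; have [D0 [hD0 a0 b0 sep0]] := separating_ex xy.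
have step (z : X) : exists D, pair_data D /\ local_pair D.2.1 D.2.2 z.
  (* The construction at [z] calls for a second point: it is [x], and [y] when [z] is [x]. *)
  have [zx|zx] := pselect (z = x); first by apply: (@local_pair_ex _ y); rewrite zx.
  exact: (local_pair_ex zx).
have [D hD] := choice step.
have near z : nbhs z [set z' | local_pair (D z).2.1 (D z).2.2 z'].
  by have [[_ f f'] h] := hD z; exact: local_pair_near f f' h.
have [s hs] := finite_subcover X_compact near.
pose E (j : 'I_(size s).+1) := if val j is m.+1 then D (nth x s m) else D0.
have hE j : pair_data (E j) by rewrite /E; case: (val j) => // m; have [] := hD (nth x s m).
pose K := (\prod_j (E j).1)%N.
have K0 : (0 < K)%N by apply: prodn_gt0 => j; have [] := hE j.
have EK j : ((E j).1 %| K)%N by rewrite /K (bigD1 j) //= dvdn_mulr.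
have [t ht] := choice (fun j => pair_power (hE j) K0 (EK j)).
pose F (i : 'I_((size s).+1 + (size s).+1)) := match fintype.split i with inl j => (t j).1 | inr j => (t j).2 end.
have Fl j : F (lshift _ j) = (t j).1 by rewrite /F (unsplitK (inl j)).
have Fr j : F (rshift _ j) = (t j).2 by rewrite /F (unsplitK (inr j)).
exists K, (size s + (size s).+1)%N, (fun i => (F i).1), (fun i => (F i).2); split.
- by move=> i; rewrite /F; case: fintype.split => j; have [] := ht j.
- move=> z; have [z' z's hz] := hs z.
  have lt : ((index z' s).+1 < (size s).+1)%N by rewrite ltnS index_mem.
  pose j := Ordinal lt; exists (lshift (size s).+1 j), (rshift (size s).+1 j); rewrite Fl Fr.
  by have [_ _ h _] := ht j; apply: h; rewrite /E /= nth_index.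
exists (lshift (size s).+1 ord0), (rshift (size s).+1 ord0); rewrite Fl Fr.
by have [_ _ _ h] := ht ord0; apply: h.
Qed.

End Separation.

(** * Maps to projective space *)

Section Rows.
Variables (R : realType) (n : nat).

Lemma cvg_row (I : Type) (G : set_system I) {FG : Filter G} (f : I -> 'rV[Cplx R]_n)
  (v : 'rV[Cplx R]_n) : (forall j, (fun i => f i ord0 j) @ G --> v ord0 j) -> f @ G --> v.
Proof.
move=> h A [Q hQ QA].
have : \forall i \near G, forall j, Q ord0 j (f i ord0 j).
  by apply: filter_forall => j; exact: (h j _ (hQ ord0 j)).
by apply: filterS => i hi; apply: QA => a j; rewrite ord1.
Qed.

Lemma row_derivable (g : Cplx R -> 'rV[Cplx R]_n) (z : R[i]) (d : 'rV[Cplx R]_n) :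
  (forall j, cder (fun w => g w ord0 j) z (d ord0 j)) ->
  derivable g z 1 /\ derive1 g z = d.
Proof.
move=> /choice [phi hphi].
have h : (fun h : Cplx R => h^-1 *: (g (h + z) - g z)) @ 0^' --> d.
  apply: cvg_row => j; have [cphi phid E] := hphi j => A; rewrite -phid => /nbhs_cmod[e e0 hA].
  have [r r0 hr] := cphi e e0.
  rewrite /nbhs /= /dnbhs; apply/nbhs_cmod; exists r => // w hw w0 /=.
  apply: hA; rewrite subr0 in hw; have Ew : w + z - z = w by rewrite addrK.
  rewrite !mxE E Ew mulrCA mulVf // mulr1; apply: hr; by rewrite Ew.
have h' : (fun h : Cplx R => h^-1 *: ((g \o shift z) (h *: 1) - g z)) @ 0^' --> d.
  have -> // : (fun h : Cplx R => h^-1 *: ((g \o shift z) (h *: 1) - g z)) =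
    (fun h : Cplx R => h^-1 *: (g (h + z) - g z)).
  by apply/funext => w; rewrite /= /GRing.scale /= mulr1.
split; first by apply/cvg_ex; exists d.
exact: (cvg_lim (@norm_hausdorff R[i] 'rV[Cplx R]_n) h).
Qed.

End Rows.

Section Lines.
Variables (R : realType) (N : nat).
Local Notation row := 'rV[Cplx R]_N.+1.

Definition line (v : row) (v0 : v != 0) : CP R N :=
  \pi_(quotient_topology {eq_quot @same_line R N})%qT
    (exist (fun x => x \in nonzero_vec R N) v (mem_set v0) : nonzero_vec R N).

Lemma pi_eq (u w : nonzero_vec R N) :
  \pi_(quotient_topology {eq_quot @same_line R N})%qT u =
  \pi_(quotient_topology {eq_quot @same_line R N})%qT w <->
  exists2 a : R[i], a != 0 & val u = a *: val w.
Proof.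
have h := @eqmodP _ (same_line_equivRel R N) u w.
by split => [/(introT h)/asboolP//|/asboolP/(elimT h)].
Qed.

Lemma line_eq (v w : row) (v0 : v != 0) (w0 : w != 0) :
  line v0 = line w0 <-> exists2 a : R[i], a != 0 & v = a *: w.
Proof. exact: pi_eq. Qed.

Lemma homogeneous_line (v : row) (v0 : v != 0) :
  exists2 a : R[i], a != 0 & homogeneous (line v0) = a *: v.
Proof. by have /pi_eq := reprK (line v0). Qed.

Lemma affine_chart_line (v : row) (v0 : v != 0) k :
  affine_chart k (line v0) = (v ord0 k : R[i])^-1 *: v.
Proof.
have [a a0 E] := homogeneous_line v0; rewrite /affine_chart E mxE scalerA invfM.
by rewrite mulrAC mulVf // mul1r.
Qed.

Lemma line_cvg (I : Type) (G : set_system I) {FG : Filter G} (f : I -> row) (v : row)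
  (f0 : forall i, f i != 0) (v0 : v != 0) : f @ G --> v -> (fun i => line (f0 i)) @ G --> line v0.
Proof.
move=> h A; rewrite nbhsE; case=> O [oO Ov] OA.
have [B oB BE] := oO.
have Bv : nbhs v B.
  apply: open_nbhs_nbhs; split => //.
  have : (set_val @^-1` B) (exist (fun x => x \in nonzero_vec R N) v (mem_set v0) : nonzero_vec R N).
    by rewrite BE.
  by [].
have hB : \forall i \near G, B (f i) by exact: h.
have : \forall i \near G, A (line (f0 i)); last by [].
apply: filterS hB => i Bi; apply: OA.
have : (set_val @^-1` B) (exist (fun x => x \in nonzero_vec R N) (f i) (mem_set (f0 i)) : nonzero_vec R N) by [].
by rewrite BE.
Qed.

End Lines.

Section Immersion.
Variables (R : realType) (X : topologicalType).
Hypotheses (X_compact : compact [set: X]) (X_hausdorff : hausdorff_space X).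
Variable L : lamination R X.
Variable P : X -> R[i] -> X.
Hypotheses (P_unif : forall x, unif L (P x)) (P0 : forall x, P x 0 = x).
Local Notation form := ((R[i] -> X) -> R[i]).
Variables (K n : nat) (F G : 'I_n.+1 -> form).
Hypothesis FG : forall i, autform L K (F i) (G i).
Hypothesis W : forall x, exists i j, wronskian (F i) (G i) (F j) (G j) (P x) != 0.

Definition forms_row (p : R[i] -> X) : 'rV[Cplx R]_n.+1 := \row_i F i p.

Lemma forms_row_neq0 x : forms_row (P x) != 0.
Proof.
have [i [j]] := W x; apply: contra => /eqP E.
have F0 k : F k (P x) = 0 by have := congr1 (fun v : 'rV_n.+1 => v ord0 k) E; rewrite !mxE.
by rewrite /wronskian !F0 mul0r mulr0 subr0.
Qed.

Definition forms_map x : CP R n := line (forms_row_neq0 x).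

(** Another uniformization with the same base point differs by a rotation, which multiplies all
    coordinates by the same factor. *)
Lemma forms_row_unif p : unif L p -> exists2 a : R[i], a != 0 & forms_row p = a *: forms_row (P (p 0)).
Proof.
move=> up; have [e e1 pe] := unif_rotation (P_unif (p 0)) up (P0 (p 0)).
exists (e ^+ K); first by rewrite expf_neq0 // -cmod_gt0 e1.
apply/rowP => i; rewrite !mxE; have [rot _ _] := FG i.
have ue := unif_rot (P_unif (p 0)) e1.
by rewrite (autform_ext (FG i) up ue pe) rot.
Qed.

(** Along an ultrafilter the rows converge only up to the factor e^K, which does not change the
    line. *)
Lemma forms_map_continuous : continuous forms_map.
Proof.
move=> x A hA; apply: ultra_nbhs => H UH Hx.
have [e e1 he] := form_lim X_compact X_hausdorff P_unif P0 UH Hx.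
have e0 : e ^+ K != 0 by rewrite expf_neq0 // -cmod_gt0 e1.
have v0 : e ^+ K *: forms_row (P x) != 0 by rewrite scaler_eq0 negb_or e0 forms_row_neq0.
have E : forms_map x = line v0.
  by apply/line_eq; exists (e ^+ K)^-1; rewrite ?invr_eq0 // scalerA mulVf // scale1r.
have lim : (fun y => forms_row (P y)) @ H --> (e ^+ K *: forms_row (P x) : 'rV[Cplx R]_n.+1).
  apply: cvg_row => j; rewrite mxE mxE.
  have [/climP h _] := he _ _ _ (FG j).
  have -> // : (fun y => forms_row (P y) ord0 j) = (fun y => F j (P y)).
  by apply/funext => y; rewrite mxE.
rewrite E in hA; exact: (@line_cvg R n X H _ (fun y => forms_row (P y)) _ forms_row_neq0 v0 lim A hA).
Qed.

(** The plaque through [x] lifts by psi to the disc of [P x], where the coordinates of the map are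
    the holomorphic functions [h] of the forms up to a common factor. *)
Lemma forms_map_immersion : leafwise_holomorphic_immersion L forms_map.
Proof.
move=> c t z k Lc; rewrite unit_discE => z1 hk g.
set x := fb_inv c (z, t) in hk; have xE : x = iv c z t by [].
have dx : fb_dom c (P x 0) by rewrite P0 xE; exact: iv_dom.
have z01 : cmod (0 : R[i]) < 1 by rewrite cmod0.
have [psi [dpsi psi0 psiP]] := (P_unif x).2 0 c z01 Lc dx.
rewrite P0 xE tc_iv // in psiP; rewrite P0 xE zc_iv // in psi0.
have [[d hd] _] := dpsi z z1.
have [d' hd' d'0] := unif_der (P_unif x) z01 Lc dx.
have d0 : d != 0.
  have hc : cder (zc c \o P x \o psi) z (d' * d) by apply: cder_comp => //; rewrite psi0.
  have r0 : 0 < 1 - cmod z by rewrite subr_gt0.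
  have : cder id z (d' * d).
    apply: cder_near r0 _ hc => w hw /=.
    have w1 : cmod w < 1 by have := cmod_lerB w z; lra.
    by rewrite psiP // zc_iv.
  move=> /(cder_uniq (cder_id z)) E; apply/eqP => d0; move: E; rewrite d0 mulr0 => /eqP.
  by rewrite oner_eq0.
have Fk : F k (P x) != 0.
  have [a a0 E] := homogeneous_line (forms_row_neq0 x).
  by move: hk; rewrite /forms_map E !mxE mulf_eq0 negb_or => /andP[].
have [h hh] := choice (fun i => let: And3 _ e _ := FG i in e (P x) (P_unif x)).
have half : 0 < 1 / 2 :> R by rewrite divr_gt0.
have [r r0 hr] := cder_cont hd half.
rewrite psi0 in hr.
have m0 : 0 < Num.min r (1 - cmod z) by rewrite lt_min r0 subr_gt0.
(* The factor (1 - |u|^2)^K, which is not holomorphic, and the rotation factor [a] are common to all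
   coordinates and cancel in the affine chart. *)
have gE w j : cmod (w - z) < Num.min r (1 - cmod z) -> h j (psi w) / h k (psi w) = g w ord0 j.
  rewrite lt_min => /andP[/hr]; rewrite subr0 => u1 wz.
  have w1 : cmod w < 1 by have := cmod_lerB w z; lra.
  set u := psi w in u1 *; have u1' : cmod u < 1 by lra.
  have uq := unif_mob (P_unif x) u1'.
  have [a a0] := forms_row_unif uq; rewrite /= mob0 psiP // => E.
  have sc : (1 - cmod u ^+ 2)%:C ^+ K != 0 :> R[i].
    by rewrite expf_neq0 // -cmod_gt0 cmodC gtr0_norm; exact: cmod_sq_gt0.
  have FE i : (1 - cmod u ^+ 2)%:C ^+ K * h i u = a * F i (P (iv c w t)).
    have [_ _ <- //] := hh i.
    by have := congr1 (fun v : 'rV[Cplx R]_n.+1 => v ord0 i) E; rewrite !mxE.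
  rewrite /g /forms_map affine_chart_line !mxE -/(iv c w t).
  have -> : h j u / h k u = ((1 - cmod u ^+ 2)%:C ^+ K * h j u) / ((1 - cmod u ^+ 2)%:C ^+ K * h k u).
    by rewrite invfM mulrACA divff // mul1r.
  by rewrite !FE invfM mulrACA divff // mul1r mulrC.
pose D : 'rV[Cplx R]_n.+1 :=
  \row_j ((G j (P x) * F k (P x) - F j (P x) * G k (P x)) / F k (P x) ^+ 2 * d).
have hD j : cder (fun w => g w ord0 j) z (D ord0 j).
  apply: (cder_near m0 (fun w => @gE w j)).
  have [dj j0 _] := hh j; have [dk k0 _] := hh k.
  rewrite mxE; apply: (@cder_comp _ (fun u => h j u / h k u) psi); first exact: hd.
  have hk0 : h k 0 != 0 by rewrite k0.
  rewrite psi0; have := cderM dj (cderV hk0 dk); rewrite k0 j0.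
  by congr cder; field.
have [g1 g2] := row_derivable hD; split; first exact: g1.
rewrite g2; apply/negP => /eqP E.
(* A vanishing derivative makes the vector of the [G j] proportional to that of the [F j], with the
   ratio G k / F k; then every Wronskian at [P x] vanishes. *)
have GE j : G j (P x) * F k (P x) = F j (P x) * G k (P x).
  have := congr1 (fun v : 'rV[Cplx R]_n.+1 => v ord0 j) E; rewrite !mxE => /eqP.
  rewrite mulf_eq0 (negbTE d0) orbF mulf_eq0 invr_eq0 expf_eq0 /= (negbTE Fk) orbF.
  by rewrite subr_eq0 => /eqP.
have [i [j /negP]] := W x; apply; apply/eqP; apply: (mulIf Fk); rewrite mul0r /wronskian.
by rewrite mulrBl -mulrA GE mulrAC GE; ring.
Qed.

End Immersion.

Theorem mainTheorem14 (R : realType) (X : topologicalType)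
  (X_compact : compact [set: X]) (X_hausdorff : hausdorff_space X)
  (L : lamination R X) (L_hyperbolic : hyperbolic L) : projective L.
Proof.
have step x : exists p : R[i] -> X, unif L p /\ p 0 = x.
  by have [p up p0] := hyperbolic_unif L_hyperbolic x; exists p.
have [P hP] := choice step.
have P_unif x : unif L (P x) by have [] := hP x.
have P0 x : P x 0 = x by have [] := hP x.
move=> x y xy.
have [K [n [F [G [FG W [i [j sep]]]]]]] := embedding_forms X_compact X_hausdorff P_unif P0 xy.
exists n, (forms_map W); split.
- exact: (forms_map_continuous X_compact X_hausdorff P_unif P0 FG).
- exact: (forms_map_immersion P_unif P0 FG).
move=> /line_eq[a a0 E]; move: sep; rewrite /separates_points.
have E' k : F k (P x) = a * F k (P y).
  by have := congr1 (fun v : 'rV[Cplx R]_n.+1 => v ord0 k) E; rewrite !mxE.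
by rewrite !E' (_ : _ - _ = 0) ?eqxx //; ring.
Qed.
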